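(* Let $g:[0,T]\times E\to\mathbb R_+$ be bounded and Borel, written $g_s(x)$, and let $\psi_g:[0,T]\times E\to\mathbb R_+$ be the unique bounded non-negative Borel solution of $$\psi_g(s,y)=G_g(s,y)+\lambda_1\int_s^T\int_EK(r-s,y',y)\,F\bigl(\psi_g(r,y')\bigr)\,m(dy')\,dr,\qquad(s,y)\in[0,T]\times E.$$ Then $$\mathbb E\left[\exp\left(-\int_0^T\langle g_s,V_s\rangle\,ds\right)\right]=\exp\left(-\int_0^T\langle g_s,\phi_s\rangle\,ds-\int_0^T\int_E\bigl(\lambda_0+\lambda_1\phi_s(y)\bigr)F\bigl(\psi_g(s,y)\bigr)\,m(dy)\,ds\right),$$ where the integrals in the exponent are finite.
   Context: Fix a complete probability space $(\Omega,\mathcal F,\mathbb P)$, a horizon $T>0$, and a Polish space $E$ with Borel $\sigma$-algebra $\mathcal E$ and a finite Borel measure $m$. Write $\mathbb R_+=[0,\infty)$. Let $\ell$ be a Borel measure supported on $(0,\infty)$ with $\overline z:=\int_0^\infty z\,\ell(dz)<\infty$, and let $N$ be a Poisson random measure on $[0,T]\times E\times\mathbb R_+\times\mathbb R_+$ with intensity $ds\,m(dy)\,\ell(dz)\,du$. Let $\mathcal F_t^0$ be generated by $N((0,s]\times B)$, $s\le t$, $B$ Borel, augmented with all $\mathbb P$-null sets, and put $\mathcal F_t^N=\bigcap_{r\in(t,T]}\mathcal F_r^0$ for $t<T$, $\mathcal F_T^N=\mathcal F_T^0$. The predictable $\sigma$-algebra $\mathcal P$ on $\Omega\times[0,T]\times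 E$ is generated by the sets $A_0\times\{0\}\times B$ and $A\times(s,t]\times B$ with $A_0\in\mathcal F_0^N$, $A\in\mathcal F_s^N$, $B\in\mathcal E$; a field is predictable if it is $\mathcal P$-measurable. $K:(0,T]\times E\times E\to\mathbb R_+$ is an admissible kernel: Borel, with $k(r):=\sup_{x}\int_EK(r,x,y)\,m(dy)$ Borel measurable and in $L^1((0,T])$; set $K(0,x,y):=0$. In addition (standing assumption), the dual majorant $\widetilde k(r):=\sup_{y\in E}\int_EK(r,x,y)\,m(dx)$ is Borel measurable on $(0,T]$ with $\int_0^T\widetilde k(r)\,dr<\infty$. $\lambda_0,\lambda_1\ge0$ are constants, $\phi:[0,T]\times E\to\mathbb R_+$ is bounded and measurable. $V$ is the non-negative predictable field (with values in $[0,\infty]$, a.s. finite at each $(t,x)$, unique up to modification) with $\sup_{(t,x)}\mathbb E[V_t(x)]<\infty$ such that, for every $(t,x)\in[0,T]\times E$, almost surely $V_t(x)=\phi_t(x)+\int_{(0,t)\times E\times\mathbb R_+\times\mathbb R_+}K(t-s,x,y)\,z\,\mathbf 1_{\{u\le\lambda_0+\lambda_1V_s(y)\}}N(ds,dy,dz,du)$. Notation: $\langle f,h\rangle=\int_Ef(x)h(x)\,m(dx)$; $F(q)=\int_0^\infty(1-e^{-qz})\,\ell(dz)$, $q\ge0$; $G_g(s,y)=\int_s^T\int_Eg_r(x)K(r-s,x,y)\,m(dx)\,dr$ for $(s,y)\in[0,T]\times E$. The equation for $\psi_g$ has exactly one bounded non-negative Borel solution. *)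

(* Defs.v *)
From HB Require Import structures.
From mathcomp Require Import all_boot all_order all_algebra.
From mathcomp Require Import all_classical all_reals all_analysis.
From mathcomp Require Import measurable_realfun.

Set Implicit Arguments.
Unset Strict Implicit.
Unset Printing Implicit Defensive.

Import Order.TTheory GRing.Theory Num.Theory.
Import numFieldNormedType.Exports.

Local Open Scope classical_set_scope.
Local Open Scope ring_scope.

Notation borel E := (g_sigma_algebraType (@open E)).

(* The distance takes values in [R]; it is not part of the structure of [E],
   which is only a topological space. *)
Definition polish (R : realType) (E : topologicalType) : Prop :=
  (exists2 A : set E, countable A & dense A) /\
  exists dist : E -> E -> R,
    [/\ forall x y, dist x y = 0 <-> x = y,
        forall x y, dist x y = dist y x,
        forall x y z, dist x z <= dist x y + dist y z,
        forall x (U : set E), nbhs x U <->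
          exists2 e : R, 0 < e & [set y | dist x y < e] `<=` U &
        forall u : nat -> E,
          (forall e : R, 0 < e -> exists n0, forall i j,
             (n0 <= i)%N -> (n0 <= j)%N -> dist (u i) (u j) < e) ->
          exists x : E, u @ \oo --> x].

Section poisson_random_measure.
Context (R : realType) (d d' : measure_display).
Context (Omega : measurableType d) (X : measurableType d').
Local Open Scope ereal_scope.

(* [N] is a Poisson random measure on the measurable set [D] with intensity
   [nu]; what [N] does outside [D] is irrelevant.  The Poisson law of parameter
   0 is the Dirac mass at 0, and that of parameter +oo the Dirac mass at +oo.
   The [0%N] passed to [poisson_prob] is a dummy argument of that definition. *)
Definition poisson_random_measure (P : probability Omega R)
    (D : set X) (nu : set X -> \bar R) (N : R.-ker Omega ~> X) : Prop :=
  [/\ forall B, measurable B -> B `<=` D -> nu B < +oo ->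
        forall k : nat, P [set w | N w B = k%:R%:E] =
                        poisson_prob (fine (nu B)) 0%N [set k],
      forall B, measurable B -> B `<=` D -> nu B = +oo ->
        {ae P, forall w, N w B = +oo} &
      forall (n : nat) (B : 'I_n -> set X),
        (forall i, measurable (B i)) -> (forall i, B i `<=` D) ->
        trivIset setT B ->
        forall C : 'I_n -> set (\bar R), (forall i, measurable (C i)) ->
          P (\bigcap_i [set w | C i (N w (B i))]) =
          \prod_(i < n) P [set w | C i (N w (B i))]].

End poisson_random_measure.

Section model.
Context (R : realType) (E : ptopologicalType).
Context (d : measure_display) (Omega : measurableType d).
Local Open Scope ereal_scope.

Local Notation mu := (@lebesgue_measure R).

(* Atoms of [N] are written (s, (y, (z, u))). *)
Local Notation marks := (borel E * (R * R))%type.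
Local Notation atoms := (R * (borel E * (R * R)))%type.

Definition mark_space : set marks :=
  [set: borel E] `*` (`[0%R, +oo[ `*` `[0%R, +oo[).

Definition atom_space (T : R) : set atoms := `[0%R, T] `*` mark_space.

(* [\x] is an iterated integral, whose inner integrals are over the second
   factor.  It is the product measure when [l] is sigma-finite, which holds as
   soon as [l] has a finite first moment and no mass on ]-oo, 0]. *)
Definition intensity (m : set (borel E) -> \bar R) (l : set R -> \bar R) :
  set atoms -> \bar R := mu \x (m \x (l \x mu)).

Section filtration.
Context (P : probability Omega R) (N : R.-ker Omega ~> atoms) (T : R).

Definition raw_filtration (t : R) : set (set Omega) :=
  <<s [set A | exists (s : R) (B : set marks) (C : set (\bar R)),
         [/\ (0 <= s <= t)%R, measurable B, B `<=` mark_space, measurable C &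
             A = [set w | C (N w (`]0%R, s] `*` B))]]]
      `|` P.-negligible >>.

Definition filtration (t : R) : set (set Omega) :=
  if (t < T)%R then \bigcap_(r in `]t, T]) raw_filtration r
  else raw_filtration T.

Definition predictable_algebra : set (set (Omega * R * borel E)) :=
  <<s [set: Omega] `*` `[0%R, T] `*` [set: borel E],
      [set X | exists A (B : set (borel E)),
         [/\ filtration 0 A, measurable B & X = A `*` [set 0%R] `*` B]]
      `|` [set X | exists A (B : set (borel E)) (s t : R),
         [/\ (0 <= s)%R, (s < t)%R, (t <= T)%R &
             [/\ filtration s A, measurable B & X = A `*` `]s, t] `*` B]]] >>.

Definition predictable (V : Omega -> R -> borel E -> \bar R) : Prop :=
  forall C : set (\bar R), measurable C ->
    predictable_algebra
      [set p | (0 <= p.1.2 <= T)%R /\ C (V p.1.1 p.1.2 p.2)].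

End filtration.

Definition kernel_majorant (m : set (borel E) -> \bar R)
    (K : R -> borel E -> borel E -> R) (r : R) : \bar R :=
  ereal_sup (range (fun x => \int[m]_y (K r x y)%:E)).

Definition dual_majorant (m : set (borel E) -> \bar R)
    (K : R -> borel E -> borel E -> R) (r : R) : \bar R :=
  ereal_sup (range (fun y => \int[m]_x (K r x y)%:E)).

(* Integrability on ]0, T] includes measurability there.  Kernels are total
   functions of the time variable, of which only the values on [0, T] matter. *)
Definition admissible_kernel (T : R) (m : set (borel E) -> \bar R)
    (K : R -> borel E -> borel E -> R) : Prop :=
  [/\ forall (r : R) x y, (0 < r <= T)%R -> (0 <= K r x y)%R,
      measurable_fun (`]0%R, T] `*` [set: borel E * borel E])
        (fun p => K p.1 p.2.1 p.2.2),
      mu.-integrable `]0%R, T] (kernel_majorant m K) &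
      forall x y, K 0%R x y = 0%R].

Definition bounded_nonneg_borel (T : R) (f : R -> borel E -> R) : Prop :=
  [/\ measurable_fun (`[0%R, T] `*` [set: borel E]) (fun p => f p.1 p.2),
      forall (t : R) x, (0 <= t <= T)%R -> (0 <= f t x)%R &
      exists M : R, forall (t : R) x, (0 <= t <= T)%R -> (f t x <= M)%R].

(* The jump condition on u is compared in [\bar R], as V may be infinite, with
   the convention 0 * +oo = 0. *)
Definition volterra_equation (P : probability Omega R)
    (N : R.-ker Omega ~> atoms) (T : R) (K : R -> borel E -> borel E -> R)
    (lambda0 lambda1 : R) (phi : R -> borel E -> R)
    (V : Omega -> R -> borel E -> \bar R) : Prop :=
  forall (t : R) x, (0 <= t <= T)%R ->
    {ae P, forall w, V w t x = (phi t x)%:E +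
      \int[N w]_(p in `]0%R, t[ `*` mark_space)
        (let: (s, (y, (z, u))) := p in
         (K (t - s) x y * z *
          (u%:E <= lambda0%:E + lambda1%:E * V w s y)%E%:R)%:E)}.

Definition pairing (m : set (borel E) -> \bar R) (f h : borel E -> \bar R) :
  \bar R := \int[m]_x (f x * h x).

Definition laplace_exponent (l : set R -> \bar R) (q : R) : \bar R :=
  \int[l]_(z in `]0%R, +oo[) (1 - expR (- (q * z)))%:E.

Definition dual_source (T : R) (m : set (borel E) -> \bar R)
    (K : R -> borel E -> borel E -> R) (g : R -> borel E -> R)
    (s : R) (y : borel E) : \bar R :=
  \int[mu]_(r in `[s, T]) \int[m]_x (g r x * K (r - s) x y)%:E.

Definition dual_equation (T : R) (m : set (borel E) -> \bar R)
    (l : set R -> \bar R) (K : R -> borel E -> borel E -> R) (lambda1 : R)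
    (g psi : R -> borel E -> R) : Prop :=
  forall (s : R) y, (0 <= s <= T)%R ->
    (psi s y)%:E = dual_source T m K g s y +
      lambda1%:E * \int[mu]_(r in `[s, T])
        \int[m]_y' ((K (r - s) y' y)%:E * laplace_exponent l (psi r y')).

End model.

(* Main.v *)
Require Import Defs.
From HB Require Import structures.
From mathcomp Require Import all_boot all_order all_algebra.
From mathcomp Require Import all_classical all_reals all_analysis.
From mathcomp Require Import measurable_realfun.
From mathcomp Require Import ring lra.

(* Let A_t be the integral over [0, t] x E of (lambda0 + lambda1 V) F(psi) and
   let X be the sum of psi(s, y) z over the accepted atoms.  Integrating the
   Volterra equation against g and against lambda1 F(psi), the equation of psi
   gives  X + <g, phi> + I_psi = <g, V> + A_T  pathwise, so that the formula is
   equivalent to  E[exp(-X + A_T)] = 1,  the exponential formula for the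
   predictable set of accepted atoms.  For finite unions of
   rectangles it follows, backwards in time, from the Laplace functional of N
   and the independence of its past and its future; it extends to predictable
   sets by approximation in measure.  It applies to the atoms accepted while
   A_s <= k, which keeps the compensator bounded; since psi solves a dual
   equation and K vanishes at nonpositive times, the stopped A is at most
   I_psi + X, and k can go to infinity by dominated convergence. *)

Set Implicit Arguments.
Unset Strict Implicit.
Unset Printing Implicit Defensive.

Import Order.TTheory GRing.Theory Num.Theory.
Import numFieldNormedType.Exports.

Local Open Scope classical_set_scope.
Local Open Scope ring_scope.
Local Open Scope ereal_scope.

Definition expN {R : realType} (x : \bar R) : \bar R := expeR (- x).

Section expN.
Context {R : realType}.
Implicit Types x y : \bar R.

Lemma expN_ge0 x : 0 <= expN x. Proof. exact: expeR_ge0. Qed.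

Lemma expN0 : expN 0 = 1 :> \bar R.
Proof. by rewrite /expN oppe0 expeR0. Qed.

Lemma expNy : expN +oo = 0 :> \bar R. Proof. by []. Qed.

Lemma expN_le1 x : 0 <= x -> expN x <= 1.
Proof. by move=> x0; rewrite -expeR0 lee_expeR oppe_le0. Qed.

Lemma expND x y : 0 <= x -> 0 <= y -> expN (x + y) = expN x * expN y.
Proof. by move=> x0 y0; rewrite /expN oppeD ?ge0_adde_def ?inE// expeRD. Qed.

Lemma expN_fin x : 0 <= x -> expN x \is a fin_num.
Proof.
move=> x0; rewrite ge0_fin_numE ?expN_ge0//.
by apply: (le_lt_trans (expN_le1 x0)); rewrite ltry.
Qed.

Lemma le_expN x y : x <= y -> expN y <= expN x.
Proof. by move=> xy; rewrite lee_expeR leeN2. Qed.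

Lemma measurable_expeR : measurable_fun [set: \bar R] (@expeR R).
Proof.
apply: (measurability _ (ErealGenOInfty.measurableE R)).
move=> _ [_ [a ->] <-]; rewrite setTI.
have [a0|a0] := ltP a 0%R.
  rewrite (_ : _ @^-1` _ = setT)//; apply/seteqP; split => // x _ /=.
  by rewrite in_itv/= andbT; apply: (lt_le_trans _ (expeR_ge0 x)); rewrite lte_fin.
have [y ya] := expeR_total (a0 : 0 <= a%:E).
rewrite (_ : _ @^-1` _ = [set` `]y, +oo[]); last first.
  by apply/seteqP; split => x /=; rewrite !in_itv/= !andbT -ya lte_expeR.
exact: emeasurable_itv.
Qed.

Lemma measurable_expN d (T : measurableType d) (D : set T) (f : T -> \bar R) :
  measurable_fun D f -> measurable_fun D (fun t => expN (f t)).
Proof.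
move=> mf; apply: (measurableT_comp measurable_expeR) => //.
exact: measurableT_comp.
Qed.

Lemma cvg_expN (u : nat -> \bar R) x : 0 <= x -> u @ \oo --> x ->
  (fun n => expN (u n)) @ \oo --> expN x.
Proof.
case: x => [r| |] // r0 ux.
- move: (ux) => /fine_cvgP[ufin ucvg]; apply/fine_cvgP; split.
    near=> n; have : u n \is a fin_num by near: n; exact: ufin.
    by case: (u n).
  rewrite /expN /=.
  have h : (fun n => expR (- fine (u n))) @ \oo --> expR (- r).
    apply: continuous_cvg; first exact: continuous_expR.
    exact: cvgN.
  apply: cvg_trans h; apply: near_eq_cvg.
  near=> n; have : u n \is a fin_num by near: n; exact: ufin.
  by rewrite /=; case: (u n).
- rewrite expNy; apply/fine_cvgP; split.
    near=> n; apply: expN_fin.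
    by near: n; move/cvgeyPge : ux => /(_ 0%R).
  apply/cvgrPdist_le => e e0.
  near=> n; rewrite sub0r normrN.
  have un : (- ln e)%:E <= u n by near: n; move/cvgeyPge : ux; exact.
  have := le_expN un; rewrite {2}/expN /= opprK lnK ?posrE// => h.
  have := expN_ge0 (u n); rewrite /=.
  move: h; case: (expN (u n)) => [s| |] //=; rewrite ?lee_fin// => ? ?.
  by rewrite ger0_norm.
Unshelve. all: by end_near. Qed.

End expN.

Section ge0_ind.
Context d (T : measurableType d) (R : realType).
Import HBNNSimple.

Lemma ge0_measurable_ind (Q : (T -> \bar R) -> Prop) :
  (forall A, measurable A -> Q (fun x => (\1_A x)%:E)) ->
  (forall f g, measurable_fun setT f -> measurable_fun setT g ->
    (forall x, 0 <= f x) -> (forall x, 0 <= g x) -> Q f -> Q g ->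
    Q (fun x => f x + g x)) ->
  (forall (k : R) f, (0 <= k)%R -> measurable_fun setT f ->
    (forall x, 0 <= f x) -> Q f -> Q (fun x => k%:E * f x)) ->
  (forall f : (T -> \bar R)^nat, (forall n, measurable_fun setT (f n)) ->
    (forall n x, 0 <= f n x) -> (forall x, nondecreasing_seq (f ^~ x)) ->
    (forall n, Q (f n)) -> Q (fun x => limn (f ^~ x))) ->
  forall f, measurable_fun setT f -> (forall x, 0 <= f x) -> Q f.
Proof.
move=> Q1 QD QZ Qlim f mf f0.
pose f_ := nnsfun_approx measurableT mf.
have -> : f = (fun x => limn (fun n => (f_ n x)%:E)).
  by apply/funext => x; apply/esym/cvg_lim => //; apply: cvg_nnsfun_approx.
apply: Qlim.
- by move=> n; exact/measurable_EFinP.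
- by move=> n x; rewrite lee_fin.
- by move=> x m n mn; rewrite lee_fin; exact/lefP/nd_nnsfun_approx.
move=> n; set g := f_ n; pose s0 := finmap.enum_fset (fset_set (range g)).
have -> : (fun x => (g x)%:E) = (fun x => \sum_(r <- s0)
    (r%:E * (\1_(g @^-1` [set r]) x)%:E)).
  apply/funext => x; rewrite fimfunE fsbig_finite//= -sumEFin.
  by apply: eq_bigr => r _.
have Hp r x : r \in s0 -> 0 <= r%:E * (\1_(g @^-1` [set r]) x)%:E :> \bar R.
  by rewrite /s0 in_fset_set// inE => -[t _ <-]; rewrite mule_ge0// lee_fin.
have mr r : measurable_fun setT (fun x => r%:E * (\1_(g @^-1` [set r]) x)%:E).
  apply: measurable_funeM; apply/measurable_EFinP; apply: measurable_indic.
  by apply: measurable_sfunP.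
suff H (s : seq R) : {subset s <= s0} ->
  Q (fun x => \sum_(r <- s) (r%:E * (\1_(g @^-1` [set r]) x)%:E)) by exact: H.
elim: s => [_|r s ih sub].
  have -> : (fun x : T => \sum_(r <- [::]) (r%:E * (\1_(g @^-1` [set r]) x)%:E)) =
     (fun x => (\1_(@set0 T) x)%:E).
    by apply/funext => x; rewrite big_nil indicE in_set0.
  exact: (Q1 _ measurable0).
have rg : r \in s0 by apply: sub; rewrite mem_head.
have sg : {subset s <= s0}.
  by move=> y ys; apply: sub; rewrite in_cons ys orbT.
have -> : (fun x => \sum_(r0 <- (r :: s)) (r0%:E * (\1_(g @^-1` [set r0]) x)%:E)) =
  (fun x => r%:E * (\1_(g @^-1` [set r]) x)%:E +
    \sum_(r0 <- s) (r0%:E * (\1_(g @^-1` [set r0]) x)%:E)).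
  by apply/funext => x; rewrite big_cons.
apply: QD => //.
- exact: emeasurable_sum.
- by move=> x; exact: Hp.
- by move=> x; rewrite big_seq; apply: sume_ge0 => i /sg; exact: Hp.
- apply: QZ => //.
  + by move: rg; rewrite /s0 in_fset_set// inE => -[t _ <-].
  + by apply/measurable_EFinP/measurable_indic.
  + have := Q1 (g @^-1` [set r]); apply; exact: measurable_sfunP.
- exact: ih.
Qed.

End ge0_ind.

Lemma ae_eq_ge0_integral d (T : measurableType d) (R : realType)
    (mu : {measure set T -> \bar R}) (f g : T -> \bar R) :
  measurable_fun setT f -> measurable_fun setT g ->
  (forall x, 0 <= f x) -> (forall x, 0 <= g x) ->
  {ae mu, forall x, f x = g x} -> \int[mu]_x f x = \int[mu]_x g x.
Proof.
move=> mf mg f0 g0 fg; apply: ge0_ae_eq_integral => //.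
by apply: filterS fg => x fgx _.
Qed.

Lemma bounded_cvg_integral d (T : measurableType d) (R : realType)
    (P : {finite_measure set T -> \bar R}) (F_ : (T -> \bar R)^nat)
    (F : T -> \bar R) (c : R) :
  (forall n, measurable_fun setT (F_ n)) -> measurable_fun setT F ->
  (forall n x, 0 <= F_ n x) ->
  {ae P, forall x, F_ ^~ x @ \oo --> F x} ->
  {ae P, forall x, forall n, F_ n x <= c%:E} ->
  (fun n => \int[P]_x F_ n x) @ \oo --> \int[P]_x F x.
Proof.
move=> mF_ mF F0 FF Fc.
have [| | |_ _ //] := @dominated_convergence _ _ _ P setT measurableT F_ F
  (EFin \o cst c) mF_ mF.
- by apply: filterS FF => x Fx _.
- exact: finite_measure_integrable_cst.
- by apply: filterS Fc => x Fx n _; rewrite gee0_abs.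
Qed.

Lemma measurable_bool_natr d (T : measurableType d) (R : realType) (b : T -> bool) :
  measurable_fun setT b -> measurable_fun setT (fun x => (b x)%:R : R).
Proof.
by move=> mb; apply: (@measurableT_comp _ _ _ _ _ _ (fun b : bool => b%:R : R)).
Qed.

Section counting_variable.
Context d (Omega : measurableType d) (R : realType) (P : probability Omega R).
Variable X : Omega -> \bar R.
Hypothesis mX : measurable_fun setT X.

Let mXk k : measurable (X @^-1` [set k]).
Proof. by rewrite -[X in measurable X]setTI; exact: mX. Qed.

Lemma expectation_count (phi : \bar R -> \bar R) :
  {ae P, forall w, exists k : nat, X w = k%:R%:E} ->
  measurable_fun setT phi -> (forall x, 0 <= phi x) ->
  \int[P]_w phi (X w) =
    \sum_(k <oo) phi k%:R%:E * P [set w | X w = k%:R%:E].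
Proof.
move=> Xae mphi phi0.
pose F (k : nat) := X @^-1` [set k%:R%:E].
have mF k : measurable (F k) by exact: mXk.
have mD : measurable (\bigcup_k F k) by exact: bigcup_measurable.
have mphiX : measurable_fun setT (phi \o X) by exact: measurableT_comp.
transitivity (\int[P]_(w in \bigcup_k F k) phi (X w)).
  rewrite [RHS]integral_mkcond; apply: ae_eq_ge0_integral => //.
  - apply/(measurable_restrictT _ mD).1; exact: measurable_funTS.
  - by move=> w; rewrite patchE; case: ifP.
  - apply: filterS Xae => w [k Xk]; rewrite patchE mem_set//.
    by exists k.
rewrite ge0_integral_bigcup//.
- apply: eq_eseriesr => k _.
  rewrite -integral_cst; last exact: mXk.
  by apply: eq_integral => w; rewrite inE => /= ->.
- exact: measurable_funTS.
- apply/trivIsetP => i j _ _ ij; rewrite -subset0 => w []; rewrite /F /= => -> [] /eqP.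
  by rewrite eqr_nat (negbTE ij).
Qed.

Lemma expN_poisson (lam a : R) : (0 <= lam)%R -> (0 <= a)%R ->
  (forall k : nat, P [set w | X w = k%:R%:E] = poisson_prob lam 0%N [set k]) ->
  (forall w, 0 <= X w) ->
  {ae P, forall w, exists k : nat, X w = k%:R%:E} /\
  \int[P]_w expN (a%:E * X w) = expN (lam * (1 - expR (- a)))%:E.
Proof.
move=> lam0 a0 Xlaw X0.
pose F (k : nat) := X @^-1` [set k%:R%:E].
have mF k : measurable (F k) by exact: mXk.
have Xae : {ae P, forall w, exists k : nat, X w = k%:R%:E}.
  have eF : ~` [set w | exists k : nat, X w = k%:R%:E] = ~` (\bigcup_k F k).
    by congr (~` _); apply/seteqP; split=> w /= [k]; [exists k|exists k].
  have mCF : measurable (~` (\bigcup_k F k)).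
    by apply/measurableC/bigcup_measurable.
  have PC : P (~` (\bigcup_k F k)) = 0.
    rewrite probability_setC; last exact: bigcup_measurable.
    suff -> : P (\bigcup_k F k) = 1 by rewrite subee.
    rewrite measure_bigcup//=; last first.
      apply/trivIsetP => i j _ _ ij; rewrite -subset0 => w []; rewrite /F /= => -> [] /eqP.
      by rewrite eqr_nat (negbTE ij).
    transitivity (poisson_prob lam 0%N (\bigcup_k [set k])).
      rewrite measure_bigcup//=.
      - by apply: eq_eseriesr => k _; exact: Xlaw.
      - by apply/trivIsetP => i j _ _ ij; rewrite -subset0 => w [/= -> /eqP]; rewrite (negbTE ij).
    rewrite (_ : \bigcup_k [set k] = setT); first exact: probability_setT.
    by apply/seteqP; split => // k _; exists k.
  by rewrite /almost_everywhere; apply: (negligibleS _ ((negligibleP _ mCF).2 PC)); rewrite -eF.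
split => //.
transitivity (\int[P]_w (fun x => expN (a%:E * `|x|)) (X w)).
  by apply: eq_integral => w _; rewrite gee0_abs.
rewrite (expectation_count (phi := fun x => expN (a%:E * `|x|)) Xae); last 2 first.
- by apply: measurable_expN; apply: measurable_funeM; exact: abse_measurable.
- by move=> x; exact: expN_ge0.
transitivity (\sum_(k <oo) (expR (- a * k%:R))%:E * poisson_prob lam 0%N [set k]).
  by apply: eq_eseriesr => k _; rewrite -Xlaw /expN /= ger0_norm// mulNr.
rewrite /poisson_prob; have [lam_gt0|lam_le0] := ltP 0%R lam; last first.
  have -> : lam = 0%R by apply/le_anti; rewrite lam_le0 lam0.
  rewrite mul0r expN0 (@nneseriesD1 _ _ 0%N)//; last first.
    by move=> k _; rewrite mule_ge0.
  rewrite mulr0 expR0 mul1e diracE mem_set// eseries0 ?adde0// => k _ k0.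
  by rewrite diracE memNset ?mule0// => /= k0'; move: k0; rewrite -k0' eqxx.
transitivity (\sum_(k <oo) (expR (- lam))%:E * (((expR (- a) * lam) ^+ k) / k`!%:R)%:E).
  apply: eq_eseriesr => k _.
  rewrite esum_set1; last by rewrite lee_fin poisson_pmf_ge0.
  rewrite /poisson_pmf lam_gt0 -!EFinM; congr EFin.
  by rewrite expRM_natr exprMn; ring.
rewrite nneseriesZl; last first.
  by move=> n _; rewrite lee_fin divr_ge0// exprn_ge0// mulr_ge0// expR_ge0.
transitivity ((expR (- lam))%:E * (expR (expR (- a) * lam))%:E).
  congr *%E; rewrite expRE -EFin_lim; last first.
    rewrite /pseries/=; under eq_fun do rewrite mulrC.
    exact: is_cvg_series_exp_coeff.
  apply/congr_lim/funext => n/=; rewrite /pseries/= /series/= -sumEFin//.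
  by under eq_bigr do rewrite mulrC.
rewrite /expN /= -EFinM -expRD; congr (expR _)%:E; ring.
Qed.

End counting_variable.

Lemma integral_mul_comp d d' (T : measurableType d) (T' : measurableType d')
    (R : realType) (mu : {measure set T -> \bar R}) (W : T -> R) (c : R)
    (X : T -> T') :
  measurable_fun setT W -> (forall x, 0 <= W x)%R -> (0 <= c)%R ->
  measurable_fun setT X ->
  (forall C, measurable C ->
    \int[mu]_x ((W x)%:E * (\1_C (X x))%:E) = c%:E * mu (X @^-1` C)) ->
  forall f : T' -> \bar R, measurable_fun setT f -> (forall y, 0 <= f y) ->
    \int[mu]_x ((W x)%:E * f (X x)) = c%:E * \int[mu]_x f (X x).
Proof.
move=> mW W0 c0 mX H.
have mWE : measurable_fun setT (EFin \o W) by exact/measurable_EFinP.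
have mfX (f : T' -> \bar R) : measurable_fun setT f -> measurable_fun setT (f \o X).
  by move=> mf; exact: measurableT_comp.
apply: ge0_measurable_ind.
- move=> A mA; rewrite H//; congr (_ * _).
  transitivity (\int[mu]_x (\1_(X @^-1` A) x)%:E); last exact: eq_integral.
  by rewrite integral_indic ?setIT// -[X in measurable X]setTI; exact: mX.
- move=> f g mf mg f0 g0 Hf Hg.
  under eq_integral do rewrite ge0_muleDr//.
  rewrite [LHS]ge0_integralD//.
  + rewrite Hf Hg ge0_integralD//; [|exact: mfX..].
    by rewrite [RHS]ge0_muleDr//; apply: integral_ge0 => x _; rewrite ?f0 ?g0.
  + by move=> x _; rewrite mule_ge0// lee_fin.
  + by apply: emeasurable_funM => //; exact: mfX.
  + by move=> x _; rewrite mule_ge0// lee_fin.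
  + by apply: emeasurable_funM => //; exact: mfX.
- move=> k f k0 mf f0 Hf.
  transitivity (\int[mu]_x (k%:E * ((W x)%:E * f (X x)))).
    by apply: eq_integral => x _; rewrite muleCA.
  rewrite [LHS]ge0_integralZl_EFin//.
  + rewrite Hf ge0_integralZl_EFin//; last exact: mfX.
    by rewrite muleCA.
  + by move=> x _; rewrite mule_ge0// lee_fin.
  + by apply: emeasurable_funM => //; exact: mfX.
- move=> f mf f0 ndf Hf.
  have mfXn n : measurable_fun setT (fun x => f n (X x)) by exact: mfX.
  have -> : \int[mu]_x limn (f ^~ (X x)) = limn (fun n => \int[mu]_x f n (X x)).
    exact: monotone_convergence.
  have -> : c%:E * limn (fun n => \int[mu]_x f n (X x)) =
            limn (fun n => c%:E * \int[mu]_x f n (X x)).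
    rewrite limeMl//; apply: ereal_nondecreasing_is_cvgn => m n mn.
    by apply: ge0_le_integral => // x _; exact: ndf.
  transitivity (\int[mu]_x limn (fun n => (W x)%:E * f n (X x))).
    apply: eq_integral => x _; rewrite limeMl//.
    exact: ereal_nondecreasing_is_cvgn.
  rewrite monotone_convergence//.
  + by apply/congr_lim/funext => n; exact: Hf.
  + by move=> n; apply: emeasurable_funM => //; exact: mfX.
  + by move=> n x _; rewrite mule_ge0// lee_fin.
  + by move=> x _ m n mn; rewrite lee_pmul// ?lee_fin//; exact: ndf.
Qed.

Section independent_product.
Context d (Omega : measurableType d) (R : realType) (P : probability Omega R).

Lemma integral_prod_independent n (X : 'I_n -> Omega -> \bar R)
    (phi : 'I_n -> \bar R -> R) :
  (forall i, measurable_fun setT (X i)) ->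
  (forall C : 'I_n -> set (\bar R), (forall i, measurable (C i)) ->
    P (\bigcap_i [set w | C i (X i w)]) = \prod_(i < n) P [set w | C i (X i w)]) ->
  (forall i, measurable_fun setT (phi i)) ->
  (forall i x, 0 <= phi i x <= 1)%R ->
  \int[P]_w (\prod_(i < n) phi i (X i w))%:E =
    \prod_(i < n) \int[P]_w (phi i (X i w))%:E.
Proof.
move=> mX HX.
have mXi i C : measurable C -> measurable (X i @^-1` C).
  by move=> mC; rewrite -[X in measurable X]setTI; exact: mX.
suff H : forall k, (k <= n)%N -> forall phi : 'I_n -> \bar R -> R,
    (forall i, measurable_fun setT (phi i)) -> (forall i x, 0 <= phi i x <= 1)%R ->
    (forall i : 'I_n, (k <= i)%N -> exists2 C, measurable C & phi i = \1_C) ->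
    \int[P]_w (\prod_(i < n) phi i (X i w))%:E =
    \prod_(i < n) \int[P]_w (phi i (X i w))%:E.
  move=> mphi phi01; apply: (H n) => // i.
  by rewrite leqNgt ltn_ord.
clear phi; elim => [_ phi mphi phi01 phiC|k ih kn phi mphi phi01 phiC].
  have {}phiC i : exists C, measurable C /\ phi i = \1_C.
    by have [C ? ?] := phiC i (leq0n _); exists C.
  have [C HC] := choice phiC.
  transitivity (P (\bigcap_i [set w | C i (X i w)])).
    rewrite -[X in P X]setIT -integral_indic//; last first.
      apply: fin_bigcap_measurable => // i _.
      exact: mXi (HC i).1.
    apply: eq_integral => w _; congr EFin.
    rewrite indicE; case: (pselect ((\bigcap_i [set w | C i (X i w)]) w)) => h.
      rewrite (mem_set h) big1// => i _.
      by rewrite (HC i).2 indicE mem_set//; exact: h.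
    rewrite memNset//.
    have [i Ci] : exists i, ~ C i (X i w).
      by apply: contrapT => /forallNP h'; apply: h => i _; apply: contrapT; exact: h'.
    by rewrite (bigD1 i)//= (HC i).2 indicE memNset// mul0r.
  rewrite HX; last by move=> i; exact: (HC i).1.
  apply: eq_bigr => i _.
  rewrite -[X in P X]setIT -integral_indic//; last exact: mXi (HC i).1.
  by apply: eq_integral => w _; rewrite (HC i).2.
pose j := Ordinal kn.
have fin01 i : (0 <= \int[P]_w (phi i (X i w))%:E <= 1)%E.
  rewrite integral_ge0/=; last by move=> w _; rewrite lee_fin; case/andP: (phi01 i (X i w)).
  apply: (@le_trans _ _ (\int[P]_w (cst 1 w))); last first.
    by rewrite integral_cst//= probability_setT mul1e.
  apply: ge0_le_integral => //.
  - by move=> w _; rewrite lee_fin; case/andP: (phi01 i (X i w)).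
  - by apply/measurable_EFinP; apply: measurableT_comp.
  - by move=> w _; rewrite lee_fin; case/andP: (phi01 i (X i w)).
have phi0 i x : (0 <= phi i x)%R by case/andP: (phi01 i x).
pose W w := (\prod_(i < n | i != j) phi i (X i w))%R.
have mW : measurable_fun setT W.
  have -> : W = (fun w => \prod_(i < n) (if i != j then phi i (X i w) else 1)%R)%R.
    by apply/funext => w; rewrite /W big_mkcond.
  apply: measurable_prod => i _; case: (i != j) => //.
  exact: measurableT_comp.
pose c := fine (\prod_(i < n | i != j) \int[P]_w (phi i (X i w))%:E).
have cE : c%:E = \prod_(i < n | i != j) \int[P]_w (phi i (X i w))%:E.
  rewrite /c fineK//; elim/big_ind : _ => //.
  - by move=> x y ? ?; rewrite fin_numM.
  - move=> i _; have /andP[h0 h1] := fin01 i.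
    by rewrite ge0_fin_numE// (le_lt_trans h1)// ltry.
transitivity (\int[P]_w ((W w)%:E * (phi j (X j w))%:E)).
  by apply: eq_integral => w _; rewrite (bigD1 j)//= mulrC EFinM.
rewrite [RHS](bigD1 j)//= -cE muleC.
apply: (@integral_mul_comp _ _ _ _ _ P W c (X j) _ _ _ _ _ (EFin \o phi j)) => //.
- by move=> w; apply: prodr_ge0.
- by rewrite /c fine_ge0// prode_ge0// => i _; case/andP: (fin01 i).
- move=> C mC.
  pose phi' i := if i == j then \1_C else phi i.
  have := ih (ltnW kn) phi'.
  have -> : \int[P]_w (\prod_(i < n) phi' i (X i w))%:E =
     \int[P]_w ((W w)%:E * (\1_C (X j w))%:E).
    apply: eq_integral => w _; rewrite (bigD1 j)//= mulrC EFinM /phi' eqxx; congr (_%:E * _).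
    by apply: eq_bigr => i /negbTE ->.
  move=> ->.
  + rewrite (bigD1 j)//= muleC cE; congr (_ * _).
      by apply: eq_bigr => i /negbTE ij; rewrite /phi' ij.
    rewrite /phi' eqxx -[X in _ = P X]setIT -integral_indic//; exact: mXi.
  + by move=> i; rewrite /phi'; case: ifP => // _; exact: measurable_indic.
  + move=> i x; rewrite /phi'; case: ifP => // _; rewrite indicE.
    by case: (_ \in _); rewrite ?lexx ?ler01.
  + move=> i ki; rewrite /phi'; case: (eqVneq i j) => [|ij]; first by exists C.
    apply: phiC; rewrite ltn_neqAle ki andbT; apply: contra ij => /eqP kE.
    by apply/eqP/val_inj.
- exact/measurable_EFinP.
- by move=> y; rewrite lee_fin.
Qed.

End independent_product.

Section integral_comp_nnsfun.
Context d (T : measurableType d) (R : realType).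
Import HBNNSimple.

Definition simple_values (h : {nnsfun T >-> R}) : seq R :=
  finmap.enum_fset (fset_set (range h)).

Lemma simple_values_uniq h : uniq (simple_values h).
Proof. exact: finmap.fset_uniq. Qed.

Lemma integral_comp_nnsfun (m : {measure set T -> \bar R}) (D : set T)
    (h : {nnsfun T >-> R}) (phi : R -> R) : measurable D ->
  (forall r, 0 <= r -> 0 <= phi r)%R ->
  \int[m]_(x in D) (phi (h x))%:E =
  \sum_(r <- simple_values h) (phi r)%:E * m (h @^-1` [set r] `&` D).
Proof.
move=> mD phi0.
have mh r : measurable (h @^-1` [set r]) by exact: measurable_sfunP.
have h0 r : r \in simple_values h -> (0 <= r)%R.
  by rewrite /simple_values in_fset_set// inE => -[t _ <-].
transitivity (\int[m]_(x in D)
    \sum_(r <- simple_values h) ((phi r)%:E * (\1_(h @^-1` [set r]) x)%:E)).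
  apply: eq_integral => x _.
  have hx : h x \in simple_values h.
    by rewrite /simple_values in_fset_set// inE; exists x.
  rewrite (bigD1_seq (h x))//=; last exact: simple_values_uniq.
  rewrite indicE mem_set// mule1 big1 ?adde0// => r /negP rx.
  rewrite indicE memNset ?mule0//= => hr; apply: rx; rewrite hr; exact/eqP.
have mi r : measurable_fun D (fun x => (phi r)%:E * (\1_(h @^-1` [set r]) x)%:E).
  by apply: measurable_funeM; apply/measurable_EFinP; exact: measurable_indic.
rewrite big_seq.
transitivity (\int[m]_(x in D)
    \sum_(r <- simple_values h) ((phi `|r|%R)%:E * (\1_(h @^-1` [set r]) x)%:E)).
  apply: eq_integral => x _; rewrite big_seq [RHS]big_seq.
  by apply: eq_bigr => r /h0 r0; rewrite ger0_norm.
rewrite ge0_integral_sum//.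
- rewrite [LHS]big_seq; apply: eq_bigr => r /h0 r0; rewrite ger0_norm//.
  rewrite ge0_integralZl_EFin//.
  + by rewrite integral_indic.
  + by apply/measurable_EFinP; exact: measurable_indic.
  + exact: phi0.
- by move=> r; apply: measurable_funeM; apply/measurable_EFinP; exact: measurable_indic.
- by move=> r x _; rewrite mule_ge0// lee_fin// phi0.
Qed.

End integral_comp_nnsfun.

Lemma expN_sum (R : realType) n (F : 'I_n -> \bar R) : (forall i, 0 <= F i) ->
  expN (\sum_(i < n) F i) = \prod_(i < n) expN (F i).
Proof.
elim: n F => [F _|n ih F F0]; first by rewrite !big_ord0 expN0.
by rewrite !big_ord_recr/= expND ?ih// sume_ge0.
Qed.

Section laplace_functional.
Context (R : realType) (d d' : measure_display).
Context (Omega : measurableType d) (X : measurableType d').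
Context (P : probability Omega R) (D : set X) (nu : {measure set X -> \bar R}).
Context (N : R.-ker Omega ~> X).
Hypothesis mD : measurable D.
Hypothesis hN : poisson_random_measure P D nu N.

Let mN B : measurable B -> measurable_fun setT (fun w => N w B).
Proof. exact: measurable_kernel. Qed.

Lemma poisson_count_nat B : measurable B -> B `<=` D ->
  {ae P, forall w, N w B = +oo \/ exists k : nat, N w B = k%:R%:E}.
Proof.
move=> mB BD; have [h1 h2 _] := hN.
have [nuB|] := ltP (nu B) +oo; last first.
  rewrite leye_eq => /eqP nuB.
  by apply: filterS (h2 _ mB BD nuB) => w; left.
have [h _] := @expN_poisson _ _ _ P (fun w => N w B) (mN mB) (fine (nu B)) 0
  (fine_ge0 (measure_ge0 _ _)) (lexx _) (h1 _ mB BD nuB) (fun w => measure_ge0 _ _).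
by apply: filterS h => w; right.
Qed.

Lemma expN_poisson_count B (a : R) : measurable B -> B `<=` D -> (0 <= a)%R ->
  \int[P]_w expN (a%:E * N w B) = expN ((1 - expR (- a))%:E * nu B).
Proof.
move=> mB BD a0; have [h1 h2 _] := hN.
have [nuB|] := ltP (nu B) +oo.
  have [_ ->//] := @expN_poisson _ _ _ P (fun w => N w B) (mN mB) (fine (nu B)) a
    (fine_ge0 (measure_ge0 _ _)) a0 (h1 _ mB BD nuB) (fun w => measure_ge0 _ _).
  by rewrite EFinM fineK ?ge0_fin_numE// muleC.
rewrite leye_eq => /eqP nuB.
have [->|an0] := eqVneq a 0%R.
  rewrite oppr0 expR0 subrr mul0e expN0.
  under eq_integral do rewrite mul0e expN0.
  by rewrite integral_cst//= probability_setT mul1e.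
have a_gt0 : (0 < a)%R by rewrite lt0r an0.
rewrite nuB gt0_muley; last by rewrite lte_fin subr_gt0 -expR0 ltr_expR oppr_lt0.
rewrite expNy -(integral0 P setT); apply: ae_eq_ge0_integral => //.
- by apply: measurable_expN; apply: measurable_funeM; exact: mN.
- by move=> w; exact: expN_ge0.
- by apply: filterS (h2 _ mB BD nuB) => w ->; rewrite gt0_muley// lte_fin.
Qed.

Lemma expN_poisson_counts n (B : 'I_n -> set X) (a : 'I_n -> R) :
  (forall i, measurable (B i)) -> (forall i, B i `<=` D) -> trivIset setT B ->
  (forall i, 0 <= a i)%R ->
  \int[P]_w expN (\sum_(i < n) (a i)%:E * N w (B i)) =
  expN (\sum_(i < n) (1 - expR (- a i))%:E * nu (B i)).
Proof.
move=> mB BD tB a0; have [h1 h2 h3] := hN.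
pose phi (i : 'I_n) (x : \bar R) : R := fine (expN ((a i)%:E * `|x|)).
have a0' i (x : \bar R) : 0 <= (a i)%:E * `|x| by rewrite mule_ge0// lee_fin.
transitivity (\int[P]_w (\prod_(i < n) phi i (N w (B i)))%:E).
  apply: eq_integral => w _; rewrite expN_sum; last first.
    by move=> i; rewrite mule_ge0// lee_fin.
  rewrite -prodEFin; apply: eq_bigr => i _.
  by rewrite /phi fineK ?expN_fin// gee0_abs.
rewrite (@integral_prod_independent _ _ _ P _ (fun i w => N w (B i)) phi)//.
- rewrite expN_sum; last first.
    move=> i; rewrite mule_ge0// lee_fin subr_ge0 -expR0 ler_expR oppr_le0//.
  apply: eq_bigr => i _; rewrite -expN_poisson_count//.
  by apply: eq_integral => w _; rewrite /phi fineK ?expN_fin// gee0_abs.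
- by move=> i; exact: mN.
- by move=> C mC; exact: h3.
- move=> i; apply: (measurableT_comp (fine_measurable _)) => //.
  by apply: measurable_expN; apply: measurable_funeM; exact: abse_measurable.
- move=> i x; rewrite -!lee_fin /phi fineK ?expN_fin// expN_ge0/=.
  exact: expN_le1.
Qed.

Import HBNNSimple.

Lemma laplace_functional (f : X -> R) : measurable_fun setT f ->
  (forall x, 0 <= f x)%R ->
  \int[P]_w expN (\int[N w]_(x in D) (f x)%:E) =
  expN (\int[nu]_(x in D) (1 - expR (- f x))%:E).
Proof.
move=> mf f0.
have mfE : measurable_fun setT (EFin \o f) by exact/measurable_EFinP.
pose h := nnsfun_approx measurableT mfE.
have hf x : (fun n => h n x) @ \oo --> f x.
  have := @cvg_nnsfun_approx _ _ _ _ measurableT _ mfE (fun x _ => f0 x) x I.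
  by move/fine_cvg.
have ndh x : {homo h ^~ x : m n / (m <= n)%N >-> (m <= n)%R}.
  by move=> m n mn; exact/lefP/nd_nnsfun_approx.
have emono : {homo (fun r : R => 1 - expR (- r))%R : r s / (r <= s)%R}.
  by move=> r s rs; rewrite lerD2l lerN2 ler_expR lerN2.
have e0 (r : R) : (0 <= r)%R -> (0 <= 1 - expR (- r))%R.
  by move=> r0; rewrite subr_ge0 -expR0 ler_expR oppr_le0.
have mh n : measurable_fun D (EFin \o h n).
  by apply/measurable_EFinP; apply: measurable_funTS.
have me n : measurable_fun D (fun x => (1 - expR (- h n x))%:E).
  apply/measurable_EFinP; apply: measurable_funB => //.
  apply: measurableT_comp => //; apply: measurableT_comp => //.
  exact: measurable_funTS.
have Nlim w : (fun n => \int[N w]_(x in D) (h n x)%:E) @ \oo -->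
    \int[N w]_(x in D) (f x)%:E.
  have -> : \int[N w]_(x in D) (f x)%:E =
      \int[N w]_(x in D) limn (fun n => (h n x)%:E).
    apply: eq_integral => x _; apply/esym/cvg_lim => //.
    by apply/fine_cvgP; split; [exact: nearW|exact: hf].
  apply: cvg_monotone_convergence => //.
  - by move=> n x _; rewrite lee_fin.
  - by move=> x _ m n mn; rewrite lee_fin; exact: ndh.
have nulim : (fun n => \int[nu]_(x in D) (1 - expR (- h n x))%:E) @ \oo -->
    \int[nu]_(x in D) (1 - expR (- f x))%:E.
  have -> : \int[nu]_(x in D) (1 - expR (- f x))%:E =
      \int[nu]_(x in D) limn (fun n => (1 - expR (- h n x))%:E).
    apply: eq_integral => x _; apply/esym/cvg_lim => //.
    apply/fine_cvgP; split; [exact: nearW|].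
    apply: cvgB; first exact: cvg_cst.
    apply: continuous_cvg; first exact: continuous_expR.
    by apply: cvgN; exact: hf.
  apply: cvg_monotone_convergence => //.
  - by move=> n x _; rewrite lee_fin e0.
  - by move=> x _ m n mn; rewrite lee_fin; apply: emono; exact: ndh.
have simple n : \int[P]_w expN (\int[N w]_(x in D) (h n x)%:E) =
    expN (\int[nu]_(x in D) (1 - expR (- h n x))%:E).
  set g := h n.
  rewrite (integral_comp_nnsfun nu g mD e0).
  have -> : (fun w => expN (\int[N w]_(x in D) (g x)%:E)) =
     (fun w => expN (\sum_(r <- simple_values g) r%:E * N w (g @^-1` [set r] `&` D))).
    apply/funext => w; congr expN.
    exact: (@integral_comp_nnsfun _ _ _ (N w) D g id).
  set s := simple_values g.
  have s0 (i : 'I_(size s)) : (0 <= s`_i)%R.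
    have : s`_i \in s by exact: mem_nth.
    by rewrite /s /simple_values in_fset_set// inE => -[t _ <-].
  rewrite (big_nth 0%R) big_mkord.
  under eq_integral do rewrite (big_nth 0%R) big_mkord.
  rewrite (@expN_poisson_counts _ (fun i : 'I_(size s) => g @^-1` [set s`_i] `&` D)
     (fun i => s`_i))//.
  - by move=> i; apply: measurableI => //; exact: measurable_sfunP.
  - apply/trivIsetP => i j _ _ ij; rewrite -subset0 => x [[/= gi _] [gj _]].
    move: ij; apply/negP; rewrite negbK; apply/eqP/val_inj/eqP.
    rewrite -(nth_uniq 0%R (ltn_ord i) (ltn_ord j)) ?simple_values_uniq//.
    by rewrite -gi -gj.
have mNh n : measurable_fun setT (fun w => expN (\int[N w]_(x in D) (h n x)%:E)).
  apply: measurable_expN.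
  have -> : (fun w => \int[N w]_(x in D) (h n x)%:E) =
    (fun w => \int[N w]_x ((EFin \o h n) \_ D) x).
    by apply/funext => w; rewrite integral_mkcond.
  apply: measurable_fun_integral_kernel.
  - exact: mN.
  - by move=> x; rewrite patchE; case: ifP => //; rewrite lee_fin.
  - exact/(measurable_restrictT _ mD).1.
have mNf : measurable_fun setT (fun w => expN (\int[N w]_(x in D) (f x)%:E)).
  apply: measurable_expN.
  have -> : (fun w => \int[N w]_(x in D) (f x)%:E) =
    (fun w => \int[N w]_x ((EFin \o f) \_ D) x).
    by apply/funext => w; rewrite integral_mkcond.
  apply: measurable_fun_integral_kernel.
  - exact: mN.
  - by move=> x; rewrite patchE; case: ifP => //; rewrite lee_fin.
  - apply/(measurable_restrictT _ mD).1; exact: measurable_funTS.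
have Nge0 n w : 0 <= \int[N w]_(x in D) (h n x)%:E.
  by apply: integral_ge0 => x _; rewrite lee_fin.
have Nfge0 w : 0 <= \int[N w]_(x in D) (f x)%:E.
  by apply: integral_ge0 => x _; rewrite lee_fin.
have lim1 : (fun n => \int[P]_w expN (\int[N w]_(x in D) (h n x)%:E)) @ \oo -->
    \int[P]_w expN (\int[N w]_(x in D) (f x)%:E).
  apply: (@bounded_cvg_integral _ _ _ P _ _ 1%R) => //.
  - by move=> n w; exact: expN_ge0.
  - by apply: aeW => w; apply: cvg_expN.
  - by apply: aeW => w n; apply: expN_le1.
rewrite -(cvg_lim _ lim1)//.
have -> : (fun n => \int[P]_w expN (\int[N w]_(x in D) (h n x)%:E)) =
    (fun n => expN (\int[nu]_(x in D) (1 - expR (- h n x))%:E)).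
  by apply/funext => n; exact: simple.
apply/cvg_lim => //; apply: cvg_expN nulim.
by apply: integral_ge0 => x _; rewrite lee_fin e0.
Qed.

End laplace_functional.

Section sfinite_version.
Context (R : realType) (d d' : measure_display).
Context (Omega : measurableType d) (X : measurableType d').
Context (N : R.-ker Omega ~> X).

Section piece.
Context (A : set X) (mA : measurable A) (j : nat).

Definition kernel_piece (w : Omega) : {measure set X -> \bar R} :=
  if (j%:R%:E <= N w A < j.+1%:R%:E)%E then (mrestr (N w) mA : {measure set X -> \bar R}) else mzero.

Lemma measurable_kernel_piece U : measurable U ->
  measurable_fun setT (fun w => kernel_piece w U).
Proof.
move=> mU.
have -> : (fun w => kernel_piece w U) =
    (fun w => if (j%:R%:E <= N w A) && (N w A < j.+1%:R%:E) then N w (U `&` A) else 0).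
  by apply/funext => w; rewrite /kernel_piece; case: ifP.
have mNA : measurable_fun setT (fun w => N w A) by exact: measurable_kernel.
apply: measurable_fun_ifT => //.
  by apply: measurable_and; [exact: measurable_fun_lee|exact: measurable_fun_lte].
by apply: measurable_kernel; exact: measurableI.
Qed.

HB.instance Definition _ :=
  isKernel.Build _ _ _ _ R kernel_piece measurable_kernel_piece.

Lemma kernel_piece_uub : measure_fam_uub kernel_piece.
Proof.
exists j.+1%:R => w; rewrite /kernel_piece; case: ifPn => [/andP[_ h]|_].
  by rewrite [ltLHS](_ : _ = N w A)// /mrestr /=; congr (N w _); rewrite setTI.
by rewrite /mzero/= lte_fin.
Qed.

HB.instance Definition _ :=
  Kernel_isFinite.Build _ _ _ _ R kernel_piece kernel_piece_uub.

End piece.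

Context (D_ : (set X)^nat) (mD : forall n, measurable (D_ n)).

Definition sfinite_version : R.-sfker Omega ~> X :=
  kseries (fun n => kseries (fun j => kernel_piece (mD n) j)).

Lemma sfinite_versionE (w : Omega) B : trivIset setT D_ ->
  (forall n, N w (D_ n) < +oo) -> measurable B ->
  sfinite_version w B = N w (B `&` \bigcup_n D_ n).
Proof.
move=> tD finD mB.
rewrite setI_bigcupr measure_bigcup//=; last 2 first.
- by move=> n _; exact: measurableI.
- apply: trivIset_setIl tD.
transitivity (\sum_(n <oo) N w (B `&` D_ n)); last first.
  by apply: eq_eseriesl => n; rewrite in_setT.
rewrite /sfinite_version /kseries /= /mseries /=; apply: eq_eseriesr => n _.
set a := N w (D_ n).
have a0 : 0 <= a by exact: measure_ge0.
have afin : a \is a fin_num by rewrite ge0_fin_numE//; exact: finD.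
have fa0 : (0 <= fine a)%R by exact: fine_ge0.
have tr := Num.Theory.truncn_itv fa0.
transitivity (\sum_(j <oo) kernel_piece (mD n) j w B); first by [].
have E k : kernel_piece (mD n) k w B =
    if (k%:R <= fine a < k.+1%:R)%R then N w (B `&` D_ n) else 0.
  rewrite /kernel_piece -/a -[in LHS](fineK afin) !lee_fin !lte_fin.
  by case: ifP.
rewrite (@nneseriesD1 _ _ (Num.truncn (fine a)))//.
rewrite E tr eseries0 ?adde0// => k _ ktr.
rewrite E; case: ifPn => //.
move=> kh; exfalso; move: ktr => /negP; apply; apply/eqP/esym.
exact/Num.Theory.truncn_def.
Qed.

End sfinite_version.

Lemma adde_fin_inj (R : realDomainType) (x y z : \bar R) : x \is a fin_num ->
  x + y = x + z -> y = z.
Proof.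
move=> xf xyz; rewrite -[LHS](addeK _ xf) -[RHS](addeK _ xf).
by rewrite (addeC y) (addeC z) xyz.
Qed.

Section independence.
Context (R : realType) (d d' : measure_display).
Context (Omega : measurableType d) (X : measurableType d').
Context (P : probability Omega R) (N : R.-sfker Omega ~> X).
Context (nu : {measure set X -> \bar R}).

Definition poisson_laplace := forall f : X -> R, measurable_fun setT f ->
  (forall x, 0 <= f x)%R ->
  \int[P]_w expN (\int[N w]_x (f x)%:E) = expN (\int[nu]_x (1 - expR (- f x))%:E).

Definition integer_valued := forall B, measurable B ->
  {ae P, forall w, N w B = +oo \/ exists k : nat, N w B = k%:R%:E}.

Definition nonneg_supported (A : set X) (h : X -> R) :=
  [/\ measurable_fun setT h, forall x, (0 <= h x)%R & forall x, ~ A x -> h x = 0%R].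

Definition expN_kernel (h : X -> R) (w : Omega) : \bar R :=
  expN (\int[N w]_x (h x)%:E).

Implicit Types h : X -> R.
Hypothesis hL : poisson_laplace.
Hypothesis hZ : integer_valued.

Lemma expN_kernel_ge0 h w : 0 <= expN_kernel h w.
Proof. exact: expN_ge0. Qed.

Lemma expN_kernel_le1 h w : (forall x, 0 <= h x)%R -> expN_kernel h w <= 1.
Proof. by move=> h0; apply: expN_le1; apply: integral_ge0 => x _; rewrite lee_fin. Qed.

Lemma measurable_expN_kernel h : measurable_fun setT h -> (forall x, 0 <= h x)%R ->
  measurable_fun setT (expN_kernel h).
Proof.
move=> mh h0; apply: measurable_expN; apply: measurable_fun_integral_kernel.
- by move=> U mU; exact: measurable_kernel.
- by move=> x; rewrite lee_fin.
- exact/measurable_EFinP.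
Qed.

Lemma expN_kernelD h1 h2 w : measurable_fun setT h1 -> measurable_fun setT h2 ->
  (forall x, 0 <= h1 x)%R -> (forall x, 0 <= h2 x)%R ->
  expN_kernel (h1 \+ h2)%R w = expN_kernel h1 w * expN_kernel h2 w.
Proof.
move=> mh1 mh2 h10 h20; rewrite /expN_kernel -expND; last 2 first.
- by apply: integral_ge0 => x _; rewrite lee_fin.
- by apply: integral_ge0 => x _; rewrite lee_fin.
congr expN; rewrite -ge0_integralD//.
- by move=> x _; rewrite lee_fin.
- exact/measurable_EFinP.
- by move=> x _; rewrite lee_fin.
- exact/measurable_EFinP.
Qed.

Variables (A1 A2 : set X).
Hypothesis A12 : A1 `&` A2 = set0.

Lemma expN_kernel_indep h1 h2 : nonneg_supported A1 h1 -> nonneg_supported A2 h2 ->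
  \int[P]_w (expN_kernel h1 w * expN_kernel h2 w) =
  (\int[P]_w expN_kernel h1 w) * (\int[P]_w expN_kernel h2 w).
Proof.
move=> [mh1 h10 h1A] [mh2 h20 h2A].
have e0 (h : X -> R) : (forall x, 0 <= h x)%R -> forall x, 0 <= (1 - expR (- h x))%:E.
  by move=> h0 x; rewrite lee_fin subr_ge0 -expR0 ler_expR oppr_le0.
have me (h : X -> R) : measurable_fun setT h -> measurable_fun setT (fun x => (1 - expR (- h x))%:E).
  move=> mh; apply/measurable_EFinP; apply: measurable_funB => //.
  by apply: measurableT_comp => //; exact: measurableT_comp.
rewrite {2 3}/expN_kernel !hL// -expND; last 2 first.
- by apply: integral_ge0 => x _; exact: e0.
- by apply: integral_ge0 => x _; exact: e0.
transitivity (\int[P]_w expN_kernel (h1 \+ h2)%R w).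
  by apply: eq_integral => w _; rewrite expN_kernelD.
rewrite hL//; last 2 first.
- by apply: measurable_funD.
- by move=> x; rewrite addr_ge0.
congr expN; rewrite -ge0_integralD//.
- apply: eq_integral => x _; rewrite -EFinD; congr EFin => /=.
  have [Ax|Ax] := pselect (A1 x); last by rewrite h1A// oppr0 add0r expR0 subrr add0r.
  rewrite h2A ?oppr0 ?addr0 ?expR0 ?subrr ?addr0// => A2x.
  by suff : set0 x by []; rewrite -A12.
- by move=> x _; exact: e0.
- exact: me.
- by move=> x _; exact: e0.
- exact: me.
Qed.

Definition indep_future (A : set Omega) := measurable A /\
  forall h1 h2, nonneg_supported A1 h1 -> nonneg_supported A2 h2 ->
  \int[P]_(w in A) (expN_kernel h1 w * expN_kernel h2 w) =
  (\int[P]_(w in A) expN_kernel h1 w) * (\int[P]_w expN_kernel h2 w).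

Lemma expectation01 (f : Omega -> \bar R) (A : set Omega) : measurable A ->
  measurable_fun setT f ->
  (forall w, 0 <= f w) -> (forall w, f w <= 1) -> \int[P]_(w in A) f w \is a fin_num.
Proof.
move=> mA mf f0 f1; rewrite ge0_fin_numE; last exact: integral_ge0.
apply: (@le_lt_trans _ _ (\int[P]_(w in A) cst 1 w)).
  by apply: ge0_le_integral => //; exact: measurable_funTS.
rewrite integral_cst// mul1e (le_lt_trans (probability_le1 _ _))//.
by rewrite ltry.
Qed.

Section fixed_weights.
Variables (h1 h2 : X -> R).
Hypothesis (H1 : nonneg_supported A1 h1) (H2 : nonneg_supported A2 h2).

Let f w := expN_kernel h1 w * expN_kernel h2 w.

Lemma weights_ge0 w : 0 <= f w.
Proof. by rewrite mule_ge0// expN_kernel_ge0. Qed.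

Lemma weights_le1 w : f w <= 1.
Proof.
have [_ h10 _] := H1; have [_ h20 _] := H2.
by rewrite -[leRHS]mule1 lee_pmul ?expN_kernel_ge0 ?expN_kernel_le1.
Qed.

Lemma measurable_weights : measurable_fun setT f.
Proof.
have [? ? _] := H1; have [? ? _] := H2.
by apply: emeasurable_funM; exact: measurable_expN_kernel.
Qed.

Lemma expN_kernel_fin : \int[P]_w expN_kernel h2 w \is a fin_num.
Proof.
have [? ? _] := H2; apply: expectation01 => //; first exact: measurable_expN_kernel.
  by move=> w; exact: expN_kernel_ge0.
by move=> w; exact: expN_kernel_le1.
Qed.

End fixed_weights.

Lemma indep_futureT : indep_future setT.
Proof. by split => // h1 h2 H1 H2; exact: expN_kernel_indep. Qed.

Lemma indep_future_ae A B : indep_future A -> measurable B ->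
  {ae P, forall w, A w <-> B w} -> indep_future B.
Proof.
move=> [mA HA] mB AB; split=> // h1 h2 H1 H2.
have eqAB (f : Omega -> \bar R) : measurable_fun setT f -> (forall w, 0 <= f w) ->
    \int[P]_(w in B) f w = \int[P]_(w in A) f w.
  move=> mf f0; rewrite integral_mkcond [RHS]integral_mkcond.
  apply: ae_eq_ge0_integral.
  - by apply/(measurable_restrictT _ mB).1; exact: measurable_funTS.
  - by apply/(measurable_restrictT _ mA).1; exact: measurable_funTS.
  - by move=> w; rewrite patchE; case: ifP.
  - by move=> w; rewrite patchE; case: ifP.
  - apply: filterS AB => w ABw; rewrite !patchE.
    by have [/ABw Bw|nAw] := pselect (A w); [rewrite !mem_set//; exact/ABw|
      rewrite !memNset// => /ABw].
rewrite eqAB ?HA ?eqAB//.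
- by have [? ? _] := H1; exact: measurable_expN_kernel.
- by move=> w; exact: expN_kernel_ge0.
- exact: measurable_weights.
- by move=> w; exact: weights_ge0.
Qed.

Lemma indep_futureD A B : indep_future A -> indep_future B -> B `<=` A ->
  indep_future (A `\` B).
Proof.
move=> [mA HA] [mB HB] BA; have mAB := measurableD mA mB.
split => // h1 h2 H1 H2.
have [? ? _] := H1.
have spl (f : Omega -> \bar R) : measurable_fun setT f -> (forall w, 0 <= f w) ->
    \int[P]_(w in A) f w = \int[P]_(w in B) f w + \int[P]_(w in A `\` B) f w.
  move=> mf f0; rewrite -ge0_integral_setU//.
  - by rewrite setDUK.
  - exact: measurable_funTS.
  - by apply/disj_setPS; rewrite setDIK.
have mw := measurable_weights H1 H2.
have m1 : measurable_fun setT (expN_kernel h1) by exact: measurable_expN_kernel.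
have := HA _ _ H1 H2; rewrite (spl _ mw); last by move=> w; exact: weights_ge0.
rewrite (spl _ m1); last by move=> w; exact: expN_kernel_ge0.
rewrite ge0_muleDl; last 2 first.
- by apply: integral_ge0 => w _; exact: expN_kernel_ge0.
- by apply: integral_ge0 => w _; exact: expN_kernel_ge0.
rewrite HB//; apply: adde_fin_inj; rewrite fin_numM ?expN_kernel_fin//.
- apply: expectation01 => // w; first exact: expN_kernel_ge0.
  exact: expN_kernel_le1.
Qed.

Lemma indep_future_ndseq (F : (set Omega)^nat) : nondecreasing_seq F ->
  (forall n, indep_future (F n)) -> indep_future (\bigcup_n F n).
Proof.
move=> ndF HF; have mF n : measurable (F n) by exact: (HF n).1.
split; first exact: bigcup_measurable.
move=> h1 h2 H1 H2; have [? ? _] := H1.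
have mw := measurable_weights H1 H2.
have m1 : measurable_fun setT (expN_kernel h1) by exact: measurable_expN_kernel.
have lim (f : Omega -> \bar R) : measurable_fun setT f -> (forall w, 0 <= f w) ->
    (fun n => \int[P]_(w in F n) f w) @ \oo --> \int[P]_(w in \bigcup_n F n) f w.
  move=> mf f0; apply: ge0_nondecreasing_set_cvg_integral => //.
  by move=> n; exact: measurable_funTS.
have l1 := lim _ mw (weights_ge0 h1 h2).
have l2 := lim _ m1 (expN_kernel_ge0 h1).
rewrite -(cvg_lim _ l1)// -(cvg_lim _ l2)//.
rewrite -limeMr//; last 2 first.
- exact: expN_kernel_fin H2.
- by apply/cvg_ex; eexists; exact: l2.
by apply/congr_lim/funext => n; apply: (HF n).2.
Qed.

Lemma indep_future_lambda : lambda_system setT indep_future.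
Proof.
split => //; [exact: indep_futureT| |exact: indep_future_ndseq].
by move=> A B BA HA HB; exact: indep_futureD.
Qed.

Lemma cvg_level_weight (k : nat) (x : \bar R) (r : R) :
  (x = +oo \/ exists2 j : nat, (k <= j)%N & x = j%:R%:E) ->
  (fun a : nat => (expR (a%:R * k%:R))%:E * (expN (a%:R%:E * x) * r%:E)) @ \oo -->
  (if x == k%:R%:E then r%:E else 0).
Proof.
move=> [->|[j kj ->]].
  rewrite /=; apply: cvg_near_cst; near=> a.
  by rewrite gt0_muley ?expNy ?mul0e ?mule0// lte_fin ltr0n; near: a; exists 1%N.
have -> : (fun a : nat => (expR (a%:R * k%:R))%:E * (expN (a%:R%:E * j%:R%:E) * r%:E)) =
    (fun a : nat => ((expR (k%:R - j%:R)) ^+ a * r)%R%:E).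
  apply/funext => a; rewrite /expN /= -!EFinM mulrA -expRD; congr (_ * r)%:E.
  by rewrite -expRM_natr; congr expR; ring.
rewrite eqe eqr_nat; case: eqVneq => [->|jk].
  under eq_fun do rewrite subrr expR0 expr1n mul1r.
  exact: cvg_cst.
apply/fine_cvgP; split; first exact: nearW.
rewrite /comp /= -[X in _ --> X](mul0r r); apply: cvgM; last exact: cvg_cst.
apply: cvg_expr; rewrite ger0_norm ?expR_ge0// -[ltRHS]expR0 ltr_expR subr_lt0 ltr_nat.
by rewrite ltn_neqAle eq_sym jk.
Unshelve. all: by end_near. Qed.

Lemma level_weight_le1 (k a : nat) (x : \bar R) :
  (x = +oo \/ exists2 j : nat, (k <= j)%N & x = j%:R%:E) ->
  (expR (a%:R * k%:R))%:E * expN (a%:R%:E * x) <= 1.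
Proof.
move=> [->|[j kj ->]].
  have [->|a0] := eqVneq a 0%N; first by rewrite !mul0r !mul0e expR0 expN0 mule1.
  by rewrite gt0_muley ?expNy ?mule0// lte_fin ltr0n lt0n.
rewrite /expN /= -EFinM lee_fin -expRD -[leRHS]expR0 ler_expR subr_le0.
by rewrite ler_wpM2l// ler_nat.
Qed.

Lemma measurable_kernel_level B x : measurable B -> measurable [set w | N w B = x].
Proof.
by move=> mB; have /(_ measurableT [set x]) := measurable_kernel N B mB; rewrite setTI; exact.
Qed.

Lemma cvg_integral_level (A : set Omega) B (k : nat) (f : Omega -> \bar R) :
  measurable A -> measurable B -> measurable_fun setT f ->
  (forall w, 0 <= f w) -> (forall w, f w <= 1) ->
  {ae P, forall w, A w ->
    N w B = +oo \/ exists2 j : nat, (k <= j)%N & N w B = j%:R%:E} ->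
  (fun a : nat => (expR (a%:R * k%:R))%:E *
    \int[P]_(w in A) (expN (a%:R%:E * N w B) * f w)) @ \oo -->
  \int[P]_(w in A `&` [set w | N w B = k%:R%:E]) f w.
Proof.
move=> mA mB mf f0 f1 HA.
have mNB : measurable_fun setT (fun w => N w B) by exact: measurable_kernel.
have mL := measurable_kernel_level k%:R%:E mB.
have mg (a : nat) : measurable_fun setT (fun w => expN (a%:R%:E * N w B) * f w).
  apply: emeasurable_funM => //; apply: measurable_expN.
  exact: measurable_funeM.
have g0 (a : nat) w : 0 <= expN (a%:R%:E * N w B) * f w.
  by rewrite mule_ge0// expN_ge0.
rewrite integral_mkcond.
have -> : (fun a : nat => (expR (a%:R * k%:R))%:E *
    \int[P]_(w in A) (expN (a%:R%:E * N w B) * f w)) =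
    (fun a : nat => \int[P]_w ((fun w => (expR (a%:R * k%:R))%:E *
       (expN (a%:R%:E * N w B) * f w)) \_ A) w).
  apply/funext => a.
  transitivity (\int[P]_(w in A) ((expR (a%:R * k%:R))%:E *
       (expN (a%:R%:E * N w B) * f w))); last by rewrite [LHS]integral_mkcond.
  rewrite [RHS]ge0_integralZl_EFin//.
  by exact: measurable_funTS.
apply: (@bounded_cvg_integral _ _ _ P _ _ 1%R).
- move=> a; apply/(measurable_restrictT _ mA).1/measurable_funTS.
  exact: measurable_funeM.
- by apply/(measurable_restrictT _ (measurableI _ _ mA mL)).1/measurable_funTS.
- move=> a w; rewrite patchE; case: ifP => // _.
  by rewrite mule_ge0// lee_fin expR_ge0.
- apply: filterS HA => w HA; have [Aw|nAw] := pselect (A w); last first.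
    rewrite patchE memNset; last by case.
    under eq_fun do rewrite patchE memNset//.
    exact: cvg_cst.
  under eq_fun do rewrite patchE mem_set//.
  have ffin : f w \is a fin_num by rewrite ge0_fin_numE// (le_lt_trans (f1 w))// ltry.
  have := @cvg_level_weight k (N w B) (fine (f w)) (HA Aw).
  rewrite fineK// patchE; case: eqP => [Nk|Nk].
    by rewrite mem_set.
  by rewrite memNset// => -[].
- apply: filterS HA => w HA a; rewrite patchE; case: ifPn; last by rewrite lee_fin.
  rewrite inE => Aw; rewrite muleA -[leRHS]mule1 lee_pmul//.
  + by rewrite mule_ge0// ?lee_fin ?expR_ge0// expN_ge0.
  + exact: level_weight_le1 (HA Aw).
Qed.

Lemma indep_future_level A B (k : nat) : measurable B -> B `<=` A1 ->
  indep_future A ->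
  {ae P, forall w, A w ->
    N w B = +oo \/ exists2 j : nat, (k <= j)%N & N w B = j%:R%:E} ->
  indep_future (A `&` [set w | N w B = k%:R%:E]).
Proof.
move=> mB BA [mA HA] Ak; split.
  by apply: measurableI => //; exact: measurable_kernel_level.
move=> h1 h2 H1 H2; have [mh1 h10 h1A] := H1.
have mw := measurable_weights H1 H2.
have m1 : measurable_fun setT (expN_kernel h1) by exact: measurable_expN_kernel.
have l1 := cvg_integral_level mA mB mw (weights_ge0 h1 h2) (weights_le1 H1 H2) Ak.
have l2 := cvg_integral_level mA mB m1 (expN_kernel_ge0 h1) (fun w => expN_kernel_le1 w h10) Ak.
rewrite -(cvg_lim _ l1)// -(cvg_lim _ l2)//.
rewrite -limeMr//; last 2 first.
- exact: expN_kernel_fin H2.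
- by apply/cvg_ex; eexists; exact: l2.
apply/congr_lim/funext => a.
pose ha x := (h1 x + a%:R * \1_B x)%R.
have mi : measurable_fun setT (fun x => (a%:R * \1_B x)%R : R).
  by apply: measurable_funM => //; exact: measurable_indic.
have i0 x : (0 <= a%:R * \1_B x :> R)%R by rewrite mulr_ge0.
have Ha : nonneg_supported A1 ha.
  split.
  - exact: measurable_funD.
  - by move=> x; rewrite addr_ge0.
  - move=> x nA; rewrite /ha h1A// add0r indicE memNset ?mulr0// => /BA //.
have haE w : expN_kernel ha w = expN (a%:R%:E * N w B) * expN_kernel h1 w.
  rewrite -[ha]/(h1 \+ (fun x => (a%:R * \1_B x)%R))%R expN_kernelD// muleC.
  congr (_ * _); rewrite /expN_kernel; congr expN.
  under eq_integral do rewrite EFinM.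
  rewrite ge0_integralZl_EFin//; last by apply/measurable_EFinP/measurable_indic.
  by rewrite integral_indic// setIT.
rewrite -muleA; congr (_ * _).
have := HA ha h2 Ha H2.
under eq_integral do rewrite haE -muleA.
move=> ->; congr (_ * _).
by apply: eq_integral => w _; rewrite haE.
Qed.

Lemma indep_future_bigcup (F : (set Omega)^nat) : trivIset setT F ->
  (forall n, indep_future (F n)) -> indep_future (\bigcup_n F n).
Proof.
have /dynkin_lambda_system [_ _] := indep_future_lambda.
exact.
Qed.

Lemma indep_future_ind A B (k : nat) : measurable B -> B `<=` A1 ->
  indep_future A -> indep_future (A `&` [set w | N w B = k%:R%:E]).
Proof.
move=> mB BA HA.
pose L (j : nat) := [set w | N w B = j%:R%:E].
pose Ak k := A `\` \bigcup_(j in `I_k) L j.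
have step j : indep_future (Ak j) -> indep_future (Ak j `&` L j).
  move=> HAj; apply: indep_future_level => //.
  apply: filterS (hZ mB) => w [->|[i Ni]] [Aw nL]; [by left|right].
  exists i => //; rewrite leqNgt; apply/negP => ij; apply: nL.
  by exists i.
suff H : indep_future (Ak k).
  have -> : A `&` [set w | N w B = k%:R%:E] = Ak k `&` L k; last exact: step.
  apply/seteqP; split => w [Aw Lw]; last by case: Aw.
  split => //; split => // -[j /= jk]; rewrite /L /= Lw => -[] /eqP.
  by rewrite eqr_nat => /eqP kj; rewrite kj ltnn in jk.
elim: k => [|k ih].
  by rewrite /Ak II0 bigcup_set0 setD0.
have -> : Ak k.+1 = Ak k `\` (Ak k `&` L k).
  rewrite /Ak IIS bigcup_setU bigcup_set1.
  apply/seteqP; split => w.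
  - move=> [Aw nL]; split.
      by split => // h; apply: nL; left.
    by move=> [_ h]; apply: nL; right.
  - move=> [[Aw nL] nk]; split => // -[//|h].
    by apply: nk.
by apply: indep_futureD => //; exact: step.
Qed.

Lemma indep_future_count A B C : measurable B -> B `<=` A1 -> measurable C ->
  indep_future A -> indep_future (A `&` [set w | C (N w B)]).
Proof.
move=> mB BA mC HA.
have h0 : indep_future set0.
  by rewrite -(setDv setT); apply: indep_futureD => //; exact: indep_futureT.
have hk k := indep_future_ind k mB BA HA.
have tL : trivIset setT (fun k : nat => A `&` [set w | N w B = k%:R%:E]).
  apply/trivIsetP => i j _ _ ij; rewrite -subset0 => w [[_ /= ->] [_ []]] /eqP.
  by rewrite eqr_nat (negbTE ij).
have hinf : indep_future (A `\` \bigcup_(k : nat) (A `&` [set w | N w B = k%:R%:E])).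
  apply: indep_futureD => //; first exact: indep_future_bigcup.
  by move=> w [k _ []].
pose F n := if n is k.+1 then
    (if k%:R%:E \in C then A `&` [set w | N w B = k%:R%:E] else set0)
  else if +oo \in C then A `\` \bigcup_(k : nat) (A `&` [set w | N w B = k%:R%:E])
  else set0.
apply: (@indep_future_ae (\bigcup_n F n)).
- apply: indep_future_bigcup; last first.
    by move=> [|n]; rewrite /F; case: ifP.
  apply/trivIsetP => -[|i] [|j] _ _ ij //; rewrite /F.
  + case: ifP => _; last by rewrite set0I.
    case: ifP => _; last by rewrite setI0.
    by rewrite -subset0 => w [[_ h] h']; apply: h; exists j.
  + case: ifP => _; last by rewrite set0I.
    case: ifP => _; last by rewrite setI0.
    by rewrite -subset0 => w [h' [_ h]]; apply: h; exists i.
  + case: ifP => _; last by rewrite set0I.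
    case: ifP => _; last by rewrite setI0.
    by move/trivIsetP : tL; apply.
- apply: measurableI; first exact: HA.1.
  by have := measurable_kernel N B mB measurableT _ mC; rewrite setTI.
- apply: filterS (hZ mB) => w [Nw|[k Nw]]; split.
  + move=> [[|k] _]; rewrite /F; case: ifPn => //.
      by rewrite inE => Cw [Aw _]; split => //=; rewrite Nw.
    by move=> _ [_] /=; rewrite Nw.
  + move=> [Aw /=]; rewrite Nw => Cw; exists 0%N => //; rewrite /F mem_set//.
    by split => // -[k _ [_]] /=; rewrite Nw.
  + move=> [[|j] _]; rewrite /F; case: ifPn => //.
      by move=> _ [Aw h]; exfalso; apply: h; exists k.
    by rewrite inE => Cj [Aw /= Nj]; split => //=; rewrite Nj.
  + move=> [Aw /=]; rewrite Nw => Cw; exists k.+1 => //; rewrite /F mem_set//.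
Qed.

Definition past_events (G : set (set Omega)) := forall A, G A -> measurable A /\
  exists B C, [/\ measurable B, B `<=` A1, measurable C &
    {ae P, forall w, C (N w B) <-> A w}].

Lemma indep_future_sigma (G : set (set Omega)) : past_events G ->
  <<s G >> `<=` indep_future.
Proof.
move=> HG.
pose Pi : set (set Omega) := [set A | exists2 s : seq (set Omega),
  (forall B, B \in s -> G B) & A = \big[setI/setT]_(B <- s) B].
have GPi : G `<=` Pi.
  move=> A GA; exists [:: A]; last by rewrite big_seq1.
  by move=> B; rewrite inE => /eqP ->.
have PiI : setI_closed Pi.
  move=> A B [s Hs ->] [t Ht ->]; exists (s ++ t); last by rewrite big_cat.
  by move=> C; rewrite mem_cat => /orP[/Hs|/Ht].
apply: (@subset_trans _ <<s Pi >>).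
  by apply: sub_smallest2r => //; exact: smallest_sigma_algebra.
apply: lambda_system_subset => //; first exact: indep_future_lambda.
move=> A [s Hs ->]; elim: s Hs => [|B s ih] Hs.
  by rewrite big_nil; exact: indep_futureT.
rewrite big_cons setIC.
have [mB [B' [C [mB' B'A mC BC]]]] := HG B (Hs B (mem_head _ _)).
have ihs : indep_future (\big[setI/setT]_(B <- s) B).
  by apply: ih => D Ds; apply: Hs; rewrite in_cons Ds orbT.
apply: indep_future_ae (indep_future_count mB' B'A mC ihs) _ _.
  by apply: measurableI => //; exact: ihs.1.
by apply: filterS BC => w BCw; split => -[? /BCw].
Qed.

End independence.

Section simple_sets.
Context (R : realType) (d d' : measure_display).
Context (Omega : measurableType d) (Y : measurableType d').
Local Notation X := (R * Y)%type.
Context (P : probability Omega R) (N : R.-sfker Omega ~> X).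
Context (nu : {measure set X -> \bar R}) (T : R) (F : R -> set (set Omega)).
Context (f : X -> R).

Hypothesis hL : poisson_laplace P N nu.
Hypothesis hnu : forall h : Omega * X -> \bar R, measurable_fun setT h ->
  (forall p, 0 <= h p) -> measurable_fun setT (fun w => \int[nu]_x h (w, x)).
Hypothesis F_sigma : forall s, sigma_algebra setT (F s).
Hypothesis F_le : forall s t, (s <= t)%R -> F s `<=` F t.
Hypothesis F_indep : forall s, (0 <= s <= T)%R ->
  F s `<=` indep_future P N [set x : X | (x.1 <= s)%R] [set x : X | (s < x.1)%R].
Hypothesis mf : measurable_fun setT f.
Hypothesis f0 : forall x, (0 <= f x)%R.
Hypothesis fT : forall x, ~ (0 < x.1 <= T)%R -> f x = 0%R.
Hypothesis fnu : \int[nu]_x (f x)%:E < +oo.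

Definition time_section (S : set (Omega * X)) (s : R) (w : Omega) : set Y :=
  [set y | S (w, (s, y))].

Definition simple_after (s0 : R) (tau : seq R) (S : set (Omega * X)) : Prop :=
  [/\ measurable S,
    (forall s s', (s0 < s)%R -> (s <= s')%R -> (s' <= T)%R ->
      (forall t, t \in tau -> ~~ (s <= t < s')%R) ->
      forall w, time_section S s w = time_section S s' w) &
    (forall t s, (s0 <= t)%R -> (t < s)%R -> (s <= T)%R ->
      (forall r, r \in tau -> ~~ (t < r < s)%R) ->
      exists Bs : seq (set Y), [/\ forall B, B \in Bs -> measurable B,
        forall w, time_section S s w \in Bs &
        forall B, F t [set w | time_section S s w = B]])].

Let g x : R := (1 - expR (- f x))%R.

Let g0 x : (0 <= g x)%R.
Proof. by rewrite subr_ge0 -[leRHS]expR0 ler_expR oppr_le0. Qed.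

Let mg : measurable_fun setT g.
Proof.
by apply: measurable_funB => //; apply: measurableT_comp => //; exact: measurableT_comp.
Qed.

Let g_le_f x : (g x <= f x)%R.
Proof. by rewrite lerBlDr addrC -lerBlDr; have := expR_ge1Dx (- f x); lra. Qed.

Definition jump_sum (s : R) (S : set (Omega * X)) (w : Omega) : \bar R :=
  \int[N w]_x (f x * (s < x.1)%R%:R * \1_S (w, x))%:E.

Definition compensator (s : R) (S : set (Omega * X)) (w : Omega) : \bar R :=
  \int[nu]_x ((1 - expR (- f x)) * (s < x.1)%R%:R * \1_S (w, x))%:E.

Definition exponential_after (s : R) (S : set (Omega * X)) (w : Omega) : \bar R :=
  expN (jump_sum s S w) * expeR (compensator s S w).

Lemma measurable_restricted (h : X -> R) (s : R) S : measurable_fun setT h -> measurable S ->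
  measurable_fun setT (fun p : Omega * X => (h p.2 * (s < p.2.1)%R%:R * \1_S p)%:E).
Proof.
move=> mh mS; apply/measurable_EFinP; apply: measurable_funM; last exact: measurable_indic.
apply: measurable_funM; first exact: measurableT_comp.
apply: measurable_bool_natr.
apply: (@measurable_fun_ltr _ _ _ _ (cst s) (fun p : Omega * X => p.2.1)) => //.
by apply: measurableT_comp.
Qed.

Lemma restricted_ge0 (h : X -> R) (s : R) (S : set (Omega * X)) p :
  (forall x, 0 <= h x)%R -> 0 <= (h p.2 * (s < p.2.1)%R%:R * \1_S p)%:E.
Proof. by move=> h0; rewrite lee_fin !mulr_ge0. Qed.

Lemma jump_sum_ge0 s S w : 0 <= jump_sum s S w.
Proof. by apply: integral_ge0 => x _; exact: (@restricted_ge0 f s S (w, x)). Qed.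

Lemma compensator_ge0 s S w : 0 <= compensator s S w.
Proof. by apply: integral_ge0 => x _; exact: (@restricted_ge0 g s S (w, x)). Qed.

Lemma measurable_jump_sum s S : measurable S -> measurable_fun setT (jump_sum s S).
Proof.
move=> mS; apply: (measurable_fun_integral_sfinite_kernel
  (fun p : Omega * X => (f p.2 * (s < p.2.1)%R%:R * \1_S p)%:E) N).
- by move=> p; exact: restricted_ge0.
- exact: measurable_restricted.
Qed.

Lemma measurable_compensator s S : measurable S -> measurable_fun setT (compensator s S).
Proof.
move=> mS; apply: (hnu
  (h := fun p : Omega * X => (g p.2 * (s < p.2.1)%R%:R * \1_S p)%:E)).
- exact: measurable_restricted.
- by move=> p; exact: restricted_ge0.
Qed.

Lemma exponential_after_ge0 s S w : 0 <= exponential_after s S w.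
Proof. by rewrite mule_ge0// ?expN_ge0// expeR_ge0. Qed.

Lemma measurable_exponential_after s S : measurable S ->
  measurable_fun setT (exponential_after s S).
Proof.
move=> mS; apply: emeasurable_funM.
  exact/measurable_expN/measurable_jump_sum.
by apply: measurableT_comp measurable_expeR _; exact: measurable_compensator.
Qed.

Lemma compensator_le s S w : measurable S -> compensator s S w <= \int[nu]_x (f x)%:E.
Proof.
move=> mS; apply: ge0_le_integral => //.
- by move=> x _; exact: (@restricted_ge0 g s S (w, x)).
- exact: (measurableT_comp (measurable_restricted s mg mS) (measurable_pair1 w)).
- exact/measurable_EFinP.
- move=> x _; rewrite lee_fin -mulrA; apply: le_trans (g_le_f x).
  rewrite -[leRHS]mulr1 ler_wpM2l ?g0//.
  by rewrite indicE; case: (_ < _)%R; case: (_ \in _); rewrite ?mulr1 ?mulr0.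
Qed.

Lemma exponential_after_end S w : exponential_after T S w = 1.
Proof.
have z x : (f x * (T < x.1)%R%:R = 0 :> R)%R.
  by have [Tx|] := ltP T x.1; rewrite ?mulr0// fT ?mul0r// => /andP[_]; rewrite leNgt Tx.
have z' x : ((1 - expR (- f x)) * (T < x.1)%R%:R = 0 :> R)%R.
  have [Tx|] := ltP T x.1; rewrite ?mulr0// fT ?oppr0 ?expR0 ?subrr ?mul0r//.
  by move=> /andP[_]; rewrite leNgt Tx.
rewrite /exponential_after /jump_sum /compensator.
rewrite integral0_eq; last by move=> x _; rewrite z mul0r.
rewrite integral0_eq; last by move=> x _; rewrite z' mul0r.
by rewrite expN0 expeR0 mule1.
Qed.

Section one_step.
Variables (S : set (Omega * X)) (s t : R).
Hypothesis (s0 : (0 <= s)%R) (st : (s < t)%R) (tT : (t <= T)%R).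

Let fB (B : set Y) (x : X) : R := (f x * \1_(`]s, t] `*` B) x)%R.

Let mfB B : measurable B -> measurable_fun setT (fB B).
Proof.
move=> mB; apply: measurable_funM => //; apply: measurable_indic.
exact: measurableX.
Qed.

Let fB0 B x : (0 <= fB B x)%R. Proof. by rewrite mulr_ge0. Qed.

Lemma exponential_step (B : set Y) (w : Omega) (h : X -> R) :
  measurable S -> measurable B ->
  measurable_fun setT h -> (forall x, 0 <= h x)%R ->
  (forall r, (s < r)%R -> (r <= t)%R -> time_section S r w = B) ->
  expN_kernel N h w * exponential_after s S w =
  expeR (\int[nu]_x (1 - expR (- fB B x))%:E) *
    (expN_kernel N (h \+ fB B)%R w * exponential_after t S w).
Proof.
move=> mS mB mh h0 HB.
have spl x : ((s < x.1)%R%:R * \1_S (w, x) =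
    \1_(`]s, t] `*` B) x + (t < x.1)%R%:R * \1_S (w, x) :> R)%R.
  case: x => r y /=; rewrite !indicE.
  have [sr|rs] := ltP s r; last first.
    have -> : ((r, y) \in `]s, t] `*` B) = false.
      by apply/memNset => -[/=]; rewrite in_itv/= ltNge rs.
    by rewrite ltNge (le_trans rs (ltW st))/= !mul0r addr0.
  rewrite mul1r; have [tr|rt] := ltP t r.
    have -> : ((r, y) \in `]s, t] `*` B) = false.
      by apply/memNset => -[/=]; rewrite in_itv/= (leNgt r) tr andbF.
    by rewrite mul1r add0r.
  rewrite mul0r addr0; congr (_ %:R); congr nat_of_bool.
  have E := HB _ sr rt.
  apply/idP/idP; rewrite !inE /= => h1.
    by split; rewrite /= ?in_itv/= ?sr//; rewrite -E.
  by case: h1 => _ /=; rewrite -E.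
have gB x : (1 - expR (- fB B x) = g x * \1_(`]s, t] `*` B) x)%R.
  rewrite /fB /g indicE; case: (_ \in _); first by rewrite !mulr1.
  by rewrite !mulr0 oppr0 expR0 subrr.
have mI : measurable_fun setT (\1_(`]s, t] `*` B) : X -> R).
  by apply: measurable_indic; exact: measurableX.
have mtail (k : X -> R) : measurable_fun setT k ->
    measurable_fun setT (fun x => (k x * (t < x.1)%R%:R * \1_S (w, x))%:E).
  by move=> mk; exact: (measurableT_comp (measurable_restricted t mk mS) (measurable_pair1 w)).
have -> : exponential_after s S w =
    expeR (\int[nu]_x (1 - expR (- fB B x))%:E) * (expN_kernel N (fB B) w * exponential_after t S w).
  rewrite /exponential_after.
  have -> : jump_sum s S w = \int[N w]_x (fB B x)%:E + jump_sum t S w.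
    rewrite /jump_sum -ge0_integralD//.
    - by apply: eq_integral => x _; rewrite -EFinD -!mulrA spl mulrDr.
    - by move=> x _; rewrite lee_fin.
    - by apply/measurable_EFinP; exact: mfB.
    - by move=> x _; exact: (@restricted_ge0 f t S (w, x)).
    - exact: mtail.
  have -> : compensator s S w =
      \int[nu]_x (1 - expR (- fB B x))%:E + compensator t S w.
    rewrite /compensator -ge0_integralD//.
    - by apply: eq_integral => x _; rewrite -EFinD gB -!mulrA spl mulrDr.
    - by move=> x _; rewrite gB lee_fin mulr_ge0.
    - by under eq_fun do rewrite gB; apply/measurable_EFinP/measurable_funM.
    - by move=> x _; exact: (@restricted_ge0 g t S (w, x)).
    - exact: mtail.
  rewrite expND ?jump_sum_ge0//; last by apply: integral_ge0 => x _; rewrite lee_fin.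
  by rewrite expeRD muleACA [X in X * _]muleC -muleA.
rewrite expN_kernelD//; last exact: mfB.
by rewrite muleCA !muleA.
Qed.

Lemma exponential_one_step (tau : seq R) (A : set Omega) (h : X -> R) :
  simple_after s tau S -> (forall r, r \in tau -> ~~ (s < r < t)%R) ->
  (forall A h, F t A -> nonneg_supported [set x : X | (x.1 <= t)%R] h ->
    \int[P]_(w in A) (expN_kernel N h w * exponential_after t S w) =
    \int[P]_(w in A) expN_kernel N h w) ->
  F s A -> nonneg_supported [set x : X | (x.1 <= s)%R] h ->
  \int[P]_(w in A) (expN_kernel N h w * exponential_after s S w) =
  \int[P]_(w in A) expN_kernel N h w.
Proof.
move=> [mS Scst Ssimp] notau ih FA Hh.
have [mh h0 hs] := Hh.
have s0T : (0 <= s <= T)%R by rewrite s0 (ltW (lt_le_trans st tT)).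
have [Bs [mBs SBs FBs]] := Ssimp s t (lexx _) st tT notau.
pose L (B : set Y) := A `&` [set w | time_section S t w = B].
have FL B : F s (L B).
  by have /sigma_algebraP[//|_ _ _] := F_sigma s; apply.
have indepL B : indep_future P N _ _ (L B) := F_indep s0T (FL B).
have mL B : measurable (L B) := (indepL B).1.
have AE : A = \big[setU/set0]_(B <- undup Bs) L B.
  rewrite -bigcup_seq; apply/seteqP; split => w.
    by move=> Aw; exists (time_section S t w) => //=; rewrite mem_undup.
  by move=> [B _ []].
have tL : trivIset [set` undup Bs] L.
  by apply/trivIsetP => B C _ _ BC; rewrite -subset0 => w [[_ /= BE] [_ /= CE]];
    move: BC; rewrite -BE -CE eqxx.
have decomp (phi : Omega -> \bar R) : measurable_fun setT phi ->
    (forall w, 0 <= phi w) ->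
    \int[P]_(w in A) phi w = \sum_(B <- undup Bs) \int[P]_(w in L B) phi w.
  move=> mphi phi0; rewrite AE ge0_integral_bigsetU//.
  - exact: undup_uniq.
  - exact: measurable_funTS.
have mh' := measurable_expN_kernel N mh h0.
have me := measurable_exponential_after s mS.
rewrite decomp; last 2 first.
- exact: emeasurable_funM.
- by move=> w; rewrite mule_ge0// ?expN_kernel_ge0// exponential_after_ge0.
rewrite decomp//; last by move=> w; exact: expN_kernel_ge0.
rewrite big_seq [RHS]big_seq; apply: eq_bigr => B; rewrite mem_undup => BBs.
have mB := mBs B BBs.
have HfB : nonneg_supported [set x : X | (s < x.1)%R] (fB B).
  split; [exact: mfB|exact: fB0|].
  move=> [r y] /= nsr; rewrite /fB indicE memNset ?mulr0//.
  by move=> [/=]; rewrite in_itv/= => /andP[].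
have Hh' : nonneg_supported [set x : X | (x.1 <= t)%R] (h \+ fB B)%R.
  split.
  - by apply: measurable_funD => //; exact: mfB.
  - by move=> x; rewrite addr_ge0// fB0.
  - move=> [r y] /= ntr; rewrite hs /=; last first.
      by move=> rs; apply: ntr; exact: le_trans rs (ltW st).
    rewrite add0r /fB indicE memNset ?mulr0//.
    by move=> [/=]; rewrite in_itv/= => /andP[].
transitivity (\int[P]_(w in L B) (expeR (\int[nu]_x (1 - expR (- fB B x))%:E) *
    (expN_kernel N (h \+ fB B)%R w * exponential_after t S w))).
  apply: eq_integral => w; rewrite inE => -[_ /= wB].
  apply: exponential_step => // r sr rt; rewrite -wB.
  apply: Scst => // t' t'tau; apply: contra (notau _ t'tau) => /andP[rt' ->].
  by rewrite (lt_le_trans sr rt').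
have [mhf hf0 _] := Hh'.
have c0 : 0 <= \int[nu]_x (1 - expR (- fB B x))%:E.
  by apply: integral_ge0 => x _; rewrite lee_fin subr_ge0 -[leRHS]expR0 ler_expR oppr_le0 fB0.
rewrite ge0_integralZl; last 4 first.
- exact: mL.
- apply: measurable_funTS; apply: emeasurable_funM.
    exact: measurable_expN_kernel.
  exact: measurable_exponential_after.
- by move=> w _; rewrite mule_ge0// ?expN_kernel_ge0// exponential_after_ge0.
- exact: expeR_ge0.
rewrite ih//; last exact: F_le (ltW st) _ (FL B).
have -> : \int[P]_(w in L B) expN_kernel N (h \+ fB B)%R w =
    \int[P]_(w in L B) (expN_kernel N h w * expN_kernel N (fB B) w).
  by apply: eq_integral => w _; rewrite expN_kernelD//; exact: mfB.
rewrite (indepL B).2//.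
have -> : \int[P]_w expN_kernel N (fB B) w = expN (\int[nu]_x (1 - expR (- fB B x))%:E).
  by apply: hL; [exact: mfB|exact: fB0].
rewrite muleCA -expeRD subee ?expeR0 ?mule1//.
rewrite ge0_fin_numE//; apply: le_lt_trans fnu.
apply: ge0_le_integral => //.
- by move=> x _; rewrite lee_fin subr_ge0 -[leRHS]expR0 ler_expR oppr_le0 fB0.
- apply/measurable_EFinP; apply: measurable_funB => //; apply: measurableT_comp => //.
  by apply: measurableT_comp => //; exact: mfB.
- exact/measurable_EFinP.
- move=> x _; rewrite lee_fin /fB indicE.
  case: (_ \in _); rewrite ?mulr1 ?mulr0; first exact: g_le_f.
  by rewrite oppr0 expR0 subrr.
Qed.

End one_step.

Lemma exponential_simple_after (S : set (Omega * X)) (tau : seq R) :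
  sorted (<=%R) tau -> forall s, (0 <= s <= T)%R -> simple_after s tau S ->
  forall A h, F s A -> nonneg_supported [set x : X | (x.1 <= s)%R] h ->
    \int[P]_(w in A) (expN_kernel N h w * exponential_after s S w) =
    \int[P]_(w in A) expN_kernel N h w.
Proof.
have end_step A h : \int[P]_(w in A) (expN_kernel N h w * exponential_after T S w) =
    \int[P]_(w in A) expN_kernel N h w.
  by apply: eq_integral => w _; rewrite exponential_after_end mule1.
elim: tau => [_ s s0T|r tau ih path_tau s s0T].
  move=> simpS A h FA Hh; have /andP[s0 sT] := s0T.
  have [->|sT'] := eqVneq s T; first exact: end_step.
  apply: (@exponential_one_step _ _ T) simpS _ _ FA Hh => //.
  by rewrite lt_neqAle sT'.
move=> simpS A h FA Hh; have /andP[s0 sT] := s0T.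
have mem_tau q : q \in r :: tau -> (r <= q)%R.
  rewrite inE => /predU1P[->//|qtau].
  by move: (order_path_min le_trans path_tau) => /allP; apply.
have sorted_tau := path_sorted path_tau.
have [rs|sr] := leP r s.
  apply: ih => //; case: simpS => mS S1 S2; split => //.
  - move=> a b sa ab bT H w; apply: S1 => // q; rewrite inE => /predU1P[->|].
      by rewrite negb_and -ltNge (le_lt_trans rs sa).
    exact: H.
  - move=> a b sa ab bT H; apply: S2 => // q; rewrite inE => /predU1P[->|].
      by rewrite negb_and -leNgt (le_trans rs sa).
    exact: H.
have [Tr|rT] := leP T r.
  have [->|sT'] := eqVneq s T; first exact: end_step.
  apply: (@exponential_one_step _ _ T) simpS _ _ FA Hh => //.
  - by rewrite lt_neqAle sT'.
  - by move=> q /mem_tau rq; rewrite negb_and -!leNgt (le_trans Tr rq) orbT.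
have simpS' := simpS.
apply: (@exponential_one_step _ _ r) simpS' _ _ FA Hh => //.
- exact: ltW.
- by move=> q /mem_tau rq; rewrite negb_and -!leNgt rq orbT.
move=> A' h' FA' Hh'; apply: ih => //.
  by rewrite (ltW (le_lt_trans s0 sr)) ltW.
case: simpS => mS S1 S2; split => //.
- move=> a b ra ab bT H w; apply: S1 => //; first exact: lt_trans ra.
  move=> q; rewrite inE => /predU1P[->|]; last exact: H.
  by rewrite negb_and -ltNge ra.
- move=> a b ra ab bT H; apply: S2 => //; first exact: le_trans (ltW sr) ra.
  move=> q; rewrite inE => /predU1P[->|]; last exact: H.
  by rewrite negb_and -leNgt ra.
Qed.

Definition simple_set (S : set (Omega * X)) := exists tau, simple_after 0 tau S.

Hypothesis T0 : (0 < T)%R.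

Lemma exponential_simple S : simple_set S ->
  \int[P]_w exponential_after 0 S w = 1.
Proof.
move=> [tau simpS].
have simpS' : simple_after 0 (sort <=%R tau) S.
  case: simpS => mS S1 S2; split => //.
  - by move=> a b a0 ab bT H w; apply: S1 => // q qtau; apply: H; rewrite mem_sort.
  - by move=> a b a0 ab bT H; apply: S2 => // q qtau; apply: H; rewrite mem_sort.
have F0 : F 0 setT by have /sigma_algebraP[//|] := F_sigma 0.
have Z : nonneg_supported [set x : X | (x.1 <= 0)%R] (cst 0%R : X -> R).
  by split => //; exact: measurable_cst.
have s0T : ((0 : R) <= 0 <= T)%R.
  by rewrite (ltW T0) andbT.
have := @exponential_simple_after S _ (sort_sorted le_total tau) 0%R s0T simpS' _ _ F0 Z.
have E w : expN_kernel N (cst 0%R) w = 1 by rewrite /expN_kernel integral0 expN0.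
under eq_integral do rewrite E mul1e.
under [X in _ = X -> _]eq_integral do rewrite E.
by rewrite integral_cst//= probability_setT mul1e.
Qed.

Section sigma_algebra_closure.
Context (U : Type) (G : set (set U)).
Hypothesis hG : sigma_algebra setT G.

Lemma sigma_algebra_setC A : G A -> G (~` A).
Proof. by case: hG => _ GC _ /GC; rewrite setTD. Qed.

Lemma sigma_algebra_setT : G setT.
Proof. by have /sigma_algebraP[//|] := hG. Qed.

Lemma sigma_algebra_setI A B : G A -> G B -> G (A `&` B).
Proof. by have /sigma_algebraP[//|_ _ _] := hG; apply. Qed.

Lemma sigma_algebra_setU A B : G A -> G B -> G (A `|` B).
Proof.
by move=> GA GB; rewrite -[_ `|` _]setCK setCU; apply/sigma_algebra_setC/sigma_algebra_setI;
  exact: sigma_algebra_setC.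
Qed.

Lemma sigma_algebra_cst (Q : Prop) : G [set _ | Q].
Proof.
have [q|nq] := pselect Q.
  have -> : [set _ : U | Q] = setT by apply/seteqP; split.
  exact: sigma_algebra_setT.
have -> : [set _ : U | Q] = set0 by apply/seteqP; split.
by case: hG.
Qed.

End sigma_algebra_closure.

Lemma simple_setC S : simple_set S -> simple_set (~` S).
Proof.
move=> [tau [mS S1 S2]]; exists tau.
have secC s w : time_section (~` S) s w = ~` time_section S s w by [].
split => //; first exact: measurableC.
- by move=> a b a0 ab bT H w; rewrite !secC; congr (~` _); exact: S1.
- move=> a b a0 ab bT H; have [Bs [mBs SBs FBs]] := S2 a b a0 ab bT H.
  exists [seq ~` B | B <- Bs]; split.
  + by move=> B /mapP[B' /mBs mB' ->]; exact: measurableC.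
  + by move=> w; rewrite secC; apply/mapP; exists (time_section S b w).
  + move=> B; rewrite (_ : [set w | _] = [set w | time_section S b w = ~` B])//.
    apply/seteqP; split => w /=; rewrite secC; first by move=> <-; rewrite setCK.
    by move=> ->; rewrite setCK.
Qed.

Lemma simple_setU S S' : simple_set S -> simple_set S' -> simple_set (S `|` S').
Proof.
move=> [tau [mS S1 S2]] [tau' [mS' S1' S2']]; exists (tau ++ tau').
have secU s w : time_section (S `|` S') s w = time_section S s w `|` time_section S' s w by [].
split; first exact: measurableU.
- move=> a b a0 ab bT H w; rewrite !secU; congr (_ `|` _).
    by apply: S1 => // q qt; apply: H; rewrite mem_cat qt.
  by apply: S1' => // q qt; apply: H; rewrite mem_cat qt orbT.
- move=> a b a0 ab bT H.
  have [|Bs [mBs SBs FBs]] := S2 a b a0 ab bT _.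
    by move=> q qt; apply: H; rewrite mem_cat qt.
  have [|Bs' [mBs' SBs' FBs']] := S2' a b a0 ab bT _.
    by move=> q qt; apply: H; rewrite mem_cat qt orbT.
  exists [seq B `|` B' | B <- Bs, B' <- Bs']; split.
  + by move=> B /allpairsP[[C C'] /= [/mBs ? /mBs' ? ->]]; exact: measurableU.
  + move=> w; apply/allpairsP; exists (time_section S b w, time_section S' b w).
    by split => //=.
  + move=> C; rewrite (_ : [set w | _] = \big[setU/set0]_(B <- Bs) \big[setU/set0]_(B' <- Bs')
      ([set w | time_section S b w = B] `&` [set w | time_section S' b w = B'] `&`
       [set _ | B `|` B' = C])).
      have hF := F_sigma a.
      have F0 : F a set0 by case: hF.
      elim/big_ind : _ => // [? ? ? ?|B _]; first exact: sigma_algebra_setU.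
      elim/big_ind : _ => // [? ? ? ?|B' _]; first exact: sigma_algebra_setU.
      apply: sigma_algebra_setI => //; last exact: sigma_algebra_cst.
      exact: sigma_algebra_setI.
    apply/seteqP; split => w /=.
    * rewrite secU => wC; rewrite -bigcup_seq; exists (time_section S b w) => //=.
      by rewrite -bigcup_seq; exists (time_section S' b w) => //=.
    * rewrite -bigcup_seq => -[B _]; rewrite -bigcup_seq => -[B' _] [[/= EB EB'] /= EC].
      by rewrite secU EB EB'.
Qed.

Definition time_rectangles : set (set (Omega * X)) :=
  [set D | exists A a b (B : set Y), [/\ (0 <= a)%R, (a < b)%R, (b <= T)%R &
    [/\ F a A, measurable B & D = A `*` (`]a, b] `*` B)]]].

Lemma simple_rectangle D : time_rectangles D -> simple_set D.
Proof.
move=> [A [a [b [B [a0 ab bT [FA mB ->]]]]]]; exists [:: a; b].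
have mA : measurable A.
  by have [] : indep_future P N _ _ A := F_indep (s := a) (ltac:(rewrite a0 (ltW (lt_le_trans ab bT)))) FA.
split.
- by apply: measurableX => //; exact: measurableX.
- move=> s s' s0 ss' s'T H w.
  have /H : a \in [:: a; b] by rewrite mem_head.
  have /H : b \in [:: a; b] by rewrite !inE eqxx orbT.
  rewrite !negb_and -!ltNge -!leNgt => hb ha.
  apply/seteqP; split => y [/= Aw []]; rewrite /= !in_itv/= => /andP[h1 h2] By; split => //; split => //=;
    rewrite in_itv/=; apply/andP; split.
  + exact: lt_le_trans ss'.
  + by case/orP : hb => // h; move: h2; rewrite leNgt h.
  + by case/orP : ha => // h; move: h1; rewrite ltNge h.
  + exact: le_trans h2.
- move=> t s t0 ts sT H.
  have /H : a \in [:: a; b] by rewrite mem_head.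
  rewrite negb_and -!leNgt => ha.
  exists [:: B; set0].
  have secE w : time_section (A `*` (`]a, b] `*` B)) s w =
      if (s \in `]a, b]) && `[< A w >] then B else set0.
    case: ifPn => [/andP[sab /asboolP Aw]|].
      by apply/seteqP; split => y; [case=> _ []|move=> By; split].
    rewrite negb_and => /orP[nsab|/asboolP nAw]; apply/seteqP; split => y // -[] //=.
    by move=> _ [/=]; rewrite (negbTE nsab).
  split.
  + by move=> C; rewrite !inE => /orP[/eqP->|/eqP->].
  + by move=> w; rewrite secE; case: ifP => _; rewrite !inE eqxx ?orbT.
  + move=> C; have hF := F_sigma t.
    have [sab|nsab] := boolP (s \in `]a, b]); last first.
      rewrite (_ : [set w | _] = [set _ | set0 = C]); first exact: sigma_algebra_cst.
      by apply/seteqP; split => w /=; rewrite secE (negbTE nsab).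
    have at_ : (a <= t)%R.
      case/orP : ha => // h; move: sab; rewrite in_itv/= => /andP[as_ _].
      by move: h; rewrite leNgt as_.
    have FtA : F t A by exact: F_le at_ _ FA.
    rewrite (_ : [set w | _] = (A `&` [set _ | B = C]) `|` (~` A `&` [set _ | set0 = C])).
      apply: sigma_algebra_setU => //; apply: sigma_algebra_setI => //; try exact: sigma_algebra_cst.
      exact: sigma_algebra_setC.
    apply/seteqP; split => w /=; rewrite secE sab/=.
      by case: asboolP => Aw ?; [left|right].
    by move=> [[Aw]|[nAw]]; case: asboolP.
Qed.

End simple_sets.

Section symmetric_difference_approximation.
Context d (T : measurableType d) (R : realType) (mu : {measure set T -> \bar R}).
Context (S : set (set T)).
Hypothesis mufin : fin_num_fun mu.
Hypothesis mS : forall A, S A -> measurable A.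
Hypothesis S0 : S set0.
Hypothesis SC : forall A, S A -> S (~` A).
Hypothesis SU : forall A B, S A -> S B -> S (A `|` B).

Definition symdiff (A B : set T) := (A `\` B) `|` (B `\` A).

Lemma measurable_symdiff A B : measurable A -> measurable B -> measurable (symdiff A B).
Proof. by move=> mA mB; apply: measurableU; exact: measurableD. Qed.

Let appr (A : set T) := measurable A /\ forall e : R, (0 < e)%R ->
  exists2 B, S B & mu (symdiff A B) < e%:E.

Let apprU A B : appr A -> appr B -> appr (A `|` B).
Proof.
move=> [mA HA] [mB HB]; split; first exact: measurableU.
move=> e e0; have e20 : (0 < e / 2)%R by rewrite divr_gt0.
have [A' SA' AA'] := HA _ e20; have [B' SB' BB'] := HB _ e20.
exists (A' `|` B'); first exact: SU.
have mAA' := measurable_symdiff mA (mS SA').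
have mBB' := measurable_symdiff mB (mS SB').
apply: (@le_lt_trans _ _ (mu (symdiff A A' `|` symdiff B B'))).
  apply: le_measure; rewrite ?inE.
  - by apply: measurable_symdiff; apply: measurableU => //; exact: mS.
  - exact: measurableU.
  - move=> x; rewrite /symdiff /=.
    by have := pselect (A x); have := pselect (B x); have := pselect (A' x);
      have := pselect (B' x); tauto.
apply: (@le_lt_trans _ _ (mu (symdiff A A') + mu (symdiff B B'))).
  exact: measureU2.
by rewrite (splitr e) EFinD lteD.
Qed.

Lemma sigma_algebra_approximation A : <<s S >> A -> measurable A /\
  forall e : R, (0 < e)%R -> exists2 B, S B & mu (symdiff A B) < e%:E.
Proof.
rewrite -/(appr A); move: A; apply: smallest_sub; last first.
  move=> A SA; split; first exact: mS.
  move=> e e0; exists A => //; rewrite /symdiff setDv setU0 measure0 lte_fin//.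
have appr0 : appr set0.
  split => // e e0; exists set0 => //.
  by rewrite /symdiff setDv setU0 measure0 lte_fin.
split => //.
- move=> A [mA HA]; rewrite setTD; split; first exact: measurableC.
  move=> e e0; have [B SB AB] := HA e e0; exists (~` B); first exact: SC.
  have -> : symdiff (~` A) (~` B) = symdiff A B; last exact: AB.
  apply/seteqP; split => x; rewrite /symdiff /=;
    have := pselect (A x); have := pselect (B x); tauto.
- move=> F HF; have mF n : measurable (F n) := (HF n).1.
  split; first exact: bigcup_measurable.
  move=> e e0; have e20 : (0 < e / 2)%R by rewrite divr_gt0.
  pose U n := \big[setU/set0]_(i < n.+1) F i.
  have apprUn n : appr (U n) by rewrite /U; elim/big_ind : _ => //.
  have mU n : measurable (U n) by exact: (apprUn n).1.
  have mUF : measurable (\bigcup_n F n) by exact: bigcup_measurable.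
  have UE : \bigcup_n U n = \bigcup_n F n by rewrite /U bigcup_bigsetU_bigcup.
  have cvgU : (fun n => mu (U n)) @ \oo --> mu (\bigcup_n F n).
    rewrite -UE; apply: nondecreasing_cvg_mu => //.
      by rewrite UE.
    by move=> m n mn; apply/subsetPset; exact: subset_bigsetU.
  have muF : mu (\bigcup_n F n) \is a fin_num by exact: mufin.
  have [n Hn] : exists n, mu ((\bigcup_n F n) `\` U n) < (e / 2)%:E.
    move: cvgU; rewrite -(fineK muF) => /fine_cvgP[_ /cvgrPdist_lt /(_ _ e20)[n _ Hn]].
    exists n; have := Hn n (leqnn n); rewrite /= => h.
    have UF : U n `<=` \bigcup_n F n by rewrite -UE; exact: bigcup_sup.
    have muU : mu (U n) \is a fin_num by exact: mufin.
    have mD : measurable ((\bigcup_n F n) `\` U n) by exact: measurableD.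
    have muD : mu ((\bigcup_n F n) `\` U n) \is a fin_num by exact: mufin.
    have E : mu (\bigcup_n F n) = mu (U n) + mu ((\bigcup_n F n) `\` U n).
      by rewrite -measureU ?setDUK//; exact: setDIK.
    move: h; rewrite E fineD// addrAC subrr add0r => h.
    rewrite -(fineK muD) lte_fin.
    by apply: le_lt_trans h; exact: ler_norm.
  have [B SB UB] := (apprUn n).2 _ e20.
  exists B => //.
  apply: (@le_lt_trans _ _ (mu (((\bigcup_n F n) `\` U n) `|` symdiff (U n) B))).
    apply: le_measure; rewrite ?inE.
    - by apply: measurable_symdiff => //; exact: mS.
    - apply: measurableU; first exact: measurableD.
      by apply: measurable_symdiff => //; exact: mS.
    - have UF : U n `<=` \bigcup_n F n by rewrite -UE; exact: bigcup_sup.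
      move=> x; rewrite /symdiff => -[[Fx nBx]|[Bx nFx]].
        by have [Ux|nUx] := pselect (U n x); [right; left|left].
      by right; right; split => // /UF.
  apply: (@le_lt_trans _ _ (mu ((\bigcup_n F n) `\` U n) + mu (symdiff (U n) B))).
    apply: measureU2; first exact: measurableD.
    by apply: measurable_symdiff => //; exact: mS.
  by rewrite (splitr e) EFinD lteD.
Qed.

End symmetric_difference_approximation.

Lemma expN_lipschitz (R : realType) (a a' d1 c c' d2 C : \bar R) :
  0 <= a -> 0 <= a' -> 0 <= d1 -> 0 <= c -> 0 <= c' -> 0 <= d2 ->
  c <= C -> c' <= C -> C \is a fin_num -> a' <= a + d1 -> c <= c' + d2 ->
  expN a * expeR c <= expN a' * expeR c' + expeR C * (d1 + d2).
Proof.
case: C => // C + + + + + + + + _.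
case: c => // c; case: c' => // c'; rewrite !lee_fin.
move=> a0 a'0 d10 c0 c'0 d20 cC c'C.
have rhs0 : 0 <= expN a' * expeR c'%:E by rewrite mule_ge0 ?expN_ge0// expeR_ge0.
have inf : d1 + d2 = +oo ->
    expN a * expeR c%:E <= expN a' * expeR c'%:E + expeR C%:E * (d1 + d2).
  move=> ->; rewrite gt0_muley ?lte_fin ?expR_gt0//.
  by apply: le_trans (leeDr _ rhs0); exact: leey.
case: d1 d10 inf => // [d1|] d10 inf; last first.
  by move=> _ _; apply: inf; case: d2 d20.
case: d2 d20 inf => // [d2|] d20 inf; last by move=> _ _; exact: inf.
clear inf rhs0; case: a a0 => // [a|] a0; last first.
  move=> _ _; rewrite expNy mul0e adde_ge0 ?mule_ge0 ?expN_ge0 ?expeR_ge0//.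
  by rewrite adde_ge0.
case: a' a'0 => // a' a'0.
rewrite -!EFinD !lee_fin => h1 h2.
rewrite -!expRD.
rewrite !lee_fin in d10 d20 a0 a'0.
have [le|lt] := leP (- a + c)%R (- a' + c')%R.
  rewrite -[leLHS]addr0 lerD ?ler_expR// mulr_ge0 ?expR_ge0// addr_ge0//.
rewrite -lerBlDl.
have -> : (expR (- a + c) - expR (- a' + c') =
   expR (- a + c) * (1 - expR ((- a' + c') - (- a + c))))%R.
  by rewrite mulrBr mulr1 -expRD; congr (_ - expR _)%R; ring.
have e1 : (1 - expR ((- a' + c') - (- a + c)) <= d1 + d2)%R.
  have := expR_ge1Dx ((- a' + c') - (- a + c))%R; lra.
apply: ler_pM => //.
- rewrite subr_ge0 -[leRHS]expR0 ler_expR; lra.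
- rewrite ler_expR; lra.
Qed.

Lemma cvg_scaled_laplace (R : realType) (x : \bar R) : 0 <= x ->
  (fun n : nat => n.+1%:R%:E * (1 - expN (n.+1%:R^-1%:E * x))) @ \oo --> x.
Proof.
case: x => [r| |] // r0; last first.
  under eq_fun do rewrite gt0_muley ?lte_fin// expNy sube0 mule1.
  apply/cvgeryP; apply/cvgryPge => M; near=> n.
  rewrite -natr1; apply: (@le_trans _ _ n%:R); last by rewrite lerDl.
  by near: n; exact: nbhs_infty_ger.
rewrite lee_fin in r0.
have -> : (fun n : nat => n.+1%:R%:E * (1 - expN (n.+1%:R^-1%:E * r%:E))) =
    (fun n : nat => (n.+1%:R * (1 - expR (- (n.+1%:R^-1 * r))))%R%:E).
  by apply/funext => n; rewrite /expN /= -EFinB -EFinM.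
apply/fine_cvgP; split; first exact: nearW.
rewrite /comp /=.
apply: (@squeeze_cvgr _ _ _ _ (fun n : nat => r - r ^+ 2 * n.+1%:R^-1)%R (cst r)).
- near=> n; set k : R := n.+1%:R.
  have k0 : (0 < k)%R by rewrite ltr0n.
  set y := (k^-1 * r)%R; have y0 : (0 <= y)%R by rewrite mulr_ge0// invr_ge0 ltW.
  have ry : r = (k * y)%R by rewrite /y mulrA mulfV ?mul1r// gt_eqF.
  have ge1 := expR_ge1Dx (- y); have ge2 := expR_ge1Dx y.
  have inv : (expR (- y) * expR y = 1)%R by rewrite -expRD addNr expR0.
  have e0 := expR_gt0 (- y).
  apply/andP; split.
    have -> : (r - r ^+ 2 * k^-1 = k * (y - y ^+ 2))%R.
      by rewrite ry; field; rewrite gt_eqF.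
    rewrite ler_wpM2l// ?(ltW k0)//.
    have : (expR (- y) * (1 + y) <= 1)%R.
      by rewrite -[leRHS]inv ler_wpM2l// ltW.
    move=> h1; have y3 : (0 <= y ^+ 3)%R by rewrite exprn_ge0.
    have : (0 <= (1 + y) * (1 - expR (- y) - (y - y ^+ 2)))%R.
      have -> : ((1 + y) * (1 - expR (- y) - (y - y ^+ 2)) =
        1 - expR (- y) * (1 + y) + y ^+ 3)%R by ring.
      lra.
    by rewrite pmulr_rge0 ?subr_ge0//; lra.
  by rewrite [leRHS]ry ler_wpM2l// ?(ltW k0)//; lra.
- have H : ((fun n : nat => r - r ^+ 2 * n.+1%:R^-1) @ \oo --> r - r ^+ 2 * 0)%R.
    apply: cvgB; first exact: cvg_cst.
    by apply: cvgMr; exact: cvg_harmonic.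
  by move: H; rewrite mulr0 subr0.
- exact: cvg_cst.
Unshelve. all: by end_near. Qed.

Lemma poisson_mean_le (R : realType) d d' (Omega : measurableType d) (X : measurableType d')
    (P : probability Omega R) (N : R.-sfker Omega ~> X)
    (nu : {measure set X -> \bar R}) (f : X -> R) :
  poisson_laplace P N nu -> measurable_fun setT f -> (forall x, 0 <= f x)%R ->
  \int[P]_w \int[N w]_x (f x)%:E <= \int[nu]_x (f x)%:E.
Proof.
move=> hL mf f0.
pose Z w := \int[N w]_x (f x)%:E.
have Z0 w : 0 <= Z w by apply: integral_ge0 => x _; rewrite lee_fin.
have mfE : measurable_fun setT (EFin \o f) by exact/measurable_EFinP.
have mZ : measurable_fun setT Z.
  apply: measurable_fun_integral_kernel => //.
  - by move=> U mU; exact: measurable_kernel.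
pose phi (n : nat) w := n.+1%:R%:E * (1 - expN (n.+1%:R^-1%:E * Z w)).
have nZ0 (n : nat) w : 0 <= n.+1%:R^-1%:E * Z w by rewrite mule_ge0// lee_fin invr_ge0.
have phi0 n w : 0 <= phi n w.
  by rewrite mule_ge0 ?lee_fin// sube_ge0 ?expN_le1// expN_fin.
have mphi n : measurable_fun setT (phi n).
  apply: measurable_funeM; apply: emeasurable_funB => //.
  by apply: measurable_expN; exact: measurable_funeM.
have -> : \int[P]_w Z w = \int[P]_w limn_einf (phi ^~ w).
  apply: eq_integral => w _.
  by have /cvg_limn_einf_sup[-> _] := cvg_scaled_laplace (Z0 w).
apply: (le_trans (fatou _ measurableT mphi (fun n w _ => phi0 n w))).
have phi_le n : \int[P]_w phi n w <= \int[nu]_x (f x)%:E.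
  set k : R := n.+1%:R.
  have k0 : (0 < k)%R by rewrite ltr0n.
  pose fk x : R := (k^-1 * f x)%R.
  have mfk : measurable_fun setT fk by exact: measurable_funM.
  have fk0 x : (0 <= fk x)%R by rewrite mulr_ge0// invr_ge0 ltW.
  have ZE w : k^-1%:E * Z w = \int[N w]_x (fk x)%:E.
    rewrite /Z -ge0_integralZl_EFin//; last 2 first.
    - by move=> x _; rewrite lee_fin.
    - by rewrite invr_ge0 ltW.
  have E1 : \int[P]_w expN (k^-1%:E * Z w) = expN (\int[nu]_x (1 - expR (- fk x))%:E).
    by rewrite -hL//; apply: eq_integral => w _; rewrite ZE.
  have e0 x : (0 <= 1 - expR (- fk x))%R by rewrite subr_ge0 -[leRHS]expR0 ler_expR oppr_le0.
  have I0 : 0 <= \int[nu]_x (1 - expR (- fk x))%:E by apply: integral_ge0 => x _; rewrite lee_fin.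
  have mE : measurable_fun setT (fun w => expN (k^-1%:E * Z w)).
    by apply: measurable_expN; exact: measurable_funeM.
  have Z1 w : 0 <= 1 - expN (k^-1%:E * Z w) by rewrite sube_ge0 ?expN_le1 ?expN_fin ?nZ0.
  have mZ1 : measurable_fun setT (fun w => 1 - expN (k^-1%:E * Z w)).
    exact: emeasurable_funB.
  rewrite /phi -/k ge0_integralZl_EFin ?(ltW k0)//.
  have fin1 : \int[P]_w expN (k^-1%:E * Z w) \is a fin_num by rewrite E1 expN_fin.
  have -> : \int[P]_w (1 - expN (k^-1%:E * Z w)) = 1 - \int[P]_w expN (k^-1%:E * Z w).
    apply: (@adde_fin_inj _ _ _ _ fin1).
    rewrite -ge0_integralD//.
      transitivity (\int[P]_w cst 1 w).
        by apply: eq_integral => w _; rewrite addeC subeK ?expN_fin ?nZ0.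
      by rewrite integral_cst//= probability_setT mul1e addeC subeK.
    by move=> w _; exact: expN_ge0.
  rewrite E1.
  have le1 : 1 - expN (\int[nu]_x (1 - expR (- fk x))%:E) <= \int[nu]_x (1 - expR (- fk x))%:E.
    case: (\int[nu]_x _) I0 => [r| |] // r0; last by rewrite leey.
    rewrite /expN /= -EFinB lee_fin.
    by have := expR_ge1Dx (- r); lra.
  apply: (@le_trans _ _ (k%:E * \int[nu]_x (1 - expR (- fk x))%:E)).
    by rewrite lee_wpmul2l// lee_fin ltW.
  have me : measurable_fun setT (fun x => (1 - expR (- fk x))%:E).
    apply/measurable_EFinP; apply: measurable_funB => //.
    by apply: measurableT_comp => //; exact: measurableT_comp.
  have -> : k%:E * \int[nu]_x (1 - expR (- fk x))%:E =
      \int[nu]_x (k%:E * (1 - expR (- fk x))%:E).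
    rewrite ge0_integralZl_EFin ?(ltW k0)// => x _.
    by rewrite lee_fin.
  apply: ge0_le_integral => //.
  - by move=> x _; rewrite mule_ge0// lee_fin ?(ltW k0).
  - exact: measurable_funeM.
  - move=> x _; rewrite -EFinM lee_fin.
    have -> : f x = (k * fk x)%R by rewrite /fk mulrA mulfV ?mul1r// gt_eqF.
    rewrite ler_wpM2l ?(ltW k0)//.
    by have := expR_ge1Dx (- fk x); lra.
rewrite limn_einf_lim; apply: lime_le.
  exact: is_cvg_einfs.
apply: nearW => n; apply: le_trans (phi_le n).
by apply: ereal_inf_lbound; exists n => /=.
Qed.

(* [k] is a family of measures whose joint integrals are measurable in the
   parameter, as for s-finite kernels and for a constant family. *)
Section intensity_measure.
Context (R : realType) (d d' : measure_display).
Context (Omega : measurableType d) (X : measurableType d').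
Context (P : probability Omega R) (k : Omega -> {measure set X -> \bar R}) (f : X -> R).
Hypothesis hk : forall h : Omega * X -> \bar R, measurable_fun setT h ->
  (forall p, 0 <= h p) -> measurable_fun setT (fun w => \int[k w]_x h (w, x)).
Hypothesis mf : measurable_fun setT f.
Hypothesis f0 : forall x, (0 <= f x)%R.

Let integrand (D : set (Omega * X)) (p : Omega * X) : \bar R :=
  (f p.2 * \1_D p)%:E.

Let integrand_ge0 D p : 0 <= integrand D p.
Proof. by rewrite lee_fin mulr_ge0. Qed.

Let measurable_integrand D : measurable D -> measurable_fun setT (integrand D).
Proof.
move=> mD; apply/measurable_EFinP; apply: measurable_funM; last exact: measurable_indic.
exact: measurableT_comp.
Qed.

Definition marked_measure (D : set (Omega * X)) : \bar R :=
  \int[P]_w \int[k w]_x (f x * \1_D (w, x))%:E.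

Let marked_measure0 : marked_measure set0 = 0.
Proof.
rewrite /marked_measure integral0_eq// => w _; rewrite integral0_eq// => x _.
by rewrite indicE in_set0 mulr0.
Qed.

Let marked_measure_ge0 D : 0 <= marked_measure D.
Proof.
apply: integral_ge0 => w _; apply: integral_ge0 => x _.
exact: (integrand_ge0 D (w, x)).
Qed.

Let marked_measure_sigma_additive : semi_sigma_additive marked_measure.
Proof.
move=> F mF tF mUF.
have m1 n w : measurable_fun setT (fun x => integrand (F n) (w, x)).
  exact: (measurableT_comp (measurable_integrand (mF n)) (measurable_pair1 w)).
have m2 n : measurable_fun setT (fun w => \int[k w]_x integrand (F n) (w, x)).
  by apply: hk => //; exact: measurable_integrand.
have p1 n w : 0 <= \int[k w]_x integrand (F n) (w, x).
  by apply: integral_ge0 => x _; exact: integrand_ge0.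
rewrite [X in _ --> X](_ : _ = \sum_(n <oo) marked_measure (F n)).
  by apply/cvg_closeP; split; [exact: is_cvg_nneseries|rewrite closeE].
rewrite /marked_measure.
transitivity (\int[P]_w \sum_(n <oo) \int[k w]_x integrand (F n) (w, x)).
  apply: eq_integral => w _.
  transitivity (\int[k w]_x \sum_(n <oo) integrand (F n) (w, x)).
    apply: eq_integral => x _.
    rewrite EFinM indicE /integrand /=.
    have [[i _ Fi]|nF] := pselect ((\bigcup_n F n) (w, x)).
      rewrite mem_set; last by exists i.
      rewrite (@nneseriesD1 _ _ i)//; last by move=> j _; exact: (integrand_ge0 (F j) (w, x)).
      rewrite indicE mem_set// EFinM eseries0 ?adde0// => j _ ji.
      rewrite indicE memNset ?mulr0// => Fj.
      move/trivIsetP : tF => /(_ j i I I ji); rewrite -subset0 => /(_ (w, x)); exact.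
    rewrite memNset// mule0 eseries0// => j _ _; rewrite indicE memNset ?mulr0// => Fj.
    by apply: nF; exists j.
  by rewrite integral_nneseries// => n x _; exact: integrand_ge0.
by rewrite integral_nneseries// => n.
Qed.

HB.instance Definition _ := isMeasure.Build _ _ R marked_measure
  marked_measure0 marked_measure_ge0 marked_measure_sigma_additive.

Definition marked_measure_measure : {measure set (Omega * X) -> \bar R} := marked_measure.

End intensity_measure.

Section predictable_exponential.
Context (R : realType) (d d' : measure_display).
Context (Omega : measurableType d) (Y : measurableType d').
Local Notation X := (R * Y)%type.
Context (P : probability Omega R) (N : R.-sfker Omega ~> X).
Context (nu : {measure set X -> \bar R}) (T : R) (F : R -> set (set Omega)).
Context (f : X -> R).

Hypothesis hL : poisson_laplace P N nu.
Hypothesis hnu : forall h : Omega * X -> \bar R, measurable_fun setT h ->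
  (forall p, 0 <= h p) -> measurable_fun setT (fun w => \int[nu]_x h (w, x)).
Hypothesis F_sigma : forall s, sigma_algebra setT (F s).
Hypothesis F_le : forall s t, (s <= t)%R -> F s `<=` F t.
Hypothesis F_indep : forall s, (0 <= s <= T)%R ->
  F s `<=` indep_future P N [set x : X | (x.1 <= s)%R] [set x : X | (s < x.1)%R].
Hypothesis mf : measurable_fun setT f.
Hypothesis f0 : forall x, (0 <= f x)%R.
Hypothesis fT : forall x, ~ (0 < x.1 <= T)%R -> f x = 0%R.
Hypothesis fnu : \int[nu]_x (f x)%:E < +oo.
Hypothesis T0 : (0 < T)%R.

Let hN (h : Omega * X -> \bar R) : measurable_fun setT h ->
  (forall p, 0 <= h p) -> measurable_fun setT (fun w => \int[N w]_x h (w, x)).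
Proof. by move=> mh h0; exact: measurable_fun_integral_sfinite_kernel. Qed.

Let Q1 := marked_measure_measure P hN mf f0.
Let Q2 := marked_measure_measure P (k := fun=> nu) hnu mf f0.
Let Q : {measure set (Omega * X) -> \bar R} := measure_add Q1 Q2.

Let QE A : Q A = Q1 A + Q2 A.
Proof. by rewrite -measure_addE. Qed.

Let Q_fin : fin_num_fun Q.
Proof.
apply: lty_fin_num_fun; rewrite QE.
have h1 : Q1 setT < +oo.
  apply: le_lt_trans fnu; apply: le_trans (poisson_mean_le hL mf f0).
  rewrite /Q1 /= /marked_measure le_eqVlt; apply/orP; left; apply/eqP.
  by apply: eq_integral => w _; apply: eq_integral => x _; rewrite indicT mulr1.
have h2 : Q2 setT < +oo.
  apply: le_lt_trans fnu.
  rewrite /Q2 /= /marked_measure.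
  under eq_integral do under eq_integral do rewrite indicT mulr1.
  by rewrite integral_cst//= probability_setT mule1.
exact: lte_add_pinfty.
Qed.

Lemma exponential_formula D : <<s time_rectangles T F >> D -> measurable D /\
  \int[P]_w exponential_after N nu f 0 D w = 1.
Proof.
move=> sD.
have simple0 : simple_set T F (set0 : set (Omega * X)).
  exists [::]; split; [exact: measurable0|by []|].
  move=> a b _ _ _ _; exists [:: set0]; split.
  - by move=> B; rewrite inE => /eqP ->.
  - by move=> w; rewrite inE; apply/eqP/seteqP; split.
  - move=> B; have -> : [set w | time_section (set0 : set (Omega * X)) b w = B] =
        [set _ | set0 = B].
      by apply/seteqP; split => w /= <-; apply/seteqP; split.
    exact: sigma_algebra_cst.
have sD' : <<s simple_set T F >> D.
  have rs : @time_rectangles R d d' Omega Y T F `<=` simple_set T F by move=> A; exact: (simple_rectangle F_sigma F_le F_indep).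
  move: D sD; apply: sub_smallest2r => //; exact: smallest_sigma_algebra.
have mS (A : set (Omega * X)) : simple_set T F A -> measurable A by move=> [tau []].
have [mD HD] := sigma_algebra_approximation (S := simple_set T F) Q_fin mS simple0
  (fun A => @simple_setC _ _ _ _ _ _ _ A)
  (fun A B => @simple_setU _ _ _ _ _ _ _ F_sigma A B) sD'.
split => //.
pose C := \int[nu]_x (f x)%:E.
have C0 : 0 <= C by apply: integral_ge0 => x _; rewrite lee_fin.
have Cfin : C \is a fin_num by rewrite ge0_fin_numE.
have eC0 : (0 < expR (fine C))%R by exact: expR_gt0.
have main A B : measurable A -> measurable B ->
    \int[P]_w exponential_after N nu f 0 A w <=
    \int[P]_w exponential_after N nu f 0 B w + (expR (fine C))%:E * Q (symdiff A B).
  move=> mA mB.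
  have mAB : measurable (symdiff A B) by exact: measurable_symdiff.
  have ind x w : (\1_A (w, x) <= \1_B (w, x) + \1_(symdiff A B) (w, x) :> R)%R.
    rewrite !indicE; have [Ax|nAx] := pselect (A (w, x)); last first.
      by rewrite memNset// addr_ge0.
    rewrite (mem_set Ax); have [Bx|nBx] := pselect (B (w, x)).
      by rewrite (mem_set Bx) lerDl.
    by rewrite [_ \in symdiff A B]mem_set ?lerDr//; left.
  have ind' x w : (\1_B (w, x) <= \1_A (w, x) + \1_(symdiff A B) (w, x) :> R)%R.
    rewrite !indicE; have [Bx|nBx] := pselect (B (w, x)); last first.
      by rewrite memNset// addr_ge0.
    rewrite (mem_set Bx); have [Ax|nAx] := pselect (A (w, x)).
      by rewrite (mem_set Ax) lerDl.
    by rewrite [_ \in symdiff A B]mem_set ?lerDr//; right.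
  pose J w := \int[N w]_x (f x * \1_(symdiff A B) (w, x))%:E.
  pose K w := \int[nu]_x (f x * \1_(symdiff A B) (w, x))%:E.
  have mint : measurable_fun setT (fun p : Omega * X => (f p.2 * \1_(symdiff A B) p)%:E).
    apply/measurable_EFinP; apply: measurable_funM; last exact: measurable_indic.
    exact: measurableT_comp.
  have int0 p : 0 <= (f p.2 * \1_(symdiff A B) p)%:E by rewrite lee_fin mulr_ge0.
  have minth w : measurable_fun setT (fun x : X => (f x * \1_(symdiff A B) (w, x))%:E).
    exact: (measurableT_comp mint (measurable_pair1 w)).
  have mJ : measurable_fun setT J.
    exact: (hN (h := fun p => (f p.2 * \1_(symdiff A B) p)%:E)).
  have mK : measurable_fun setT K.
    exact: (hnu (h := fun p => (f p.2 * \1_(symdiff A B) p)%:E)).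
  have J0 w : 0 <= J w by apply: integral_ge0 => x _; exact: (int0 (w, x)).
  have K0 w : 0 <= K w by apply: integral_ge0 => x _; exact: (int0 (w, x)).
  have QJK : Q (symdiff A B) = \int[P]_w (J w + K w).
    by rewrite QE ge0_integralD.
  have meA := measurable_exponential_after N hnu mf f0 0 mA.
  have meB := measurable_exponential_after N hnu mf f0 0 mB.
  have eB0 w := exponential_after_ge0 N nu f 0 B w.
  have JK0 w : 0 <= (expR (fine C))%:E * (J w + K w).
    by apply: mule_ge0; [rewrite lee_fin ltW|exact: adde_ge0].
  have mJK : measurable_fun setT (fun w => (expR (fine C))%:E * (J w + K w)).
    by apply: measurable_funeM; exact: emeasurable_funD.
  rewrite QJK -ge0_integralZl_EFin ?(ltW eC0)//; last 2 first.
  - by move=> w _; rewrite adde_ge0.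
  - exact: emeasurable_funD.
  rewrite -ge0_integralD//.
  apply: ge0_le_integral => //.
  - by move=> w _; exact: exponential_after_ge0.
  - exact: emeasurable_funD.
  move=> w _.
  rewrite /exponential_after -[(expR (fine C))%:E]/(expeR (fine C)%:E) fineK//.
  have ms (h : X -> R) S : measurable_fun setT h -> measurable S ->
      measurable_fun setT (fun x : X => (h x * (0 < x.1)%R%:R * \1_S (w, x))%:E).
    by move=> mh mS'; exact: (measurableT_comp (measurable_restricted 0 mh mS') (measurable_pair1 w)).
  have g0 x : (0 <= 1 - expR (- f x))%R by rewrite subr_ge0 -[leRHS]expR0 ler_expR oppr_le0.
  have mg : measurable_fun setT (fun x => 1 - expR (- f x))%R.
    by apply: measurable_funB => //; apply: measurableT_comp => //; exact: measurableT_comp.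
  have s0 (h : X -> R) S x : (0 <= h x)%R -> 0 <= (h x * (0 < x.1)%R%:R * \1_S (w, x))%:E.
    by move=> h0; rewrite lee_fin !mulr_ge0.
  have g_le_f x : (1 - expR (- f x) <= f x)%R.
    by have := expR_ge1Dx (- f x); lra.
  have b1 (b : bool) : (b%:R <= 1 :> R)%R by case: b.
  apply: expN_lipschitz => //.
  - exact: jump_sum_ge0.
  - exact: jump_sum_ge0.
  - exact: compensator_ge0.
  - exact: compensator_ge0.
  - exact: compensator_le.
  - exact: compensator_le.
  - rewrite /J -ge0_integralD//; last 3 first.
    + by move=> x _; exact: s0.
    + exact: ms.
    + by move=> x _; exact: (int0 (w, x)).
    apply: ge0_le_integral => //.
    + by move=> x _; exact: s0.
    + exact: ms.
    + by apply: emeasurable_funD => //; exact: ms.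
    + move=> x _; rewrite -EFinD lee_fin.
      apply: (@le_trans _ _ (f x * (0 < x.1)%R%:R * (\1_A (w, x) + \1_(symdiff A B) (w, x)))%R).
        by rewrite ler_wpM2l ?mulr_ge0//.
      rewrite mulrDr lerD2l ler_wpM2r//.
      by rewrite -[leRHS]mulr1 ler_wpM2l.
  - rewrite /K -ge0_integralD//; last 3 first.
    + by move=> x _; apply: (s0 (fun x => 1 - expR (- f x))%R).
    + exact: (ms _ _ mg).
    + by move=> x _; exact: (int0 (w, x)).
    apply: ge0_le_integral => //.
    + by move=> x _; apply: (s0 (fun x => 1 - expR (- f x))%R).
    + exact: (ms _ _ mg).
    + by apply: emeasurable_funD => //; exact: (ms _ _ mg).
    + move=> x _; rewrite -EFinD lee_fin.
      apply: (@le_trans _ _ ((1 - expR (- f x)) * (0 < x.1)%R%:R * (\1_B (w, x) + \1_(symdiff A B) (w, x)))%R).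
        by rewrite ler_wpM2l ?mulr_ge0//.
      rewrite mulrDr lerD2l ler_wpM2r//.
      by rewrite -[leRHS]mulr1 ler_pM.
have symC A B : symdiff A B = symdiff B A :> set (Omega * X) by rewrite /symdiff setUC.
have exS (S : set (Omega * X)) : simple_set T F S -> \int[P]_w exponential_after N nu f 0 S w = 1.
  by move=> simpS; exact: (exponential_simple hL hnu F_sigma F_le F_indep mf f0 fT fnu T0 simpS).
apply/eqP; rewrite eq_le; apply/andP; split; apply/lee_addgt0Pr => e e0.
- have [S simpS QS] := HD (e / expR (fine C))%R (divr_gt0 e0 eC0).
  have := main D S mD (mS _ simpS); rewrite (exS _ simpS) => /le_trans; apply.
  rewrite leeD2l//; apply: (@le_trans _ _ ((expR (fine C))%:E * (e / expR (fine C))%:E)).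
    by rewrite lee_wpmul2l ?(ltW QS)// lee_fin ltW.
  by rewrite -EFinM mulrC divfK ?gt_eqF.
- have [S simpS QS] := HD (e / expR (fine C))%R (divr_gt0 e0 eC0).
  have := main S D (mS _ simpS) mD; rewrite (exS _ simpS) symC => /le_trans; apply.
  rewrite leeD2l//; apply: (@le_trans _ _ ((expR (fine C))%:E * (e / expR (fine C))%:E)).
    by rewrite lee_wpmul2l ?(ltW QS)// lee_fin ltW.
  by rewrite -EFinM mulrC divfK ?gt_eqF.
Qed.

End predictable_exponential.

Section kernel_on_product.
Context (R : realType) (d d' d'' : measure_display).
Context (Omega : measurableType d) (Z : measurableType d') (X : measurableType d'').

Section ker.
Context (N : R.-ker Omega ~> X).
Definition kernel_fst (p : Omega * Z) : {measure set X -> \bar R} := N p.1.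

Lemma measurable_kernel_fst U : measurable U ->
  measurable_fun setT (fun p => kernel_fst p U).
Proof.
move=> mU; apply: (@measurableT_comp _ _ _ _ _ _ (fun w => N w U)) => //.
exact: measurable_kernel.
Qed.

HB.instance Definition _ :=
  isKernel.Build _ _ _ _ R kernel_fst measurable_kernel_fst.
End ker.

Lemma measurable_integral_kernel_fst (N : R.-sfker Omega ~> X)
    (h : (Omega * Z) * X -> \bar R) : measurable_fun setT h -> (forall p, 0 <= h p) ->
  measurable_fun setT (fun p : Omega * Z => \int[N p.1]_x h (p, x)).
Proof.
move=> mh h0.
have sub : isSFiniteKernel_subdef _ _ _ _ _ (kernel_fst N).
  constructor; have [s hs sE] := sfinite_kernel_subdef N.
  exists (fun n => kernel_fst (s n)).
    by move=> n; have [r hr] := hs n; exists r => p; exact: hr.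
  by move=> p U mU; rewrite /kernel_fst sE.
pose N' : R.-sfker (Omega * Z)%type ~> X := HB.pack (kernel_fst N) sub.
exact: (measurable_fun_integral_sfinite_kernel h N').
Qed.

End kernel_on_product.

Section laplace_exponent_lemmas.
Context (R : realType) (l : {sigma_finite_measure set R -> \bar R}).
Let zbar := \int[l]_(z in `]0%R, +oo[) z%:E.

Lemma laplace_exponent_ge0 (q : R) : (0 <= q)%R -> 0 <= laplace_exponent l q.
Proof.
move=> q0; apply: integral_ge0 => z /=; rewrite in_itv/= andbT => z0.
by rewrite lee_fin subr_ge0 -[leRHS]expR0 ler_expR oppr_le0 mulr_ge0// ltW.
Qed.

Lemma laplace_exponent_le (q : R) : (0 <= q)%R -> laplace_exponent l q <= q%:E * zbar.
Proof.
move=> q0; rewrite -ge0_integralZl_EFin//; last first.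
  by move=> z /=; rewrite in_itv/= andbT => z0; rewrite lee_fin ltW.
apply: ge0_le_integral => //.
- move=> z /=; rewrite in_itv/= andbT => z0.
  by rewrite lee_fin subr_ge0 -[leRHS]expR0 ler_expR oppr_le0 mulr_ge0// ltW.
- apply/measurable_EFinP; apply: measurable_funTS; apply: measurable_funB => //.
  by apply: measurableT_comp => //; apply: measurableT_comp => //; exact: measurable_funM.
- by apply: measurable_funTS; apply: measurable_funeM; exact/measurable_EFinP.
- by move=> z _; rewrite -EFinM lee_fin; have := expR_ge1Dx (- (q * z)); lra.
Qed.

Lemma laplace_exponent0 : laplace_exponent l 0%R = 0.
Proof.
by rewrite /laplace_exponent integral0_eq// => z _; rewrite mul0r oppr0 expR0 subrr.
Qed.

Lemma measurable_laplace_exponent d (T : measurableType d) (psi : T -> R) :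
  measurable_fun setT psi -> (forall x, 0 <= psi x)%R ->
  measurable_fun setT (fun x => laplace_exponent l (psi x)).
Proof.
move=> mpsi psi0.
pose h (p : T * R) : \bar R := ((1 - expR (- (psi p.1 * p.2))) * \1_(`]0%R, +oo[) p.2)%:E.
have -> : (fun x => laplace_exponent l (psi x)) = (fun x => \int[l]_z h (x, z)).
  apply/funext => x; rewrite /laplace_exponent integral_mkcond.
  apply: eq_integral => z _; rewrite /h patchE indicE /=.
  by case: ifP => _; rewrite ?mulr1 ?mulr0.
apply: (@measurable_fun_fubini_tonelli_F _ _ _ _ _ l h).
- apply/measurable_EFinP; apply: measurable_funM.
    apply: measurable_funB => //; apply: measurableT_comp => //.
    apply: measurableT_comp => //; apply: measurable_funM => //.
    exact: measurableT_comp.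
  by apply: (measurableT_comp (measurable_indic _)).
- move=> [x z]; rewrite /h /= lee_fin indicE.
  case: (boolP (_ \in _)) => [|_]; last by rewrite mulr0.
  rewrite inE /= in_itv/= andbT => z0; rewrite mulr1.
  by rewrite subr_ge0 -[leRHS]expR0 ler_expR oppr_le0 mulr_ge0// ltW.
Qed.

End laplace_exponent_lemmas.

Section product_measures.
Context (R : realType) (d1 d2 d3 : measure_display).
Context (X : measurableType d1) (Y : measurableType d2) (Z : measurableType d3).
Context (m1 : {sigma_finite_measure set Y -> \bar R}).
Context (m2 : {sigma_finite_measure set Z -> \bar R}).

Let reassociate (h : X * (Y * Z) -> \bar R) (p : (X * Y) * Z) := h (p.1.1, (p.1.2, p.2)).

Let measurable_reassociate (h : X * (Y * Z) -> \bar R) :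
  measurable_fun setT h -> measurable_fun setT (reassociate h).
Proof.
move=> mh; apply: measurableT_comp => //; apply: measurable_fun_pair.
  exact: measurableT_comp.
by apply: measurable_fun_pair => //; exact: measurableT_comp.
Qed.

Lemma integral_product_iterated (h : Y * Z -> \bar R) : measurable_fun setT h ->
  (forall p, 0 <= h p) -> \int[m1 \x m2]_q h q = \int[m1]_y \int[m2]_z h (y, z).
Proof. by move=> mh h0; exact: (@fubini_tonelli1 _ _ _ _ _ m1 m2 h). Qed.

Lemma measurable_integral_product (h : X * (Y * Z) -> \bar R) : measurable_fun setT h ->
  (forall p, 0 <= h p) -> measurable_fun setT (fun x => \int[m1 \x m2]_q h (x, q)).
Proof.
move=> mh h0.
have mH : measurable_fun setT (fun p : X * Y => \int[m2]_z reassociate h (p, z)).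
  apply: (@measurable_fun_fubini_tonelli_F _ _ _ _ R m2 (reassociate h)) => [|p].
    exact: measurable_reassociate.
  exact: h0.
rewrite (_ : (fun x => _) =
    (fun x => \int[m1]_y \int[m2]_z reassociate h ((x, y), z))); last first.
  apply/funext => x; rewrite (integral_product_iterated (h := fun q => h (x, q)))//.
  exact: measurableT_comp.
apply: (@measurable_fun_fubini_tonelli_F _ _ _ _ R m1
  (fun p => \int[m2]_z reassociate h (p, z))) => // p.
by apply: integral_ge0 => z _; exact: h0.
Qed.

Lemma sfinite_product_Fubini (m0 : {sfinite_measure set X -> \bar R})
    (h : X * (Y * Z) -> \bar R) : measurable_fun setT h -> (forall p, 0 <= h p) ->
  measurable_fun setT (fun q => \int[m0]_x h (x, q)) ->
  \int[m0]_x \int[m1 \x m2]_q h (x, q) = \int[m1 \x m2]_q \int[m0]_x h (x, q).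
Proof.
move=> mh h0 mG.
have mH : measurable_fun setT (fun p : X * Y => \int[m2]_z reassociate h (p, z)).
  apply: (@measurable_fun_fubini_tonelli_F _ _ _ _ R m2 (reassociate h)) => [|p].
    exact: measurable_reassociate.
  exact: h0.
transitivity (\int[m0]_x \int[m1]_y \int[m2]_z h (x, (y, z))).
  apply: eq_integral => x _; rewrite -(integral_product_iterated (h := fun q => h (x, q)))//.
  exact: measurableT_comp.
rewrite (sfinite_Fubini m0 m1 (fun p => \int[m2]_z reassociate h (p, z)))//; last first.
  by move=> p; apply: integral_ge0 => z _; exact: h0.
rewrite (integral_product_iterated (h := fun q => \int[m0]_x h (x, q)))//; last first.
  by move=> q; apply: integral_ge0 => z _; exact: h0.
apply: eq_integral => y _.
rewrite (sfinite_Fubini m0 m2 (fun p => h (p.1, (y, p.2))))//.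
apply: measurableT_comp => //; apply: measurable_fun_pair => //.
exact: measurable_fun_pair.
Qed.

Lemma product_Fubini (m0 : {sigma_finite_measure set X -> \bar R})
    (h : X * (Y * Z) -> \bar R) : measurable_fun setT h -> (forall p, 0 <= h p) ->
  \int[m0]_x \int[m1 \x m2]_q h (x, q) = \int[m1 \x m2]_q \int[m0]_x h (x, q).
Proof.
move=> mh h0; apply: sfinite_product_Fubini => //.
exact: (@measurable_fun_fubini_tonelli_G _ _ _ _ R m0 h).
Qed.

Lemma sfinite_kernel_Fubini d (Omega : measurableType d) (N : R.-sfker Omega ~> X) w
    (h : X * (Y * Z) -> \bar R) : measurable_fun setT h -> (forall p, 0 <= h p) ->
  \int[N w]_x \int[m1 \x m2]_q h (x, q) = \int[m1 \x m2]_q \int[N w]_x h (x, q).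
Proof.
move=> mh h0.
pose Nw : {sfinite_measure set X -> \bar R} :=
  HB.pack (Measure.sort (N w)) (isSFinite.Build _ _ _ (N w) (sfinite_kernel_measure N w)).
apply: (sfinite_product_Fubini (m0 := Nw)) => //.
apply: (@measurableT_comp _ _ _ _ _ _ (fun p : Omega * (Y * Z) => \int[N p.1]_x h (x, p.2)) _ (pair w)).
  apply: (@measurable_integral_kernel_fst _ _ _ _ _ _ _ N (fun p => h (p.2, p.1.2))) => //.
  apply: measurableT_comp => //; apply: measurable_fun_pair => //.
  exact: measurableT_comp.
exact: measurable_pair1.
Qed.

Lemma ae_sections (m0 : {sigma_finite_measure set X -> \bar R}) (B : set (X * (Y * Z))) :
  measurable B -> (forall q, m0 [set x | B (x, q)] = 0) ->
  {ae m0, forall x, {ae m1 \x m2, forall q, ~ B (x, q)}}.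
Proof.
move=> mB B0.
pose h p : \bar R := (\1_B p)%:E.
have mh : measurable_fun setT h by exact/measurable_EFinP/measurable_indic.
have h0 p : 0 <= h p by rewrite lee_fin.
have msec x : measurable [set q | B (x, q)].
  have := measurable_pair1 x measurableT mB; by rewrite setTI.
have msec' q : measurable [set x | B (x, q)].
  have := measurable_pair2 q measurableT mB; by rewrite setTI.
have secE x : \int[m1 \x m2]_q h (x, q) = (m1 \x m2) [set q | B (x, q)].
  by rewrite -[in RHS](setIT [set q | B (x, q)]) -integral_indic//; apply: eq_integral => q _;
    rewrite /h !indicE.
have I0 : \int[m0]_x (m1 \x m2) [set q | B (x, q)] = 0.
  transitivity (\int[m0]_x \int[m1 \x m2]_q h (x, q)).
    by apply: eq_integral => x _; rewrite secE.
  rewrite product_Fubini// integral0_eq// => q _.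
  transitivity (m0 ([set x | B (x, q)] `&` setT)); last by rewrite setIT.
  have <- := integral_indic m0 measurableT (msec' q).
  by apply: eq_integral => x _; rewrite /h !indicE.
have mS : measurable_fun setT (fun x => (m1 \x m2) [set q | B (x, q)]).
  rewrite (_ : (fun x => _) = (fun x => \int[m1 \x m2]_q h (x, q))).
    exact: measurable_integral_product.
  by apply/funext => x; rewrite secE.
have := ae_eq_integral_abs m0 measurableT mS.
rewrite (_ : \int[m0]_x `|_| = 0); last first.
  by rewrite -I0; apply: eq_integral => x _; rewrite gee0_abs.
move=> [/(_ erefl) + _]; apply: filterS => x /(_ I) x0.
exists [set q | B (x, q)]; split => //.
by move=> q /= /contrapT.
Qed.

End product_measures.

Section volterra_laplace.
Context (R : realType) (d dE : measure_display).
Context (Omega : measurableType d) (E : measurableType dE).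
Local Notation mu := (@lebesgue_measure R).
Local Notation atoms := (R * (E * (R * R)))%type.
Context (P : probability Omega R) (N : R.-sfker Omega ~> atoms) (T : R).
Context (m : {finite_measure set E -> \bar R}).
Context (l : {sigma_finite_measure set R -> \bar R}).
Context (nu : {measure set atoms -> \bar R}).
Context (lambda0 lambda1 : R).
Context (psi : R * E -> R) (V : Omega * (R * E) -> \bar R).

Hypothesis T0 : (0 < T)%R.
Hypothesis zbar_fin : \int[l]_(z in `]0%R, +oo[) z%:E < +oo.
Hypothesis lambda0_ge0 : (0 <= lambda0)%R.
Hypothesis lambda1_ge0 : (0 <= lambda1)%R.
Hypothesis mpsi : measurable_fun setT psi.
Hypothesis psi0 : forall p : R * E, (0 <= psi p)%R.
Hypothesis psiT : forall p : R * E, ~ (0 < p.1 <= T)%R -> psi p = 0%R.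
Hypothesis psiM : exists M : R, forall p : R * E, (psi p <= M)%R.
Hypothesis mV : measurable_fun setT V.
Hypothesis V0 : forall p, 0 <= V p.

Local Notation Lam := (mu \x m).

Definition jump_rate (p : Omega * (R * E)) : \bar R :=
  lambda0%:E + lambda1%:E * V p.

Definition mean_effect (p : R * E) : \bar R := laplace_exponent l (psi p).

Definition cumulated_rate (w : Omega) (s : R) : \bar R :=
  \int[Lam]_p ((p.1 <= s)%R%:R%:E * (jump_rate (w, p) * mean_effect p)).

(* Jumps accepted by the thinning before the compensator exceeds [k]. *)
Definition accepted (k : nat) : set (Omega * atoms) :=
  [set p | [/\ (0 < p.2.1 <= T)%R, p.2.2.2.2%:E <= jump_rate (p.1, (p.2.1, p.2.2.1)) &
    cumulated_rate p.1 p.2.1 <= k%:R%:E]].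

Definition effect (x : atoms) : R :=
  (psi (x.1, x.2.1) * x.2.2.1 * (0 <= x.2.2.1)%R%:R * (0 <= x.2.2.2)%R%:R)%R.

Hypothesis nuE : forall h : atoms -> \bar R, measurable_fun setT h ->
  (forall x, 0 <= h x) ->
  (forall x, ~ [/\ (0 < x.1 <= T)%R, (0 <= x.2.2.1)%R & (0 <= x.2.2.2)%R] -> h x = 0) ->
  \int[nu]_x h x = \int[Lam]_p \int[l]_z \int[mu]_u h (p.1, (p.2, (z, u))).
Hypothesis maccepted : forall k, measurable (accepted k).

Lemma jump_rate_ge0 p : 0 <= jump_rate p.
Proof. by rewrite adde_ge0 ?mule_ge0 ?lee_fin. Qed.

Lemma measurable_jump_rate : measurable_fun setT jump_rate.
Proof. by apply: emeasurable_funD => //; exact: measurable_funeM. Qed.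

Lemma mean_effect_ge0 p : 0 <= mean_effect p.
Proof. exact: laplace_exponent_ge0. Qed.

Lemma measurable_mean_effect : measurable_fun setT mean_effect.
Proof. exact: measurable_laplace_exponent. Qed.

Lemma mean_effectT p : ~ (0 < p.1 <= T)%R -> mean_effect p = 0.
Proof. by move=> /psiT pT; rewrite /mean_effect pT laplace_exponent0. Qed.

Definition active (k : nat) (q : Omega * (R * E)) : bool :=
  q \in [set q : Omega * (R * E) | (0 < q.2.1 <= T)%R /\ cumulated_rate q.1 q.2.1 <= k%:R%:E].

Lemma measurable_active k : measurable_fun setT (fun q => (active k q)%:R : R).
Proof.
apply: measurable_indic.
pose g (q : Omega * (R * E)) : Omega * atoms := (q.1, (q.2.1, (q.2.2, (0%R, 0%R)))).
have mg : measurable_fun setT g.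
  apply: measurable_fun_pair => //; apply: measurable_fun_pair.
    exact: measurableT_comp.
  apply: measurable_fun_pair; last exact: measurable_cst.
  exact: measurableT_comp.
have := mg measurableT _ (maccepted k); rewrite setTI.
congr (measurable _); apply/seteqP; split => q; rewrite /accepted /=.
  by move=> [].
by move=> [? ?]; split => //; exact: jump_rate_ge0.
Qed.

Lemma acceptedE k w x : (\1_(accepted k) (w, x) : R) =
  ((active k (w, (x.1, x.2.1)))%:R * (x.2.2.2%:E <= jump_rate (w, (x.1, x.2.1)))%E%:R)%R.
Proof.
rewrite indicE /active; have [[h1 h2 h3]|h] := pselect (accepted k (w, x)).
  by rewrite mem_set// mem_set//= h2 mulr1.
rewrite memNset//; have [h1|h1] := pselect ([set q : Omega * (R * E) | (0 < q.2.1 <= T)%R /\ cumulated_rate q.1 q.2.1 <= k%:R%:E] (w, (x.1, x.2.1))); last first.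
  by rewrite memNset// mul0r.
rewrite mem_set// mul1r; case: (boolP (_ <= _)) => // h2; exfalso; apply: h.
by case: h1 => ? ?; split.
Qed.

Definition stopped_rate (k : nat) (w : Omega) : \bar R :=
  \int[Lam]_p ((active k (w, p))%:R%:E * (jump_rate (w, p) * mean_effect p)).

Let mrm w : measurable_fun setT (fun p => jump_rate (w, p) * mean_effect p).
Proof.
apply: emeasurable_funM; last exact: measurable_mean_effect.
exact: (measurableT_comp measurable_jump_rate (measurable_pair1 w)).
Qed.

Let rm0 w p : 0 <= jump_rate (w, p) * mean_effect p.
Proof. by rewrite mule_ge0 ?jump_rate_ge0 ?mean_effect_ge0. Qed.

Let mactive k w : measurable_fun setT (fun p => (active k (w, p))%:R : R).
Proof. exact: (measurableT_comp (measurable_active k) (measurable_pair1 w)). Qed.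

Let mcut w (c : R * E -> R) : measurable_fun setT c ->
  measurable_fun setT (fun p => (c p)%:E * (jump_rate (w, p) * mean_effect p)).
Proof.
by move=> mc; apply: emeasurable_funM; [exact/measurable_EFinP|exact: mrm].
Qed.

Let mle (s : R) : measurable_fun setT (fun p : R * E => (p.1 <= s)%R%:R : R).
Proof. by apply: measurable_bool_natr; exact: measurable_fun_ler. Qed.

Lemma cumulated_rate_le w s t : (s <= t)%R -> cumulated_rate w s <= cumulated_rate w t.
Proof.
move=> st; apply: ge0_le_integral => //.
- by move=> p _; rewrite mule_ge0.
- exact: mcut.
- exact: mcut.
- move=> p _; rewrite lee_wpmul2r// lee_fin ler_nat.
  by have [ps|] := boolP (p.1 <= s)%R; rewrite // (le_trans ps st).
Qed.

Lemma stopped_rate_le k w : stopped_rate k w <= k%:R%:E.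
Proof.
pose S := [set s : R | (0 < s <= T)%R /\ cumulated_rate w s <= k%:R%:E].
have [[s0 Ss0]|nS] := pselect (S !=set0); last first.
  rewrite /stopped_rate integral0_eq ?lee_fin// => p _.
  rewrite /active memNset ?mul0e// => Sp; apply: nS; by exists p.1.
have Sub : has_sup S.
  by split; [exists s0|exists T => s [/andP[]]].
pose a (n : nat) : R := (sup S - n.+1%:R^-1)%R.
pose b (n : nat) : R := if sup S \in S then sup S else a n.
have bnd n s : S s -> s = sup S \/ (s <= sup S)%R.
  by move=> Ss; right; apply: sup_upper_bound.
have Sdown s t : S t -> (s <= t)%R -> cumulated_rate w s <= k%:R%:E.
  by move=> [_ At] st; apply: le_trans At; exact: cumulated_rate_le.
have Ab n : cumulated_rate w (b n) <= k%:R%:E.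
  rewrite /b; case: ifPn => [|_]; first by rewrite inE => -[].
  have [|t St at_] := @sup_adherent _ S n.+1%:R^-1 _ Sub; first by rewrite invr_gt0 ltr0n.
  by apply: (Sdown _ _ St); exact: ltW.
have mb n : measurable_fun setT (fun p : R * E => ((p.1 <= b n)%R%:R%:E * (jump_rate (w, p) * mean_effect p))).
  exact: mcut.
have ndb : nondecreasing_seq b.
  move=> i j ij; rewrite /b; case: ifP => // _; rewrite /a lerD2l lerN2.
  by rewrite lef_pV2 ?posrE ?ltr0n// ler_nat.
apply: (@le_trans _ _ (\int[Lam]_p limn (fun n =>
    ((p.1 <= b n)%R%:R%:E * (jump_rate (w, p) * mean_effect p))))).
  apply: ge0_le_integral => //.
  - by move=> p _; rewrite mule_ge0.
  - exact: mcut.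
  - apply: (emeasurable_fun_cvg (fun n => (fun p : R * E => ((p.1 <= b n)%R%:R%:E * (jump_rate (w, p) * mean_effect p))))) => // p _.
    apply: ereal_nondecreasing_is_cvgn => i j ij.
    rewrite lee_wpmul2r// lee_fin ler_nat.
    by have [pb|] := boolP (p.1 <= b i)%R; rewrite // (le_trans pb (ndb _ _ ij)).
  - move=> p _; have [Sp|nSp] := pselect (S p.1); last first.
      rewrite /active memNset// mul0e; apply: lime_ge.
        apply: ereal_nondecreasing_is_cvgn => i j ij.
        rewrite lee_wpmul2r// lee_fin ler_nat.
        by have [pb|] := boolP (p.1 <= b i)%R; rewrite // (le_trans pb (ndb _ _ ij)).
      by apply: nearW => n; rewrite mule_ge0.
    rewrite /active mem_set// mul1e; apply: lime_ge.
      apply: ereal_nondecreasing_is_cvgn => i j ij.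
      rewrite lee_wpmul2r// lee_fin ler_nat.
      by have [pb|] := boolP (p.1 <= b i)%R; rewrite // (le_trans pb (ndb _ _ ij)).
    suff [n0 Hn0] : exists n0, forall n, (n0 <= n)%N -> (p.1 <= b n)%R.
      by exists n0 => // n /= /Hn0 ->; rewrite mul1e.
    have pS : (p.1 <= sup S)%R by exact: sup_upper_bound.
    have [supS|nsup] := boolP (sup S \in S).
      by exists 0%N => n _; rewrite /b supS.
    have ps : (p.1 < sup S)%R.
      rewrite lt_neqAle pS andbT; apply: contra nsup => /eqP <-.
      exact: mem_set.
    have dpos : (0 < sup S - p.1)%R by rewrite subr_gt0.
    have [n _ Hn] := near_infty_natSinv_lt (PosNum dpos).
    exists n => j nj; have := Hn j nj; rewrite /b (negbTE nsup) /a /= => h.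
    by rewrite lerBrDr addrC -lerBrDr; exact: ltW.
rewrite monotone_convergence//; last 2 first.
- by move=> n p _; rewrite mule_ge0.
- move=> p _ i j ij; rewrite lee_wpmul2r// lee_fin ler_nat.
  by have [pb|] := boolP (p.1 <= b i)%R; rewrite // (le_trans pb (ndb _ _ ij)).
apply: lime_le; last by apply: nearW => n; exact: Ab.
apply: ereal_nondecreasing_is_cvgn => i j ij; exact: (cumulated_rate_le _ (ndb _ _ ij)).
Qed.

Lemma effect_ge0 x : (0 <= effect x)%R.
Proof.
rewrite /effect; have [z0|z0] := leP 0%R x.2.2.1; last by rewrite mulr0 mul0r.
by rewrite !mulr_ge0.
Qed.

Lemma effectT x : ~ (0 < x.1 <= T)%R -> effect x = 0%R.
Proof. by move=> xT; rewrite /effect (@psiT (x.1, x.2.1) xT) !mul0r. Qed.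

Lemma measurable_effect : measurable_fun setT effect.
Proof.
have mz : measurable_fun setT (fun x : atoms => x.2.2.1).
  by apply: measurableT_comp => //; exact: measurableT_comp.
have mu' : measurable_fun setT (fun x : atoms => x.2.2.2).
  by apply: measurableT_comp => //; exact: measurableT_comp.
apply: measurable_funM; last first.
  by apply: measurable_bool_natr; exact: measurable_fun_ler.
apply: measurable_funM; last first.
  by apply: measurable_bool_natr; exact: measurable_fun_ler.
apply: measurable_funM => //.
apply: measurableT_comp => //; apply: measurable_fun_pair => //.
exact: measurableT_comp.
Qed.

Definition truncated_effect (U : R) (x : atoms) : R :=
  (effect x * (x.2.2.2 <= U)%R%:R)%R.

Lemma truncated_effect_ge0 U x : (0 <= truncated_effect U x)%R.
Proof. by rewrite mulr_ge0// effect_ge0. Qed.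

Lemma truncated_effectT U x : ~ (0 < x.1 <= T)%R -> truncated_effect U x = 0%R.
Proof. by move=> xT; rewrite /truncated_effect (effectT xT) mul0r. Qed.

Lemma measurable_truncated_effect U : measurable_fun setT (truncated_effect U).
Proof.
apply: measurable_funM; first exact: measurable_effect.
apply: measurable_bool_natr; apply: measurable_fun_ler => //.
by apply: measurableT_comp => //; exact: measurableT_comp.
Qed.

Lemma integral_thinning (c : R) (y : \bar R) : (0 <= c)%R -> 0 <= y ->
  \int[mu]_u (c * (0 <= u)%R%:R * (u%:E <= y)%E%:R)%:E = c%:E * y.
Proof.
move=> c0 y0.
pose A := [set u : R | (0 <= u)%R /\ (u%:E <= y)%E].
have mA : measurable A.
  have -> : A = `[0%R, +oo[ `&` [set u : R | (u%:E <= y)%E].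
    by apply/seteqP; split => u; rewrite /A /= in_itv/= andbT.
  exact: measurable_lee.
transitivity (\int[mu]_u (c%:E * (\1_A u)%:E)).
  apply: eq_integral => u _; rewrite -EFinM indicE -mulrA; congr (c * _)%:E.
  have [u0|u0] := leP 0%R u; last first.
    by rewrite mul0r memNset// => -[]; rewrite leNgt u0.
  rewrite mul1r; case: (boolP (u%:E <= y)) => uy; first by rewrite mem_set.
  by rewrite memNset// => -[_]; rewrite (negbTE uy).
rewrite ge0_integralZl_EFin//; last by apply/measurable_EFinP/measurable_indic.
have muA : mu A = y.
  case: y y0 @A mA => [y| |] // y0 A mA.
    have -> : A = [set` `[0%R, y]].
      by apply/seteqP; split => u; rewrite /A /= in_itv/= lee_fin => /andP.
    rewrite lebesgue_measure_itv/= lte_fin; move: y0; rewrite lee_fin le_eqVlt.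
    by move=> /predU1P[<-|->]; rewrite ?ltxx// sube0.
  have -> : A = [set` `[0%R, +oo[].
    by apply/seteqP; split => u; rewrite /A /= in_itv/= andbT leey => //= -[].
  by rewrite lebesgue_measure_itv/= ltry.
by rewrite integral_indic// setIT -muA.
Qed.

Lemma integral_marks (h : R -> R) : (h 0 = 0)%R ->
  \int[l]_z (h z * (0 <= z)%R%:R)%:E = \int[l]_(z in `]0%R, +oo[) (h z)%:E.
Proof.
move=> h0; rewrite [RHS]integral_mkcond; apply: eq_integral => z _; rewrite patchE.
have [z0|z0|<-] := ltgtP 0%R z.
- by rewrite mem_set ?mulr1//= in_itv/= z0.
- by rewrite memNset ?mulr0//= in_itv/= andbT ltNge ltW.
- by rewrite h0 mul0r memNset//= in_itv/= ltxx.
Qed.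

Lemma bounded_integral_lty (h : R * E -> \bar R) (M : R) :
  measurable_fun setT h -> (forall p, 0 <= h p) -> (forall p, h p <= M%:E) ->
  (forall p, ~ (0 < p.1 <= T)%R -> h p = 0) -> \int[Lam]_p h p < +oo.
Proof.
move=> mh h0 hM hT.
pose A : set (R * E) := [set` `]0%R, T]] `*` setT.
have mA : measurable A by exact: measurableX.
apply: (@le_lt_trans _ _ (\int[Lam]_p ((`|M|%R)%:E * (\1_A p)%:E))).
  apply: ge0_le_integral => //.
  - by apply: measurable_funeM; apply/measurable_EFinP/measurable_indic.
  - move=> p _; have [pT|pT] := pselect (0 < p.1 <= T)%R; last first.
      by rewrite hT// mule_ge0// lee_fin.
    rewrite indicE mem_set; last by split => //=; rewrite in_itv.
    by rewrite mule1; apply: le_trans (hM p) _; rewrite lee_fin ler_norm.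
rewrite ge0_integralZl_EFin//; last by apply/measurable_EFinP/measurable_indic.
have -> : \int[Lam]_p (\1_A p)%:E = mu [set` `]0%R, T]] * m setT.
  by rewrite integral_indic// setIT -product_measure1E.
rewrite lebesgue_measure_itv/= lte_fin T0 -EFinB.
rewrite -(fineK (fin_num_measure m _ measurableT)) -!EFinM.
exact: ltry.
Qed.

Lemma truncated_effect_integrable (U : R) : (0 <= U)%R ->
  \int[nu]_x (truncated_effect U x)%:E < +oo.
Proof.
move=> U0; have [M HM] := psiM.
rewrite nuE; last 3 first.
- by apply/measurable_EFinP; exact: measurable_truncated_effect.
- by move=> x; rewrite lee_fin truncated_effect_ge0.
- move=> x nx; congr EFin; rewrite /truncated_effect /effect.
  have [xT|nxT] := pselect (0 < x.1 <= T)%R; last by rewrite psiT// !mul0r.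
  have [z0|] := boolP (0 <= x.2.2.1)%R; last by rewrite mulr0 !mul0r.
  have [u0|] := boolP (0 <= x.2.2.2)%R; last by rewrite mulr0 !mul0r.
  by exfalso; apply: nx.
have {}HM p : (psi p <= `|M|)%R by apply: le_trans (HM p) (ler_norm _).
have inner p : \int[l]_z \int[mu]_u (truncated_effect U (p.1, (p.2, (z, u))))%:E =
    (psi p)%:E * (U%:E * \int[l]_(z in `]0%R, +oo[) z%:E).
  transitivity (\int[l]_z ((psi p * U)%:E * (z * (0 <= z)%R%:R)%:E)).
    apply: eq_integral => z _.
    transitivity (\int[mu]_u (psi p * z * (0 <= z)%R%:R * (0 <= u)%R%:R * (u%:E <= U%:E)%E%:R)%:E).
      by apply: eq_integral => u _; rewrite /truncated_effect /effect /= lee_fin; case: p.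
    rewrite integral_thinning ?lee_fin//; last first.
      by have [z0|z0] := leP 0%R z; rewrite ?mulr0// !mulr_ge0.
    by rewrite -!EFinM; congr EFin; ring.
  rewrite ge0_integralZl_EFin ?mulr_ge0//.
  - by rewrite (integral_marks (h := id))// EFinM muleA.
  - by move=> z _; rewrite lee_fin; have [z0|z0] := leP 0%R z; rewrite ?mulr1 ?mulr0.
  - apply/measurable_EFinP; apply: measurable_funM => //.
    by apply: measurable_bool_natr; exact: measurable_fun_ler.
have zb0 : 0 <= \int[l]_(z in `]0%R, +oo[) z%:E.
  by apply: integral_ge0 => z /=; rewrite in_itv/= andbT lee_fin => /ltW.
have zbf : U%:E * \int[l]_(z in `]0%R, +oo[) z%:E \is a fin_num.
  by rewrite fin_numM// ge0_fin_numE.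
under eq_integral do rewrite inner.
have Ipsi : \int[Lam]_p (psi p)%:E < +oo.
  apply: (@bounded_integral_lty _ `|M|%R) => //.
  - exact/measurable_EFinP.
  - by move=> p pT; rewrite psiT.
have Ipsi0 : 0 <= \int[Lam]_p (psi p)%:E.
  by apply: integral_ge0 => p _; rewrite lee_fin.
have mpsiE : measurable_fun setT (fun p => (psi p)%:E) by exact/measurable_EFinP.
rewrite ge0_integralZr//; last 2 first.
- by move=> p _; rewrite lee_fin.
- by rewrite mule_ge0.
by rewrite lte_mul_pinfty// ?ge0_fin_numE// -ge0_fin_numE// mule_ge0.
Qed.

Lemma compensator_accepted k w :
  \int[nu]_x ((1 - expR (- effect x)) * \1_(accepted k) (w, x))%:E = stopped_rate k w.
Proof.
have g0 (r : R) : (0 <= r)%R -> (0 <= 1 - expR (- r))%R.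
  by move=> r0; rewrite subr_ge0 -[leRHS]expR0 ler_expR oppr_le0.
rewrite nuE; last 3 first.
- apply/measurable_EFinP; apply: measurable_funM.
    apply: measurable_funB => //; apply: measurableT_comp => //.
    apply: measurableT_comp => //; exact: measurable_effect.
  exact: (measurableT_comp (measurable_indic (maccepted k)) (measurable_pair1 w)).
- by move=> x; rewrite lee_fin mulr_ge0// g0// effect_ge0.
- move=> x nx; congr EFin.
  have -> : effect x = 0%R; last by rewrite oppr0 expR0 subrr mul0r.
  rewrite /effect.
  have [xT|nxT] := pselect (0 < x.1 <= T)%R; last by rewrite psiT// !mul0r.
  have [z0|] := boolP (0 <= x.2.2.1)%R; last by rewrite mulr0 !mul0r.
  have [u0|] := boolP (0 <= x.2.2.2)%R; last by rewrite mulr0.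
  by exfalso; apply: nx.
apply: eq_integral => p _.
have rate0 := jump_rate_ge0 (w, p).
pose F0 := mean_effect p.
pose h (z : R) := (1 - expR (- (psi p * z)))%R.
have h00 : h 0%R = 0%R by rewrite /h mulr0 oppr0 expR0 subrr.
have mh : measurable_fun setT (fun z => (h z * (0 <= z)%R%:R)%R).
  apply: measurable_funM; last by apply: measurable_bool_natr; exact: measurable_fun_ler.
  apply: measurable_funB => //; apply: measurableT_comp => //.
  by apply: measurableT_comp => //; exact: measurable_funM.
have h0 z : (0 <= h z * (0 <= z)%R%:R)%R.
  by have [z0|z0] := leP 0%R z; rewrite ?mulr1 ?mulr0// g0// mulr_ge0.
transitivity (\int[l]_z ((h z * (0 <= z)%R%:R)%:E * ((active k (w, p))%:R%:E * jump_rate (w, p)))).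
  apply: eq_integral => z _.
  transitivity (\int[mu]_u ((active k (w, p))%:R * (h z * (0 <= z)%R%:R) * (0 <= u)%R%:R * (u%:E <= jump_rate (w, p))%E%:R)%:E).
    apply: eq_integral => u _; rewrite acceptedE /= /effect /h /= -surjective_pairing; congr EFin.
    have [z0|z0] := leP 0%R z; last by rewrite mulr0 mul0r oppr0 expR0 subrr !(mul0r, mulr0).
    have [u0|u0] := leP 0%R u; last by rewrite mulr0 oppr0 expR0 subrr !(mul0r, mulr0).
    by rewrite !mulr1; ring.
  rewrite integral_thinning//; last by rewrite mulr_ge0.
  by rewrite [in LHS]EFinM -muleA muleCA.
rewrite ge0_integralZr//; last 3 first.
- exact/measurable_EFinP.
- by move=> z _; rewrite lee_fin.
- by rewrite mule_ge0// lee_fin.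
by rewrite (integral_marks h00) muleC -muleA.
Qed.

Hypothesis hnu : forall h : Omega * atoms -> \bar R, measurable_fun setT h ->
  (forall p, 0 <= h p) -> measurable_fun setT (fun w => \int[nu]_x h (w, x)).
Hypothesis hexp : forall (k : nat) (f : atoms -> R), measurable_fun setT f ->
  (forall x, 0 <= f x)%R -> (forall x : atoms, ~ (0 < x.1 <= T)%R -> f x = 0%R) ->
  \int[nu]_x (f x)%:E < +oo ->
  \int[P]_w exponential_after N nu f 0 (accepted k) w = 1.

Definition accepted_sum (k : nat) (w : Omega) : \bar R :=
  \int[N w]_x (effect x * \1_(accepted k) (w, x))%:E.

Lemma accepted_sum_ge0 k w : 0 <= accepted_sum k w.
Proof. by apply: integral_ge0 => x _; rewrite lee_fin mulr_ge0// effect_ge0. Qed.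

Lemma stopped_rate_ge0 k w : 0 <= stopped_rate k w.
Proof. by apply: integral_ge0 => p _; rewrite mule_ge0// lee_fin. Qed.

Lemma measurable_accepted_sum k : measurable_fun setT (accepted_sum k).
Proof.
apply: (measurable_fun_integral_sfinite_kernel
  (fun p : Omega * atoms => (effect p.2 * \1_(accepted k) p)%:E) N).
- by move=> p; rewrite lee_fin mulr_ge0// effect_ge0.
- apply/measurable_EFinP; apply: measurable_funM; last exact: measurable_indic.
  by apply: measurableT_comp => //; exact: measurable_effect.
Qed.

Lemma measurable_stopped_rate k : measurable_fun setT (stopped_rate k).
Proof.
rewrite (_ : stopped_rate k = fun w =>
    \int[nu]_x ((1 - expR (- effect x)) * \1_(accepted k) (w, x))%:E); last first.
  by apply/funext => w; rewrite compensator_accepted.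
apply: (hnu (h := fun p => ((1 - expR (- effect p.2)) * \1_(accepted k) p)%:E)).
- apply/measurable_EFinP; apply: measurable_funM; last exact: measurable_indic.
  apply: measurable_funB => //; apply: measurableT_comp => //.
  apply: measurableT_comp => //; apply: measurableT_comp => //; exact: measurable_effect.
- move=> p; rewrite lee_fin mulr_ge0// subr_ge0 -[leRHS]expR0 ler_expR oppr_le0.
  exact: effect_ge0.
Qed.

Lemma cvg_expN_expeR (x y : nat -> \bar R) (a b : \bar R) :
  0 <= a -> x @ \oo --> a -> y @ \oo --> b -> b \is a fin_num ->
  (forall n, y n \is a fin_num) ->
  (fun n => expN (x n) * expeR (y n)) @ \oo --> expN a * expeR b.
Proof.
move=> a0 xa yb bfin yfin; apply: cvgeM.
- have := expN_fin a0; case: (expN a) => // r _.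
  by case: b bfin {yb} => // s _; rewrite /mule_def/= !negb_and !orbT.
- exact: cvg_expN.
- rewrite (_ : (fun n => expeR (y n)) = (fun n => (expR (fine (y n)))%:E)); last first.
    by apply/funext => n; rewrite -{1}(fineK (yfin n)).
  rewrite -(fineK bfin) /=; apply: cvg_EFin; first exact: nearW.
  apply: (@continuous_cvg _ _ _ _ _ (fun n => fine (y n)) expR); first exact: continuous_expR.
  by move: yb; rewrite -{1}(fineK bfin) => /fine_cvgP[].
Qed.

Lemma expectation_stopped k :
  \int[P]_w (expN (accepted_sum k w) * expeR (stopped_rate k w)) = 1.
Proof.
pose J (n : nat) w := jump_sum N (truncated_effect n%:R) 0 (accepted k) w.
pose C (n : nat) w := compensator nu (truncated_effect n%:R) 0 (accepted k) w.
have J0 n w : 0 <= J n w by exact: (jump_sum_ge0 N (truncated_effect_ge0 n%:R)).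
have C0 n w : 0 <= C n w by exact: (compensator_ge0 nu (truncated_effect_ge0 n%:R)).
have g0 (r : R) : (0 <= r)%R -> (0 <= 1 - expR (- r))%R.
  by move=> r0; rewrite subr_ge0 -[leRHS]expR0 ler_expR oppr_le0.
have mono (n i : nat) x : (n <= i)%N -> (truncated_effect n%:R x <= truncated_effect i%:R x)%R.
  move=> ni; rewrite /truncated_effect ler_wpM2l ?effect_ge0// ler_nat.
  have [xn|//] := boolP (x.2.2.2 <= n%:R)%R.
  by rewrite (le_trans xn)// ler_nat.
have pos0 (h : atoms -> R) x : (~ (0 < x.1 <= T)%R -> h x = 0%R) ->
    (h x * (0 < x.1)%R%:R = h x)%R.
  move=> hx; have [x0|x0] := ltP 0%R x.1; first by rewrite mulr1.
  by rewrite mulr0 hx// => /andP[]; rewrite ltNge x0.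
have mE1 (n : nat) := measurable_truncated_effect n%:R.
have mC1 (n : nat) : measurable_fun setT (fun x => 1 - expR (- truncated_effect n%:R x))%R.
  by apply: measurable_funB => //; apply: measurableT_comp => //; exact: measurableT_comp.
have eventually_eq x : \forall n \near \oo, truncated_effect n%:R x = effect x.
  near=> n; rewrite /truncated_effect (_ : (x.2.2.2 <= n%:R)%R) ?mulr1//.
  by near: n; exact: nbhs_infty_ger.
have CE n w : C n w = \int[nu]_x ((1 - expR (- truncated_effect n%:R x)) * \1_(accepted k) (w, x))%:E.
  apply: eq_integral => x _; rewrite (pos0 (fun x => 1 - expR (- truncated_effect n%:R x))%R)//.
  by move=> xT; rewrite truncated_effectT// oppr0 expR0 subrr.
have JE n w : J n w = \int[N w]_x (truncated_effect n%:R x * \1_(accepted k) (w, x))%:E.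
  apply: eq_integral => x _; rewrite (pos0 (truncated_effect n%:R))//.
  exact: truncated_effectT.
have mint (h : atoms -> R) w : measurable_fun setT h ->
    measurable_fun setT (fun x => (h x * \1_(accepted k) (w, x))%:E).
  move=> mh; apply/measurable_EFinP; apply: measurable_funM => //.
  exact: (measurableT_comp (measurable_indic (maccepted k)) (measurable_pair1 w)).
have Cle n w : C n w <= k%:R%:E.
  apply: le_trans (stopped_rate_le k w); rewrite -compensator_accepted CE.
  apply: ge0_le_integral => //.
  - by move=> x _; rewrite lee_fin mulr_ge0// g0// truncated_effect_ge0.
  - exact: mint.
  - apply: mint; apply: measurable_funB => //; apply: measurableT_comp => //.
    by apply: measurableT_comp => //; exact: measurable_effect.
  - move=> x _; rewrite lee_fin ler_wpM2r// lerD2l lerN2 ler_expR lerN2.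
    rewrite /truncated_effect -[leRHS]mulr1 ler_wpM2l ?effect_ge0//.
    by case: (x.2.2.2 <= n%:R)%R.
have Cfin n w : C n w \is a fin_num.
  by rewrite ge0_fin_numE// (le_lt_trans (Cle n w))// ltry.
have Sfin w : stopped_rate k w \is a fin_num.
  by rewrite ge0_fin_numE ?stopped_rate_ge0// (le_lt_trans (stopped_rate_le k w))// ltry.
have Jlim w : J ^~ w @ \oo --> accepted_sum k w.
  rewrite (_ : J ^~ w = fun n => \int[N w]_x (truncated_effect n%:R x * \1_(accepted k) (w, x))%:E); last first.
    by apply/funext => n; rewrite JE.
  rewrite (_ : accepted_sum k w = \int[N w]_x limn (fun n => (truncated_effect n%:R x * \1_(accepted k) (w, x))%:E)); last first.
    apply: eq_integral => x _; apply/esym/cvg_lim => //; apply: cvg_near_cst.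
    by apply: filterS (eventually_eq x) => n ->.
  apply: cvg_monotone_convergence => //.
  - by move=> n; exact: mint.
  - by move=> n x _; rewrite lee_fin mulr_ge0// truncated_effect_ge0.
  - by move=> x _ i j ij; rewrite lee_fin ler_wpM2r// mono.
have Clim w : C ^~ w @ \oo --> stopped_rate k w.
  rewrite (_ : C ^~ w = fun n => \int[nu]_x ((1 - expR (- truncated_effect n%:R x)) * \1_(accepted k) (w, x))%:E); last first.
    by apply/funext => n; rewrite CE.
  rewrite -compensator_accepted.
  rewrite (_ : \int[nu]_x _ = \int[nu]_x limn (fun n => ((1 - expR (- truncated_effect n%:R x)) * \1_(accepted k) (w, x))%:E)); last first.
    apply: eq_integral => x _; apply/esym/cvg_lim => //; apply: cvg_near_cst.
    by apply: filterS (eventually_eq x) => n ->.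
  apply: cvg_monotone_convergence => //.
  - by move=> n; exact: mint.
  - by move=> n x _; rewrite lee_fin mulr_ge0// g0// truncated_effect_ge0.
  - by move=> x _ i j ij; rewrite lee_fin ler_wpM2r// lerD2l lerN2 ler_expR lerN2 mono.
have lim := @bounded_cvg_integral _ _ _ P
  (fun n w => exponential_after N nu (truncated_effect n%:R) 0 (accepted k) w)
  (fun w => expN (accepted_sum k w) * expeR (stopped_rate k w)) (expR k%:R).
have {}lim : (fun n => \int[P]_w exponential_after N nu (truncated_effect n%:R) 0 (accepted k) w)
    @ \oo --> \int[P]_w (expN (accepted_sum k w) * expeR (stopped_rate k w)).
  apply: lim.
  - move=> n; apply: measurable_exponential_after => //; exact: truncated_effect_ge0.
  - apply: emeasurable_funM; first exact/measurable_expN/measurable_accepted_sum.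
    by apply: measurableT_comp measurable_expeR _; exact: measurable_stopped_rate.
  - by move=> n w; exact: exponential_after_ge0.
  - apply: aeW => w; apply: (@cvg_expN_expeR (J ^~ w) (C ^~ w)) => //.
    exact: accepted_sum_ge0.
  - apply: aeW => w n; rewrite -[leRHS]mul1e lee_pmul ?expN_ge0 ?expeR_ge0//.
      by apply: expN_le1; exact: J0.
    by rewrite -[_%:E]/(expeR k%:R%:E) lee_expeR; exact: Cle.
rewrite -(cvg_lim _ lim)//; apply/cvg_lim => //; apply: cvg_near_cst.
apply: nearW => n; apply: hexp => //.
- exact: truncated_effect_ge0.
- by move=> x; exact: truncated_effectT.
- exact: truncated_effect_integrable.
Unshelve. all: by end_near. Qed.

Context (Kt : R -> E -> E -> R) (g phi : R * E -> R).
Hypothesis mKt : measurable_fun setT (fun p : R * (E * E) => Kt p.1 p.2.1 p.2.2).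
Hypothesis Kt0 : forall r x y, (0 <= Kt r x y)%R.
Hypothesis KtN : forall r x y, (r <= 0)%R -> Kt r x y = 0%R.
Hypothesis mg : measurable_fun setT g.
Hypothesis g0 : forall p, (0 <= g p)%R.
Hypothesis gT : forall p : R * E, ~ (0 < p.1 <= T)%R -> g p = 0%R.
Hypothesis gM : exists M : R, forall p, (g p <= M)%R.
Hypothesis mphi : measurable_fun setT phi.
Hypothesis phi0 : forall p, (0 <= phi p)%R.
Hypothesis phiM : exists M : R, forall p, (phi p <= M)%R.

Definition thinned_mark (w : Omega) (x : atoms) : R :=
  (x.2.2.1 * (0 <= x.2.2.1)%R%:R * (0 <= x.2.2.2)%R%:R * (0 < x.1 <= T)%R%:R *
   (x.2.2.2%:E <= jump_rate (w, (x.1, x.2.1)))%E%:R)%R.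

Definition jump_part (q : Omega * (R * E)) : \bar R :=
  \int[N q.1]_x (Kt (q.2.1 - x.1) q.2.2 x.2.1 * thinned_mark q.1 x)%:E.

Lemma thinned_mark_ge0 w x : (0 <= thinned_mark w x)%R.
Proof.
rewrite /thinned_mark; have [z0|z0] := leP 0%R x.2.2.1; last by rewrite mulr0 !mul0r.
by rewrite !mulr_ge0.
Qed.

Lemma measurable_thinned_mark :
  measurable_fun setT (fun p : Omega * atoms => thinned_mark p.1 p.2).
Proof.
have ms : measurable_fun setT (fun p : Omega * atoms => p.2.1) by exact: measurableT_comp.
have my : measurable_fun setT (fun p : Omega * atoms => p.2.2.1).
  by apply: measurableT_comp => //; exact: measurableT_comp.
have mz : measurable_fun setT (fun p : Omega * atoms => p.2.2.2.1).
  by do 2 (apply: measurableT_comp => //); exact: measurableT_comp.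
have mu' : measurable_fun setT (fun p : Omega * atoms => p.2.2.2.2).
  by do 2 (apply: measurableT_comp => //); exact: measurableT_comp.
apply: measurable_funM.
  apply: measurable_funM.
    apply: measurable_funM.
      apply: measurable_funM => //.
      by apply: measurable_bool_natr; exact: measurable_fun_ler.
    by apply: measurable_bool_natr; exact: measurable_fun_ler.
  apply: measurable_bool_natr; apply: measurable_and; first exact: measurable_fun_ltr.
  exact: measurable_fun_ler.
apply: measurable_bool_natr; apply: measurable_fun_lee; first exact/measurable_EFinP.
apply: (measurableT_comp measurable_jump_rate).
by apply: measurable_fun_pair => //; exact: measurable_fun_pair.
Qed.

Lemma jump_part_ge0 q : 0 <= jump_part q.
Proof.
by apply: integral_ge0 => x _; rewrite lee_fin mulr_ge0// thinned_mark_ge0.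
Qed.

Lemma measurable_jump_part : measurable_fun setT jump_part.
Proof.
apply: (@measurable_integral_kernel_fst _ _ _ _ _ _ _ N
  (fun p : (Omega * (R * E)) * atoms =>
    (Kt (p.1.2.1 - p.2.1) p.1.2.2 p.2.2.1 * thinned_mark p.1.1 p.2)%:E)).
- apply/measurable_EFinP; apply: measurable_funM.
    pose k (p : (Omega * (R * E)) * atoms) := ((p.1.2.1 - p.2.1)%R, (p.1.2.2, p.2.2.1)).
    apply: (@measurableT_comp _ _ _ _ _ _ _ _ k mKt).
    apply: measurable_fun_pair.
      apply: measurable_funB; last exact: measurableT_comp.
      by apply: measurableT_comp => //; exact: measurableT_comp.
    apply: measurable_fun_pair.
      by apply: measurableT_comp => //; exact: measurableT_comp.
    by apply: measurableT_comp => //; exact: measurableT_comp.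
  apply: (@measurableT_comp _ _ _ _ _ _ _ _ (fun p : (Omega * (R * E)) * atoms => (p.1.1, p.2))
    measurable_thinned_mark).
  by apply: measurable_fun_pair => //; exact: measurableT_comp.
- by move=> p; rewrite lee_fin mulr_ge0// thinned_mark_ge0.
Qed.

Lemma measurable_kernel_shift : measurable_fun setT
  (fun p : atoms * (R * E) => Kt (p.2.1 - p.1.1) p.2.2 p.1.2.1).
Proof.
pose k (p : atoms * (R * E)) := ((p.2.1 - p.1.1)%R, (p.2.2, p.1.2.1)).
apply: (@measurableT_comp _ _ _ _ _ _ _ _ k mKt).
apply: measurable_fun_pair.
  by apply: measurable_funB; exact: measurableT_comp.
apply: measurable_fun_pair; first exact: measurableT_comp.
by apply: measurableT_comp => //; exact: measurableT_comp.
Qed.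

Lemma dual_fubini w (c : R * E -> \bar R) : measurable_fun setT c ->
  (forall q, 0 <= c q) ->
  \int[N w]_x ((\int[Lam]_q (c q * (Kt (q.1 - x.1) q.2 x.2.1)%:E)) * (thinned_mark w x)%:E) =
  \int[Lam]_q (c q * jump_part (w, q)).
Proof.
move=> mc c0.
have mth : measurable_fun setT (fun x => thinned_mark w x).
  exact: (measurableT_comp measurable_thinned_mark (measurable_pair1 w)).
pose h (p : atoms * (R * E)) : \bar R :=
  c p.2 * (Kt (p.2.1 - p.1.1) p.2.2 p.1.2.1)%:E * (thinned_mark w p.1)%:E.
have h0 p : 0 <= h p.
  by rewrite mule_ge0 ?mule_ge0// lee_fin// thinned_mark_ge0.
have mh : measurable_fun setT h.
  apply: emeasurable_funM; last by apply/measurable_EFinP; exact: measurableT_comp.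
  apply: emeasurable_funM; first exact: measurableT_comp.
  by apply/measurable_EFinP; exact: measurable_kernel_shift.
have mq (x : atoms) : measurable_fun setT (fun q : R * E => (Kt (q.1 - x.1) q.2 x.2.1)%:E).
  apply/measurable_EFinP.
  exact: (measurableT_comp measurable_kernel_shift (measurable_pair1 x)).
have mx (q : R * E) : measurable_fun setT (fun x : atoms => Kt (q.1 - x.1) q.2 x.2.1).
  exact: (measurableT_comp measurable_kernel_shift (measurable_pair2 q)).
transitivity (\int[N w]_x \int[Lam]_q h (x, q)).
  apply: eq_integral => x _; rewrite /h /= [RHS]ge0_integralZr//.
  - by apply: emeasurable_funM => //; exact: mq.
  - by move=> q _; rewrite mule_ge0// lee_fin.
  - by rewrite lee_fin thinned_mark_ge0.
have -> := @sfinite_kernel_Fubini R _ _ _ _ _ _ mu m _ _ N w h mh h0.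
apply: eq_integral => q _.
transitivity (\int[N w]_x (c q * (Kt (q.1 - x.1) q.2 x.2.1 * thinned_mark w x)%:E)).
  by apply: eq_integral => x _; rewrite /h /= -muleA EFinM.
rewrite ge0_integralZl//.
- by apply/measurable_EFinP; exact: measurable_funM.
- by move=> x _; rewrite lee_fin mulr_ge0// thinned_mark_ge0.
Qed.

Hypothesis hV : forall p : R * E, (0 < p.1 <= T)%R ->
  {ae P, forall w, V (w, p) = (phi p)%:E + jump_part (w, p)}.
Hypothesis hpsi : forall (s : R) (y : E), (0 < s <= T)%R ->
  (psi (s, y))%:E =
  \int[Lam]_q (((g q)%:E + lambda1%:E * mean_effect q) * (Kt (q.1 - s) q.2 y)%:E).
Hypothesis hEV : exists M : R, forall q : R * E, (0 < q.1 <= T)%R ->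
  \int[P]_w V (w, q) <= M%:E.

Definition base_rate : \bar R :=
  \int[Lam]_q ((lambda0 + lambda1 * phi q)%:E * mean_effect q).

Definition total_sum (w : Omega) : \bar R :=
  \int[N w]_x (psi (x.1, x.2.1) * thinned_mark w x)%:E.

Lemma mean_effect_bounded : exists M : R, (0 <= M)%R /\ forall q, mean_effect q <= M%:E.
Proof.
have [M hM] := psiM.
have z0 : 0 <= \int[l]_(z in `]0%R, +oo[) z%:E.
  by apply: integral_ge0 => z /=; rewrite in_itv/= andbT lee_fin => /ltW.
exists (`|M| * fine (\int[l]_(z in `]0%R, +oo[) z%:E))%R; split.
  by rewrite mulr_ge0// fine_ge0.
move=> q; apply: le_trans (laplace_exponent_le _ (psi0 q)) _.
rewrite EFinM fineK ?ge0_fin_numE//; apply: lee_wpmul2r => //.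
by rewrite lee_fin; apply: le_trans (hM q) (ler_norm _).
Qed.

Lemma cumulated_rateT w : cumulated_rate w T = \int[Lam]_q (jump_rate (w, q) * mean_effect q).
Proof.
apply: eq_integral => q _; have [qT|/negP qT] := boolP (q.1 <= T)%R.
  by rewrite mul1e.
by rewrite mean_effectT ?mule0// => /andP[].
Qed.

Lemma base_rate_ge0 : 0 <= base_rate.
Proof.
apply: integral_ge0 => q _; rewrite mule_ge0 ?mean_effect_ge0// lee_fin.
by rewrite addr_ge0 ?mulr_ge0.
Qed.

Let mbase : measurable_fun setT (fun q => (lambda0 + lambda1 * phi q)%:E * mean_effect q).
Proof.
apply: emeasurable_funM; last exact: measurable_mean_effect.
by apply/measurable_EFinP; apply: measurable_funD => //; exact: measurable_funM.
Qed.

Lemma base_rate_lty : base_rate < +oo.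
Proof.
have [M [M0 hM]] := mean_effect_bounded; have [L hL] := phiM.
apply: (@bounded_integral_lty _ ((lambda0 + lambda1 * `|L|) * M)) => //.
- move=> q; rewrite mule_ge0 ?mean_effect_ge0// lee_fin.
  by rewrite addr_ge0 ?mulr_ge0.
- move=> q; rewrite EFinM; apply: lee_pmul => //.
  + by rewrite lee_fin addr_ge0 ?mulr_ge0.
  + exact: mean_effect_ge0.
  + rewrite lee_fin lerD2l ler_wpM2l//; exact: le_trans (hL q) (ler_norm _).
- by move=> q qT; rewrite mean_effectT// mule0.
Qed.

Lemma initial_pairing_lty : \int[Lam]_q (g q * phi q)%:E < +oo.
Proof.
have [M hM] := gM; have [L hL] := phiM.
apply: (@bounded_integral_lty _ (`|M| * `|L|)) => //.
- by apply/measurable_EFinP; exact: measurable_funM.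
- by move=> q; rewrite lee_fin mulr_ge0.
- move=> q; rewrite lee_fin ler_pM//.
    exact: le_trans (hM q) (ler_norm _).
  exact: le_trans (hL q) (ler_norm _).
- by move=> q qT; rewrite gT// mul0r.
Qed.

Lemma measurable_cumulated_rateT : measurable_fun setT (cumulated_rate ^~ T).
Proof.
rewrite (_ : cumulated_rate ^~ T =
    fun w => \int[Lam]_q (jump_rate (w, q) * mean_effect q)); last first.
  by apply/funext => w; rewrite cumulated_rateT.
have := @measurable_integral_product R _ _ _ Omega _ E mu m
  (fun p : Omega * (R * E) => jump_rate p * mean_effect p.2).
apply.
- apply: emeasurable_funM; first exact: measurable_jump_rate.
  by apply: measurableT_comp => //; exact: measurable_mean_effect.
- by move=> p; rewrite mule_ge0 ?jump_rate_ge0 ?mean_effect_ge0.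
Qed.

Lemma ae_cumulated_rate_lty : {ae P, forall w, cumulated_rate w T < +oo}.
Proof.
have c0 w : 0 <= cumulated_rate w T.
  by apply: integral_ge0 => q _; rewrite mule_ge0 ?mule_ge0 ?jump_rate_ge0 ?mean_effect_ge0// lee_fin.
have fin : \int[P]_w cumulated_rate w T < +oo.
  have -> : \int[P]_w cumulated_rate w T =
      \int[P]_w \int[Lam]_q (jump_rate (w, q) * mean_effect q).
    by apply: eq_integral => w _; rewrite cumulated_rateT.
  rewrite (@product_Fubini R _ _ _ Omega _ E mu m P
    (fun p : Omega * (R * E) => jump_rate p * mean_effect p.2)); last 2 first.
  - apply: emeasurable_funM; first exact: measurable_jump_rate.
    by apply: measurableT_comp => //; exact: measurable_mean_effect.
  - by move=> p; rewrite mule_ge0 ?jump_rate_ge0 ?mean_effect_ge0.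
  have [M [M0 hM]] := mean_effect_bounded; have [L hL] := hEV.
  have mr q : measurable_fun setT (fun w => jump_rate (w, q)).
    exact: (measurableT_comp measurable_jump_rate (measurable_pair2 q)).
  have EE q : \int[P]_w (jump_rate (w, q) * mean_effect q) =
      (\int[P]_w jump_rate (w, q)) * mean_effect q.
    by rewrite ge0_integralZr ?mean_effect_ge0// => w _; exact: jump_rate_ge0.
  apply: (@bounded_integral_lty _ ((lambda0 + lambda1 * `|L|) * M)).
  - apply: (@measurable_fun_fubini_tonelli_G _ _ _ _ R P
      (fun p : Omega * (R * E) => jump_rate p * mean_effect p.2)).
    + apply: emeasurable_funM; first exact: measurable_jump_rate.
      by apply: measurableT_comp => //; exact: measurable_mean_effect.
    + by move=> p; rewrite mule_ge0 ?jump_rate_ge0 ?mean_effect_ge0.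
  - move=> q; apply: integral_ge0 => w _.
    by rewrite mule_ge0 ?jump_rate_ge0 ?mean_effect_ge0.
  - move=> q; rewrite EE; have [qT|qT] := pselect (0 < q.1 <= T)%R; last first.
      by rewrite mean_effectT// mule0 lee_fin mulr_ge0// addr_ge0// mulr_ge0.
    rewrite EFinM; apply: lee_pmul => //.
    + by apply: integral_ge0 => w _; exact: jump_rate_ge0.
    + exact: mean_effect_ge0.
    have mVq : measurable_fun setT (fun w => V (w, q)).
      exact: (measurableT_comp mV (measurable_pair2 q)).
    rewrite /jump_rate ge0_integralD//; last 2 first.
    + by move=> w _; rewrite mule_ge0// lee_fin.
    + exact: measurable_funeM.
    rewrite integral_cst//= probability_setT mule1 ge0_integralZl_EFin// EFinD.
    rewrite leeD2l// EFinM lee_wpmul2l ?lee_fin//.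
    by apply: le_trans (hL q qT) _; rewrite lee_fin ler_norm.
  - by move=> q qT; rewrite integral0_eq// => w _; rewrite mean_effectT// mule0.
have int : P.-integrable setT (cumulated_rate ^~ T).
  apply/integrableP; split; first exact: measurable_cumulated_rateT.
  by under eq_integral do rewrite gee0_abs//.
have := integrable_ae measurableT int; apply: filterS => w /(_ I).
by rewrite ge0_fin_numE.
Qed.

Lemma ae_volterra : {ae P, forall w, {ae Lam, forall q, (0 < q.1 <= T)%R ->
  V (w, q) = (phi q)%:E + jump_part (w, q)}}.
Proof.
pose W (p : Omega * (R * E)) := (phi p.2)%:E + jump_part p.
have mW : measurable_fun setT W.
  apply: emeasurable_funD; last exact: measurable_jump_part.
  by apply/measurable_EFinP; exact: measurableT_comp.
pose B := [set p : Omega * (R * E) | (0 < p.2.1 <= T)%R /\ V p <> W p].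
have mneq : measurable [set p : Omega * (R * E) | V p <> W p].
  have := measurable_neqe measurableT mV mW; rewrite setTI.
  by congr (measurable _); apply/seteqP; split => p /= /eqP.
have mB : measurable B.
  apply: measurableI => //.
  have mf : measurable_fun setT (fun p : Omega * (R * E) => p.2.1) by exact: measurableT_comp.
  have := mf measurableT _ (measurable_itv `]0%R, T]); rewrite setTI.
  by congr (measurable _); apply/seteqP; split => p /=; rewrite in_itv.
have B0 q : P [set w | B (w, q)] = 0.
  have [qT|qT] := pselect (0 < q.1 <= T)%R; last first.
    rewrite (_ : [set w | _] = set0) ?measure0//.
    by apply/seteqP; split => w // [].
  have [A [mA A0 hA]] := hV qT.
  apply: (subset_measure0 _ mA) => //.
    by have := measurable_pair2 q measurableT mB; rewrite setTI.
  by move=> w [_ hw]; exact: hA.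
have := @ae_sections R _ _ _ Omega _ E mu m P B mB B0; apply: filterS => w; apply: filterS => q /= nB qT.
by apply: contrapT => ne; apply: nB.
Qed.

Lemma measurable_total_sum : measurable_fun setT total_sum.
Proof.
apply: (measurable_fun_integral_sfinite_kernel
  (fun p : Omega * atoms => (psi (p.2.1, p.2.2.1) * thinned_mark p.1 p.2)%:E) N).
- by move=> p; rewrite lee_fin mulr_ge0// thinned_mark_ge0.
- apply/measurable_EFinP; apply: measurable_funM; last exact: measurable_thinned_mark.
  apply: (measurableT_comp mpsi); apply: measurable_fun_pair; first exact: measurableT_comp.
  by apply: measurableT_comp => //; exact: measurableT_comp.
Qed.

Lemma effect_acceptedE k w x : (effect x * \1_(accepted k) (w, x) =
  psi (x.1, x.2.1) * thinned_mark w x * (active k (w, (x.1, x.2.1)))%:R)%R.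
Proof.
rewrite acceptedE /effect /thinned_mark.
have [xT|xT] := boolP (0 < x.1 <= T)%R; first by rewrite mulr1; ring.
by rewrite psiT ?mul0r//; exact/negP.
Qed.

Lemma active_antitone k w (s t : R) (x y : E) : (s <= t)%R -> (0 < s <= T)%R ->
  active k (w, (t, y)) -> active k (w, (s, x)).
Proof.
move=> st sT; rewrite /active !inE/= => -[_ h]; split => //.
by apply: le_trans h; exact: cumulated_rate_le.
Qed.

Let mJ w : measurable_fun setT (fun q => jump_part (w, q)).
Proof. exact: (measurableT_comp measurable_jump_part (measurable_pair1 w)). Qed.

Let measurable_dual_integral w (c : R * E -> \bar R) : measurable_fun setT c ->
  (forall q, 0 <= c q) ->
  measurable_fun setT (fun x : atoms => (\int[Lam]_q (c q * (Kt (q.1 - x.1) q.2 x.2.1)%:E)) *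
    (thinned_mark w x)%:E).
Proof.
move=> mc c0; apply: emeasurable_funM; last first.
  apply/measurable_EFinP.
  exact: (measurableT_comp measurable_thinned_mark (measurable_pair1 w)).
have := @measurable_integral_product R _ _ _ atoms _ E mu m
  (fun p : atoms * (R * E) => c p.2 * (Kt (p.2.1 - p.1.1) p.2.2 p.1.2.1)%:E).
apply.
- apply: emeasurable_funM; first exact: measurableT_comp.
  by apply/measurable_EFinP; exact: measurable_kernel_shift.
- by move=> p; rewrite mule_ge0// lee_fin.
Qed.

Let mKx (x : R) (y : E) : measurable_fun setT (fun q : R * E => (Kt (q.1 - x) q.2 y)%:E).
Proof.
apply/measurable_EFinP.
exact: (measurableT_comp measurable_kernel_shift
  (measurable_pair1 ((x, (y, (0, 0)))%R : atoms))).
Qed.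

Let mdual : measurable_fun setT (fun q => (g q)%:E + lambda1%:E * mean_effect q).
Proof.
apply: emeasurable_funD; first exact/measurable_EFinP.
by apply: measurable_funeM; exact: measurable_mean_effect.
Qed.

Lemma jump_rate_split w q : ((0 < q.1 <= T)%R -> V (w, q) = (phi q)%:E + jump_part (w, q)) ->
  jump_rate (w, q) * mean_effect q =
  ((lambda0 + lambda1 * phi q)%:E + lambda1%:E * jump_part (w, q)) * mean_effect q.
Proof.
have [qT /(_ qT) VE|qT _] := pselect (0 < q.1 <= T)%R; last first.
  by rewrite mean_effectT// !mule0.
congr (_ * _); rewrite /jump_rate VE.
rewrite (@ge0_muleDr _ _ (phi q)%:E) ?jump_part_ge0 ?lee_fin//.
by rewrite EFinD EFinM addeA.
Qed.

(* The kernel vanishes at nonpositive times, so that the jumps contributing to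
   the rate at an active time happened at an active time. *)
Lemma stopped_rate_le_sum k w :
  {ae Lam, forall q, (0 < q.1 <= T)%R -> V (w, q) = (phi q)%:E + jump_part (w, q)} ->
  stopped_rate k w <= base_rate + accepted_sum k w.
Proof.
move=> hw.
pose c q := lambda1%:E * mean_effect q * (active k (w, q))%:R%:E.
have c0 q : 0 <= c q by rewrite !mule_ge0 ?mean_effect_ge0 ?lee_fin.
have mc : measurable_fun setT c.
  apply: emeasurable_funM; last exact/measurable_EFinP.
  by apply: measurable_funeM; exact: measurable_mean_effect.
have mcJ : measurable_fun setT (fun q => c q * jump_part (w, q)).
  by apply: emeasurable_funM.
have mab : measurable_fun setT (fun q => (active k (w, q))%:R%:E *
    ((lambda0 + lambda1 * phi q)%:E * mean_effect q)).
  by apply: emeasurable_funM => //; exact/measurable_EFinP.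
have b0 q : 0 <= (lambda0 + lambda1 * phi q)%:E * mean_effect q.
  rewrite mule_ge0 ?mean_effect_ge0// ?lee_fin.
  by rewrite addr_ge0 ?mulr_ge0.
have -> : stopped_rate k w = \int[Lam]_q ((active k (w, q))%:R%:E *
    ((lambda0 + lambda1 * phi q)%:E * mean_effect q) + c q * jump_part (w, q)).
  apply: ae_eq_ge0_integral.
  - exact: mcut.
  - exact: emeasurable_funD.
  - by move=> q; rewrite mule_ge0// ?lee_fin.
  - by move=> q; apply: adde_ge0; rewrite mule_ge0 ?jump_part_ge0 ?lee_fin.
  have [A [mA A0 hA]] := hw; exists A; split => //.
  apply: subset_trans hA => q /= nq hq; apply: nq; rewrite /c jump_rate_split//.
  have p0 : (0 <= lambda0 + lambda1 * phi q)%R by rewrite addr_ge0 ?mulr_ge0.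
  rewrite (@ge0_muleDl _ (mean_effect q)) ?lee_fin ?mule_ge0 ?jump_part_ge0 ?lee_fin//.
  rewrite ge0_muleDr ?mule_ge0 ?mule_ge0 ?jump_part_ge0 ?mean_effect_ge0 ?lee_fin//.
  congr (_ + _); rewrite -!muleA muleCA; congr (_ * _).
  by rewrite [X in _ * X = _]muleC muleCA.
rewrite ge0_integralD//; last 2 first.
- by move=> q _; rewrite mule_ge0// ?lee_fin.
- by move=> q _; rewrite mule_ge0// jump_part_ge0.
apply: leeD.
  apply: ge0_le_integral => //.
  - by move=> q _; rewrite mule_ge0// ?lee_fin.
  - by move=> q _; rewrite -[leRHS]mul1e lee_wpmul2r// lee_fin; case: active.
rewrite -dual_fubini//; apply: ge0_le_integral => //.
- move=> x _; rewrite mule_ge0 ?lee_fin ?thinned_mark_ge0//.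
  by apply: integral_ge0 => q _; rewrite mule_ge0// ?lee_fin.
- exact: measurable_dual_integral.
- apply/measurable_EFinP; apply: measurable_funM; first exact: measurable_effect.
  exact: (measurableT_comp (measurable_indic (maccepted k)) (measurable_pair1 w)).
move=> x _; rewrite effect_acceptedE.
have [xT|xT] := pselect (0 < x.1 <= T)%R; last first.
  by rewrite /thinned_mark (negbTE (introN idP xT)) !mulr0 !mul0r mulr0 mul0r mule0.
have [ax|ax] := boolP (active k (w, (x.1, x.2.1))); last first.
  rewrite integral0_eq ?mul0e ?mulr0// => q _.
  have [qx|xq] := leP q.1 x.1.
    by rewrite KtN ?mule0// subr_le0.
  rewrite /c; case: (boolP (active k (w, q))) => [aq|_]; last by rewrite mule0 mul0e.
  rewrite (surjective_pairing q) in aq.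
  by rewrite (active_antitone x.2.1 (ltW xq) xT aq) in ax.
rewrite mulr1 [leRHS]EFinM; apply: lee_wpmul2r; first by rewrite lee_fin thinned_mark_ge0.
rewrite hpsi//; apply: ge0_le_integral => //.
- by move=> q _; rewrite mule_ge0// ?lee_fin.
- by apply: emeasurable_funM => //; exact: mKx.
- by apply: emeasurable_funM => //; exact: mKx.
move=> q _; rewrite lee_wpmul2r ?lee_fin//.
rewrite /c; apply: (@le_trans _ _ (lambda1%:E * mean_effect q)).
  rewrite -[leRHS]mule1 lee_wpmul2l ?mule_ge0 ?mean_effect_ge0 ?lee_fin//.
  by case: active.
by rewrite leeDr// ?lee_fin.
Qed.

Lemma eventually_stopped_rate w : cumulated_rate w T < +oo ->
  \forall k \near \oo, stopped_rate k w = cumulated_rate w T /\ accepted_sum k w = total_sum w.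
Proof.
move=> cfin; set c := cumulated_rate w T in cfin *.
have c0 : 0 <= c.
  by apply: integral_ge0 => q _; rewrite mule_ge0 ?mule_ge0 ?jump_rate_ge0 ?mean_effect_ge0// lee_fin.
exists (Num.truncn (fine c)).+1 => // k /= ck.
have ck' : c <= k%:R%:E.
  rewrite -[c]fineK ?ge0_fin_numE// lee_fin ltW//.
  apply: lt_le_trans (truncnS_gt _) _; by rewrite ler_nat.
have act q : (0 < q.1 <= T)%R -> active k (w, q).
  move=> qT; rewrite /active inE /=; split => //; apply: le_trans ck'.
  by apply: cumulated_rate_le; case/andP: qT.
split.
  rewrite /c cumulated_rateT; apply: eq_integral => q _.
  have [qT|qT] := pselect (0 < q.1 <= T)%R; first by rewrite act// mul1e.
  by rewrite mean_effectT// !mule0.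
apply: eq_integral => x _; rewrite effect_acceptedE.
have [xT|xT] := boolP (0 < x.1 <= T)%R; first by rewrite act// mulr1.
by rewrite psiT ?mul0r//; exact/negP.
Qed.

Lemma expN_expeR_le (a b c : \bar R) : 0 <= a -> c \is a fin_num -> b <= c + a ->
  expN a * expeR b <= expeR c.
Proof.
case: a => [a||]//=; last by rewrite expNy mul0e expeR_ge0.
case: b => [b||]//= a0; case: c => [c||]//= _; rewrite ?leye_eq//; last first.
  by move=> _; rewrite mule0 lee_fin expR_ge0.
rewrite lee_fin => h; rewrite /expN /= -EFinM lee_fin -expRD ler_expR; lra.
Qed.

Lemma expectation_total :
  \int[P]_w (expN (total_sum w) * expeR (cumulated_rate w T)) = 1.
Proof.
have bfin : base_rate \is a fin_num by rewrite ge0_fin_numE ?base_rate_ge0 ?base_rate_lty.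
have lim := @bounded_cvg_integral _ _ _ P
  (fun k w => expN (accepted_sum k w) * expeR (stopped_rate k w))
  (fun w => expN (total_sum w) * expeR (cumulated_rate w T)) (expR (fine base_rate)).
have {}lim : (fun k => \int[P]_w (expN (accepted_sum k w) * expeR (stopped_rate k w)))
    @ \oo --> \int[P]_w (expN (total_sum w) * expeR (cumulated_rate w T)).
  apply: lim.
  - move=> k; apply: emeasurable_funM; first exact/measurable_expN/measurable_accepted_sum.
    by apply: measurableT_comp measurable_expeR _; exact: measurable_stopped_rate.
  - apply: emeasurable_funM; first exact/measurable_expN/measurable_total_sum.
    by apply: measurableT_comp measurable_expeR _; exact: measurable_cumulated_rateT.
  - by move=> k w; rewrite mule_ge0 ?expN_ge0 ?expeR_ge0.
  - apply: filterS ae_cumulated_rate_lty => w /eventually_stopped_rate ev.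
    by apply: cvg_near_cst; apply: filterS ev => k [-> ->].
  - apply: filterS ae_volterra => w hw k.
    rewrite -[leRHS]/(expeR (fine base_rate)%:E) fineK//.
    by apply: expN_expeR_le => //; [exact: accepted_sum_ge0|exact: stopped_rate_le_sum].
rewrite -(cvg_lim _ lim)//; apply/cvg_lim => //; apply: cvg_near_cst.
by apply: nearW => k; exact: expectation_stopped.
Qed.

Let integral_LamD (f h : R * E -> \bar R) : measurable_fun setT f -> measurable_fun setT h ->
  (forall q, 0 <= f q) -> (forall q, 0 <= h q) ->
  \int[Lam]_q f q + \int[Lam]_q h q = \int[Lam]_q (f q + h q).
Proof. by move=> mf mh f0 h0; rewrite ge0_integralD. Qed.

Theorem volterra_laplace :
  \int[P]_w expN (\int[Lam]_q ((g q)%:E * V (w, q))) =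
  expN (\int[Lam]_q (g q * phi q)%:E + base_rate).
Proof.
have bfin : base_rate \is a fin_num by rewrite ge0_fin_numE ?base_rate_ge0 ?base_rate_lty.
pose Ig := \int[Lam]_q (g q * phi q)%:E.
have Ig0 : 0 <= Ig by apply: integral_ge0 => q _; rewrite lee_fin mulr_ge0.
have Igfin : Ig \is a fin_num by rewrite ge0_fin_numE// initial_pairing_lty.
pose G w := \int[Lam]_q ((g q)%:E * jump_part (w, q)).
have G0 w : 0 <= G w.
  by apply: integral_ge0 => q _; rewrite mule_ge0 ?jump_part_ge0// lee_fin.
have mG : measurable_fun setT G.
  have := @measurable_integral_product R _ _ _ Omega _ E mu m
    (fun p : Omega * (R * E) => (g p.2)%:E * jump_part p).
  apply.
  - apply: emeasurable_funM; last exact: measurable_jump_part.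
    by apply/measurable_EFinP; exact: measurableT_comp.
  - by move=> p; rewrite mule_ge0 ?jump_part_ge0// lee_fin.
have mgJ w : measurable_fun setT (fun q => (g q)%:E * jump_part (w, q)).
  by apply: emeasurable_funM => //; exact/measurable_EFinP.
have mMJ w : measurable_fun setT (fun q => lambda1%:E * mean_effect q * jump_part (w, q)).
  apply: emeasurable_funM => //; apply: measurable_funeM.
  exact: measurable_mean_effect.
pose j w := \int[Lam]_q (lambda1%:E * mean_effect q * jump_part (w, q)).
have c0 q : 0 <= lambda1%:E * mean_effect q by rewrite mule_ge0 ?mean_effect_ge0 ?lee_fin.
have j0 w : 0 <= j w.
  by apply: integral_ge0 => q _; rewrite mule_ge0 ?jump_part_ge0.
have totalE w : total_sum w = G w + j w.
  rewrite /G /j integral_LamD//; last 2 first.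
  - by move=> q; rewrite mule_ge0 ?jump_part_ge0// lee_fin.
  - by move=> q; rewrite mule_ge0 ?jump_part_ge0.
  transitivity (\int[Lam]_q (((g q)%:E + lambda1%:E * mean_effect q) * jump_part (w, q))).
    rewrite -dual_fubini//; last by move=> q; rewrite adde_ge0// lee_fin.
    apply: eq_integral => x _; rewrite [LHS]EFinM.
    have [xT|xT] := pselect (0 < x.1 <= T)%R; first by rewrite hpsi.
    by rewrite /thinned_mark (negbTE (introN idP xT)) mulr0 mul0r !mule0.
  by apply: eq_integral => q _; rewrite ge0_muleDl// lee_fin.
have cumulatedE w :
    {ae Lam, forall q, (0 < q.1 <= T)%R -> V (w, q) = (phi q)%:E + jump_part (w, q)} ->
    cumulated_rate w T = base_rate + j w.
  move=> hw; rewrite cumulated_rateT /base_rate /j integral_LamD//; last 2 first.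
  - by move=> q; rewrite mule_ge0 ?mean_effect_ge0 ?lee_fin ?addr_ge0 ?mulr_ge0.
  - by move=> q; rewrite mule_ge0 ?jump_part_ge0.
  apply: ae_eq_ge0_integral.
  - exact: mrm.
  - by apply: emeasurable_funD; [exact: mbase|exact: mMJ].
  - exact: rm0.
  - move=> q; apply: adde_ge0; first by rewrite mule_ge0 ?mean_effect_ge0 ?lee_fin ?addr_ge0 ?mulr_ge0.
    by rewrite mule_ge0 ?jump_part_ge0.
  have [A [mA A0 hA]] := hw; exists A; split => //.
  apply: subset_trans hA => q /= nq hq; apply: nq; rewrite jump_rate_split//.
  have p0 : (0 <= lambda0 + lambda1 * phi q)%R by rewrite addr_ge0 ?mulr_ge0.
  rewrite (@ge0_muleDl _ (mean_effect q)) ?lee_fin ?mule_ge0 ?jump_part_ge0 ?lee_fin//.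
  by congr (_ + _); rewrite -muleA [X in _ * X = _]muleC muleA.
have valueE w :
    {ae Lam, forall q, (0 < q.1 <= T)%R -> V (w, q) = (phi q)%:E + jump_part (w, q)} ->
    \int[Lam]_q ((g q)%:E * V (w, q)) = Ig + G w.
  move=> hw; rewrite /Ig /G integral_LamD//; last 3 first.
  - by apply/measurable_EFinP; exact: measurable_funM.
  - by move=> q; rewrite lee_fin mulr_ge0.
  - by move=> q; rewrite mule_ge0 ?jump_part_ge0// lee_fin.
  apply: ae_eq_ge0_integral.
  - apply: emeasurable_funM; first exact/measurable_EFinP.
    exact: (measurableT_comp mV (measurable_pair1 w)).
  - apply: emeasurable_funD; last exact: mgJ.
    by apply/measurable_EFinP; exact: measurable_funM.
  - by move=> q; rewrite mule_ge0// lee_fin.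
  - move=> q; apply: adde_ge0; first by rewrite lee_fin mulr_ge0.
    by rewrite mule_ge0 ?jump_part_ge0// lee_fin.
  have [A [mA A0 hA]] := hw; exists A; split => //.
  apply: subset_trans hA => q /= nq hq; apply: nq.
  have [qT|qT] := pselect (0 < q.1 <= T)%R; last by rewrite gT// mul0r !mul0e add0e.
  by rewrite hq// ge0_muleDr ?jump_part_ge0 ?lee_fin// EFinM.
have EG : \int[P]_w expN (G w) * expeR base_rate = 1.
  rewrite -ge0_integralZr//; last 3 first.
  - exact/measurable_expN.
  - by move=> w _; exact: expN_ge0.
  - exact: expeR_ge0.
  rewrite -expectation_total; apply: ae_eq_ge0_integral.
  - apply: emeasurable_funM; first exact/measurable_expN.
    exact: measurable_cst.
  - apply: emeasurable_funM; first exact/measurable_expN/measurable_total_sum.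
    by apply: measurableT_comp measurable_expeR _; exact: measurable_cumulated_rateT.
  - by move=> w; rewrite mule_ge0 ?expN_ge0 ?expeR_ge0.
  - by move=> w; rewrite mule_ge0 ?expN_ge0 ?expeR_ge0.
  apply: filterS2 ae_volterra ae_cumulated_rate_lty => w hw cfin.
  rewrite totalE (cumulatedE w hw) (@expND _ (G w) (j w))//.
  have jfin : j w \is a fin_num.
    rewrite ge0_fin_numE//; apply: le_lt_trans cfin.
    by rewrite (cumulatedE w hw) leeDr// base_rate_ge0.
  rewrite -muleA; congr (_ * _).
  rewrite -(fineK jfin) -(fineK bfin) /expN /= -EFinM -expRD; congr (expR _)%:E; ring.
have -> : \int[P]_w expN (\int[Lam]_q ((g q)%:E * V (w, q))) = \int[P]_w (expN Ig * expN (G w)).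
  apply: ae_eq_ge0_integral.
  - apply: measurable_expN.
    have := @measurable_integral_product R _ _ _ Omega _ E mu m
      (fun p : Omega * (R * E) => (g p.2)%:E * V p).
    apply.
    + apply: emeasurable_funM => //.
      by apply/measurable_EFinP; exact: measurableT_comp.
    + by move=> p; rewrite mule_ge0// lee_fin.
  - by apply: measurable_funeM; exact: measurable_expN.
  - by move=> w; exact: expN_ge0.
  - by move=> w; rewrite mule_ge0 ?expN_ge0.
  by apply: filterS ae_volterra => w hw; rewrite (valueE w hw) (@expND _ Ig (G w)).
rewrite ge0_integralZl//; last 3 first.
- exact: measurable_expN.
- by move=> w _; exact: expN_ge0.
- exact: expN_ge0.
rewrite -/Ig (@expND _ Ig base_rate) ?base_rate_ge0//; congr (_ * _).
have -> : expN base_rate = (\int[P]_w expN (G w) * expeR base_rate) * expN base_rate.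
  by rewrite EG mul1e.
rewrite -muleA -(fineK bfin) /expN /= -EFinM -expRD subrr expR0 mule1 //.
Qed.

End volterra_laplace.

Lemma integral_mrestr d (X : measurableType d) (R : realType)
    (mu : {measure set X -> \bar R}) (D : set X) (mD : measurable D) (f : X -> \bar R) :
  measurable_fun setT f -> (forall x, 0 <= f x) ->
  \int[mrestr mu mD]_x f x = \int[mu]_(x in D) f x.
Proof.
move=> mf f0.
rewrite (@ge0_negligible_integral _ _ _ (mrestr mu mD) setT (~` D))//; last 2 first.
- exact: measurableC.
- by rewrite /= /mrestr setICl measure0.
rewrite setTD setCK; apply: eq_measure_integral => B mB BD.
by rewrite /= /mrestr setIidl.
Qed.

Section restriction.
Context (R : realType) (d d' : measure_display).
Context (Omega : measurableType d) (X : measurableType d').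
Context (P : probability Omega R) (N : R.-ker Omega ~> X).
Context (nu : {measure set X -> \bar R}) (D D' : set X).
Hypothesis mD' : measurable D'.
Hypothesis D'D : D' `<=` D.
Hypothesis hN : poisson_random_measure P D nu N.
Context (D_ : (set X)^nat) (mD_ : forall n, measurable (D_ n)).
Hypothesis tD_ : trivIset setT D_.
Hypothesis D_D' : \bigcup_n D_ n = D'.
Hypothesis D_fin : forall n, nu (D_ n) < +oo.

Local Notation N' := (sfinite_version N mD_).

Lemma poisson_restriction : poisson_random_measure P D' nu N.
Proof.
have [h1 h2 h3] := hN; split.
- by move=> B mB BD; apply: h1 => //; exact: subset_trans D'D.
- by move=> B mB BD; apply: h2 => //; exact: subset_trans D'D.
- by move=> n B mB BD; apply: h3 => // i; exact: subset_trans D'D.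
Qed.

Lemma ae_sfinite_version :
  {ae P, forall w, forall B, measurable B -> N' w B = N w (B `&` D')}.
Proof.
have fin n : {ae P, forall w, N w (D_ n) < +oo}.
  have sD : D_ n `<=` D' by rewrite -D_D'; exact: bigcup_sup.
  have [h1 _ _] := poisson_restriction.
  have [h _] := @expN_poisson _ _ _ P (fun w => N w (D_ n)) (measurable_kernel N _ (mD_ n))
    (fine (nu (D_ n))) 0 (fine_ge0 (measure_ge0 _ _)) (lexx _) (h1 _ (mD_ n) sD (D_fin n))
    (fun w => measure_ge0 _ _).
  by apply: filterS h => w [k ->]; rewrite ltry.
have := ae_foralln fin; apply: filterS => w hw B mB.
by rewrite sfinite_versionE// D_D'.
Qed.

Lemma sfinite_version_laplace : poisson_laplace P N' (mrestr nu mD').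
Proof.
move=> f mf f0.
have E1 : \int[P]_w expN (\int[N' w]_x (f x)%:E) =
    \int[P]_w expN (\int[N w]_(x in D') (f x)%:E).
  apply: ae_eq_ge0_integral.
  - apply: measurable_expN; apply: measurable_fun_integral_kernel.
    + by move=> U mU; exact: measurable_kernel.
    + by move=> x; rewrite lee_fin.
    + exact/measurable_EFinP.
  - apply: measurable_expN.
    rewrite (_ : (fun w => _) = (fun w => \int[N w]_x ((fun x => (f x)%:E) \_ D') x)).
      apply: measurable_fun_integral_kernel.
      + by move=> U mU; exact: measurable_kernel.
      + by move=> x; rewrite erestrict_ge0// => y _; rewrite lee_fin.
      + by apply/(measurable_restrictT _ _).1 => //; apply/measurable_EFinP; exact: measurable_funTS.
    by apply/funext => w; rewrite integral_mkcond.
  - by move=> w; exact: expN_ge0.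
  - by move=> w; exact: expN_ge0.
  apply: filterS ae_sfinite_version => w hw; congr expN.
  transitivity (\int[mrestr (N w) mD']_x (f x)%:E).
    by apply: eq_measure_integral => B mB _; exact: hw.
  by rewrite integral_mrestr//; exact/measurable_EFinP.
rewrite E1 (laplace_functional mD' poisson_restriction mf f0); congr expN.
rewrite integral_mrestr//.
- by apply/measurable_EFinP; apply: measurable_funB => //; apply: measurableT_comp => //;
    exact: measurableT_comp.
- by move=> x; rewrite lee_fin subr_ge0 -[leRHS]expR0 ler_expR oppr_le0.
Qed.

Lemma sfinite_version_integer : integer_valued P N'.
Proof.
move=> B mB; have mBD : measurable (B `&` D') by exact: measurableI.
have sBD : B `&` D' `<=` D' by exact: subIsetr.
have := poisson_count_nat poisson_restriction mBD sBD.
by apply: filterS2 ae_sfinite_version => w hw; rewrite hw.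
Qed.

End restriction.

Section sigma_finite_product.
Context (R : realType) (d1 d2 : measure_display).
Context (X1 : measurableType d1) (X2 : measurableType d2).
Context (m1 : {sigma_finite_measure set X1 -> \bar R}).
Context (m2 : {sigma_finite_measure set X2 -> \bar R}).

Let product_sigma_finite : sigma_finite setT (m1 \x m2).
Proof.
have /sigma_finiteP[A [TA ndA finA]] := sigma_finiteT m1.
have /sigma_finiteP[B [TB ndB finB]] := sigma_finiteT m2.
exists (fun n => A n `*` B n) => [|n].
  apply/seteqP; split => // -[x y] _.
  have [i _ Ax] : (\bigcup_i A i) x by rewrite -TA.
  have [j _ By] : (\bigcup_j B j) y by rewrite -TB.
  exists (maxn i j) => //; split => /=.
    by move: x Ax; exact/subsetPset/ndA/leq_maxl.
  by move: y By; exact/subsetPset/ndB/leq_maxr.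
have [mA Afin] := finA n; have [mB Bfin] := finB n; split; first exact: measurableX.
by rewrite product_measure1E// lte_mul_pinfty// ge0_fin_numE.
Qed.

Definition sigma_finite_product : {sigma_finite_measure set (X1 * X2)%type -> \bar R} :=
  HB.pack (m1 \x m2) (Measure_isSigmaFinite.Build _ _ _ (m1 \x m2) product_sigma_finite).

End sigma_finite_product.

Section fourfold_product.
Context (R : realType) (d0 d1 d2 d3 d4 : measure_display).
Context (Omega : measurableType d0).
Context (X1 : measurableType d1) (X2 : measurableType d2).
Context (X3 : measurableType d3) (X4 : measurableType d4).
Context (m1 : {sigma_finite_measure set X1 -> \bar R}).
Context (m2 : {sigma_finite_measure set X2 -> \bar R}).
Context (m3 : {sigma_finite_measure set X3 -> \bar R}).
Context (m4 : {sigma_finite_measure set X4 -> \bar R}).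
Local Notation product := (m1 \x (m2 \x (m3 \x m4))).

Lemma integral_fourfold_product (h : X1 * (X2 * (X3 * X4)) -> \bar R) :
  measurable_fun setT h -> (forall x, 0 <= h x) ->
  \int[product]_x h x =
  \int[m1 \x m2]_p \int[m3]_z \int[m4]_u h (p.1, (p.2, (z, u))).
Proof.
move=> mh h0.
have mp : measurable_fun setT (fun p : (X1 * X2) * (X3 * X4) => h (p.1.1, (p.1.2, p.2))).
  apply: measurableT_comp => //; apply: measurable_fun_pair.
    exact: measurableT_comp.
  by apply: measurable_fun_pair => //; exact: measurableT_comp.
have E34 (x : X1) (y : X2) : \int[m3]_z \int[m4]_u h (x, (y, (z, u))) =
    \int[m3 \x m4]_q h (x, (y, q)).
  rewrite (integral_product_iterated m3 m4 (h := fun q => h (x, (y, q))))//.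
  exact: (measurableT_comp mp (measurable_pair1 (x, y))).
transitivity (\int[m1]_x \int[m2]_y \int[m3]_z \int[m4]_u h (x, (y, (z, u)))).
  have -> := integral_product_iterated m1 (sigma_finite_product m2 (sigma_finite_product m3 m4)) mh h0.
  apply: eq_integral => x _.
  have mhx : measurable_fun setT (fun q => h (x, q)).
    exact: (measurableT_comp mh (measurable_pair1 x)).
  have -> := integral_product_iterated m2 (sigma_finite_product m3 m4) mhx (fun q => h0 (x, q)).
  by apply: eq_integral => y _; rewrite E34.
rewrite [RHS](integral_product_iterated m1 m2 (h := fun p => \int[m3]_z \int[m4]_u h (p.1, (p.2, (z, u)))))//.
  rewrite (_ : (fun p => _) = (fun p : X1 * X2 => \int[m3 \x m4]_q h (p.1, (p.2, q)))).
    exact: (measurable_integral_product m3 m4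
      (h := fun p : (X1 * X2) * (X3 * X4) => h (p.1.1, (p.1.2, p.2)))).
  by apply/funext => p; rewrite E34.
by move=> p; apply: integral_ge0 => z _; exact: integral_ge0.
Qed.

Lemma measurable_integral_fourfold_product
    (h : Omega * (X1 * (X2 * (X3 * X4))) -> \bar R) :
  measurable_fun setT h -> (forall x, 0 <= h x) ->
  measurable_fun setT (fun w => \int[product]_x h (w, x)).
Proof.
move=> mh h0.
exact: (@measurable_fun_fubini_tonelli_F _ _ _ _ R
  (sigma_finite_product m1 (sigma_finite_product m2 (sigma_finite_product m3 m4))) h).
Qed.

End fourfold_product.

Section sigma_finite_copy.
Context d (X : measurableType d) (R : realType) (mu : {measure set X -> \bar R}).
Hypothesis mu_sigma_finite : sigma_finite setT mu.

Definition sigma_finite_copy (_ : sigma_finite setT mu) : set X -> \bar R := mu.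

HB.instance Definition _ := Measure.on (sigma_finite_copy mu_sigma_finite).

HB.instance Definition _ := Measure_isSigmaFinite.Build _ _ _
  (sigma_finite_copy mu_sigma_finite) mu_sigma_finite.

End sigma_finite_copy.

Section poisson_model.
Context (R : realType) (E : ptopologicalType) (d : measure_display).
Context (Omega : measurableType d).
Local Notation mu := (@lebesgue_measure R).
Local Notation marks := (borel E * (R * R))%type.
Local Notation atoms := (R * (borel E * (R * R)))%type.
Local Notation copied_atoms :=
  (measurableTypeR R * (borel E * (R * measurableTypeR R)))%type.
Context (P : probability Omega R) (T : R).
Context (m : {finite_measure set (borel E) -> \bar R}) (l : {measure set R -> \bar R}).
Context (N : R.-ker Omega ~> atoms).
Hypothesis T0 : (0 < T)%R.
Hypothesis hP : measure_is_complete P.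
Hypothesis hl : l [set z | (z <= 0)%R] = 0.
Hypothesis hz : \int[l]_(z in `]0%R, +oo[) z%:E < +oo.
Hypothesis hN : poisson_random_measure P (@atom_space R E T) (intensity m l) N.

Definition positive_atoms : set atoms := [set` `]0%R, T]] `*` @mark_space R E.

Lemma measurable_mark_space : measurable (@mark_space R E).
Proof. by apply: measurableX => //; exact: measurableX. Qed.

Lemma measurable_positive_atoms : measurable positive_atoms.
Proof. by apply: measurableX => //; exact: measurable_mark_space. Qed.

Let measurable_le (c : R) : measurable [set z : R | (z <= c)%R].
Proof.
rewrite (_ : [set z | _] = [set` `]-oo, c]]); first exact: measurable_itv.
by apply/seteqP; split => z /=; rewrite in_itv.
Qed.

Let measurable_ge (c : R) : measurable [set z : R | (c <= z)%R].
Proof.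
rewrite (_ : [set z | _] = [set` `[c, +oo[]); first exact: measurable_itv.
by apply/seteqP; split => z /=; rewrite in_itv/= andbT.
Qed.

Definition mark_piece (n : nat) : set R := [set z | (z <= 0)%R] `|` [set z | (n.+1%:R^-1 <= z)%R].

Lemma measurable_mark_piece n : measurable (mark_piece n).
Proof.
by apply: measurableU; [exact: measurable_le|exact: measurable_ge].
Qed.

Lemma mark_piece_lty n : l (mark_piece n) < +oo.
Proof.
have mA := measurable_le 0; have mB := measurable_ge n.+1%:R^-1.
apply: (@le_lt_trans _ _ (l [set z : R | (z <= 0)%R] + l [set z : R | (n.+1%:R^-1 <= z)%R])).
  exact: measureU2.
rewrite [X in X + _]hl add0e.
have n0 : (0 < n.+1%:R^-1 :> R)%R by rewrite invr_gt0.
apply: (@le_lt_trans _ _ (n.+1%:R%:E * \int[l]_(z in `]0%R, +oo[) z%:E)); last first.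
  by rewrite lte_mul_pinfty// ?lee_fin//.
rewrite -ge0_integralZl_EFin//; last first.
  by move=> z /=; rewrite in_itv/= andbT lee_fin => /ltW.
have sub : [set z : R | (n.+1%:R^-1 <= z)%R] `<=` [set` `]0%R, +oo[].
  by move=> z /= hz'; rewrite in_itv/= andbT; exact: lt_le_trans hz'.
have IE := integral_indic l (measurable_itv `]0%R : R, +oo[) mB.
rewrite (setIidl sub) in IE; rewrite -IE; apply: ge0_le_integral => //.
- exact/measurable_EFinP/measurable_indic.
- by apply: measurable_funeM; exact/measurable_EFinP.
- move=> z /=; rewrite in_itv/= andbT => z0; rewrite -EFinM lee_fin indicE.
  case: (boolP (z \in _)); last by rewrite mulr_ge0// ltW.
  rewrite inE/= => h; rewrite -[leLHS](@mulfV _ (n.+1%:R : R)) ?pnatr_eq0//.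
  by rewrite ler_pM2l.
Qed.

Lemma mark_piece_cover : \bigcup_n mark_piece n = setT.
Proof.
apply/seteqP; split => // z _; have [z0|z0] := leP z 0%R.
  by exists 0%N => //; left.
exists (Num.truncn z^-1) => //; right => /=.
by rewrite invf_ple ?posrE//; apply/ltW/truncnS_gt.
Qed.

Let l_sigma_finite : sigma_finite setT l.
Proof.
exists mark_piece; first by rewrite mark_piece_cover.
by move=> n; split; [exact: measurable_mark_piece|exact: mark_piece_lty].
Qed.

Let lsf : {sigma_finite_measure set R -> \bar R} := sigma_finite_copy l_sigma_finite.

Let nu0 : {sigma_finite_measure set _ -> \bar R} :=
  sigma_finite_product mu (sigma_finite_product m (sigma_finite_product lsf mu)).

Let piece (n : nat) : set atoms :=
  [set` `]0%R, T]] `*` (setT `*` ((mark_piece n `&` [set` `[0%R, +oo[]) `*` [set` `[0%R, n%:R]])).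

Let mpiece n : measurable (piece n).
Proof.
apply: measurableX => //; apply: measurableX => //; apply: measurableX => //.
by apply: measurableI => //; exact: measurable_mark_piece.
Qed.

Let piece_fin n : nu0 (piece n) < +oo.
Proof.
have E0 : nu0 (piece n) = mu [set` `]0%R, T]] * (m setT *
    (l (mark_piece n `&` [set` `[0%R, +oo[]) * mu [set` `[0%R, n%:R]])).
  have mMn := measurableI _ _ (measurable_mark_piece n) (measurable_itv `[0%R : R, +oo[).
  have h1 := @product_measure1E _ _ _ _ R mu
    (sigma_finite_product m (sigma_finite_product lsf mu)) [set` `]0%R, T]]
    (setT `*` ((mark_piece n `&` [set` `[0%R, +oo[]) `*` [set` `[0%R, n%:R]])).
  have h2 := @product_measure1E _ _ _ _ R m (sigma_finite_product lsf mu) setT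
    ((mark_piece n `&` [set` `[0%R, +oo[]) `*` [set` `[0%R, n%:R]]).
  have h3 := @product_measure1E _ _ _ _ R lsf mu (mark_piece n `&` [set` `[0%R, +oo[])
    [set` `[0%R, n%:R]].
  have mM3 : measurable ((mark_piece n `&` [set` `[0%R, +oo[]) `*` [set` `[0%R, n%:R : R]]).
    exact: measurableX.
  have mM2 : measurable ([set: borel E] `*`
      ((mark_piece n `&` [set` `[0%R, +oo[]) `*` [set` `[0%R, n%:R : R]])).
    exact: measurableX.
  apply: etrans (h1 _ mM2) _; first exact: measurable_itv.
  congr (_ * _); apply: etrans (h2 _ mM3) _; first exact: measurableT.
  congr (_ * _); apply: h3 => //; exact: measurable_itv.
rewrite E0 !lebesgue_measure_itv/=.
have fin (a b : R) : (if a%:E < b%:E then b%:E - a%:E else 0) < +oo.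
  by case: ifPn => //; rewrite -EFinB ltry.
have pos (a b : R) : 0 <= (if a%:E < b%:E then b%:E - a%:E else 0).
  by case: ifPn => //; rewrite lte_fin -EFinB lee_fin subr_ge0 => /ltW.
have lfin : l (mark_piece n `&` [set` `[0%R, +oo[]) < +oo.
  apply: le_lt_trans (mark_piece_lty n); apply: le_measure; rewrite ?inE//.
  - by apply: measurableI => //; exact: measurable_mark_piece.
  - exact: measurable_mark_piece.
apply: lte_mul_pinfty => //; first by rewrite ge0_fin_numE.
apply: lte_mul_pinfty => //; first by rewrite fin_num_measure.
by apply: lte_mul_pinfty => //; rewrite ge0_fin_numE.
Qed.

Let D_ := seqDU (fun n => piece n).

Let mD_ n : measurable (D_ n).
Proof. exact: seqDU_measurable. Qed.

Let D_cover : \bigcup_n D_ n = positive_atoms.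
Proof.
rewrite /D_ -seqDU_bigcup_eq; apply/seteqP; split => [[s [y [z u]]]|[s [y [z u]]]].
  by move=> [n _ [/= ? [_ [[_ /= ?] /= u0]]]]; do !split => //=;
    move: u0; rewrite !in_itv /= => /andP[->].
rewrite /positive_atoms /mark_space /= => -[sT [_ [/= z0 u0]]].
have [i _ zi] : (\bigcup_n mark_piece n) z by rewrite mark_piece_cover.
exists (maxn i (Num.truncn u).+1) => //; split => //=; split => //; split => //=.
  split => //; case: zi => /= zi; [by left|right => /=].
  apply: le_trans zi; rewrite lef_pV2 ?posrE// ler_nat ltnS; exact: leq_maxl.
move: u0; rewrite !in_itv/= andbT => -> /=.
apply: le_trans (ltW (truncnS_gt _)) _; rewrite ler_nat; exact: leq_maxr.
Qed.

Let mpos := measurable_positive_atoms.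

(* [lebesgue_measure] is a measure on a copy of [R] with another display, hence
   this transport along the identity. *)
Let id_atoms : measurable_fun setT (id : copied_atoms -> atoms).
Proof. by move=> _ B mB; rewrite setTI; exact: mB. Qed.

Let nu1 : {measure set atoms -> \bar R} :=
  measure_function_pushforward__canonical__measure_function_Measure nu0 id_atoms.

Let integral_nu1 (h : atoms -> \bar R) : measurable_fun setT h -> (forall x, 0 <= h x) ->
  \int[nu1]_x h x = \int[nu0]_x h x.
Proof. by move=> mh h0; rewrite (ge0_integral_pushforward id_atoms nu0 measurableT). Qed.

Let nu : {measure set atoms -> \bar R} := mrestr nu1 mpos.

Let N' := sfinite_version N mD_.

Let sub_atoms : positive_atoms `<=` @atom_space R E T.
Proof.
move=> x [/= xT hx]; split => //=.
by move: xT; rewrite !in_itv /= => /andP[/ltW -> ->].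
Qed.

Let D_fin n : nu1 (D_ n) < +oo.
Proof.
apply: (@le_lt_trans _ _ (nu1 (piece n))); last exact: piece_fin.
by apply: le_measure; rewrite ?inE//; exact: subset_seqDU.
Qed.

Let tD_ : trivIset setT D_.
Proof. exact: trivIset_seqDU. Qed.

Let hN1 : poisson_random_measure P (@atom_space R E T) nu1 N.
Proof. exact: hN. Qed.

Lemma sigma_finite_model : exists (l' : {sigma_finite_measure set R -> \bar R})
    (N' : R.-sfker Omega ~> atoms) (nu : {measure set atoms -> \bar R}),
  [/\ (l' : set R -> \bar R) = l,
      {ae P, forall w, forall B, measurable B -> N' w B = N w (B `&` positive_atoms)},
      poisson_laplace P N' nu /\ integer_valued P N',
      forall h : atoms -> \bar R, measurable_fun setT h -> (forall x, 0 <= h x) ->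
        (forall x, ~ [/\ (0 < x.1 <= T)%R, (0 <= x.2.2.1)%R & (0 <= x.2.2.2)%R] -> h x = 0) ->
        \int[nu]_x h x = \int[mu \x m]_p \int[l']_z \int[mu]_u h (p.1, (p.2, (z, u))) &
      forall h : Omega * atoms -> \bar R, measurable_fun setT h -> (forall p, 0 <= h p) ->
        measurable_fun setT (fun w => \int[nu]_x h (w, x))].
Proof.
exists lsf, N', nu; split.
- by [].
- exact: (ae_sfinite_version sub_atoms hN1 mD_ tD_ D_cover D_fin).
- split.
    exact: (sfinite_version_laplace mpos sub_atoms hN1 mD_ tD_ D_cover D_fin).
  exact: (sfinite_version_integer mpos sub_atoms hN1 mD_ tD_ D_cover D_fin).
- move=> h mh h0 hout; rewrite [LHS]integral_mrestr// integral_mkcond.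
  rewrite (_ : h \_ positive_atoms = h); last first.
    apply/funext => x; rewrite patchE; case: ifPn => //; rewrite notin_setE => nx.
    rewrite hout// => -[x1 x2 x3]; apply: nx; rewrite /positive_atoms /mark_space.
    by do !split => //=; rewrite in_itv/= ?andbT.
  rewrite integral_nu1//; exact: (integral_fourfold_product mu m lsf mu mh h0).
- move=> h mh h0.
  pose h' p := h p * (\1_positive_atoms p.2)%:E.
  have mh' : measurable_fun setT h'.
    apply: emeasurable_funM => //; apply/measurable_EFinP.
    by apply: measurableT_comp => //; exact: measurable_indic.
  have h'0 p : 0 <= h' p by rewrite mule_ge0// lee_fin.
  rewrite (_ : (fun w => _) = fun w => \int[nu0]_x h' (w, x)).
    exact: (measurable_integral_fourfold_product mu m lsf mu mh' h'0).
  apply/funext => w; rewrite [LHS]integral_mrestr//; last first.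
    exact: (measurableT_comp mh (measurable_pair1 w)).
  rewrite integral_mkcond -integral_nu1//; last first.
    exact: (measurableT_comp mh' (measurable_pair1 w)).
  apply: eq_integral => x _.
  by rewrite /h' /= patchE indicE; case: ifP => _; rewrite ?mule1 ?mule0.
Qed.

Lemma raw_filtration_le (s t : R) : (s <= t)%R ->
  raw_filtration P N s `<=` raw_filtration P N t.
Proof.
move=> st; apply: smallest_sub; first exact: smallest_sigma_algebra.
move=> A GA; apply: sub_sigma_algebra; move: GA => [|nA]; last by right.
move=> [r [B [C [/andP[r0 rs] mB BM mC ->]]]]; left.
by exists r, B, C; split => //; rewrite r0 (le_trans rs).
Qed.

Lemma raw_filtration_indep (M : R.-sfker Omega ~> atoms)
    (nu' : {measure set atoms -> \bar R}) :
  {ae P, forall w, forall B, measurable B -> M w B = N w (B `&` positive_atoms)} ->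
  poisson_laplace P M nu' -> integer_valued P M ->
  forall s : R, (0 <= s <= T)%R ->
  raw_filtration P N s `<=`
    indep_future P M [set x : atoms | (x.1 <= s)%R] [set x : atoms | (s < x.1)%R].
Proof.
move=> hM hL hZ s /andP[s0 sT].
apply: (indep_future_sigma hL hZ).
  by apply/seteqP; split => // x [/= xs sx]; rewrite ltNge xs in sx.
move=> A [|nA]; last first.
  split; first exact: hP.
  exists set0, set0; split => //.
  have [B [mB B0 AB]] := nA; exists B; split => // w /= h.
  by apply: AB; apply: contrapT => Aw; apply: h; split.
move=> [r [B [C [/andP[r0 rs] mB BM mC ->]]]]; split.
  have := measurable_kernel N (`]0%R, r] `*` B) _ measurableT C mC.
  by rewrite setTI; apply; exact: measurableX.
exists (`]0%R, r] `*` B), C; split => //.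
- exact: measurableX.
- by move=> x [/=]; rewrite in_itv/= => /andP[_ xr] _; exact: le_trans rs.
apply: filterS hM => w -> /=; last exact: measurableX.
rewrite setIidl// => x [/=]; rewrite in_itv/= => /andP[x0 xr] Bx; split => //=.
  by rewrite in_itv/= x0 (le_trans xr)// (le_trans rs).
exact: BM.
Qed.

End poisson_model.

Section predictability.
Context (R : realType) (E : ptopologicalType) (d : measure_display).
Context (Omega : measurableType d).
Local Notation mu := (@lebesgue_measure R).
Local Notation marks := (borel E * (R * R))%type.
Local Notation atoms := (R * (borel E * (R * R)))%type.
Context (P : probability Omega R) (N : R.-ker Omega ~> atoms) (T : R).
Context (V : Omega -> R -> borel E -> \bar R).
Local Notation F := (raw_filtration P N).
Hypothesis T0 : (0 < T)%R.
Hypothesis hV : predictable P N T V.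

Lemma raw_filtration_sigma s : sigma_algebra setT (F s).
Proof. exact: smallest_sigma_algebra. Qed.

Lemma filtration_raw (s q : R) : (s < q)%R -> (q <= T)%R ->
  filtration P N T s `<=` F q.
Proof.
move=> sq qT A; rewrite /filtration (lt_le_trans sq qT) => h.
by apply: h => /=; rewrite in_itv/= sq.
Qed.

Section preimage.
Context (dZ : measure_display) (Z : measurableType dZ).
Context (pr : Z -> Omega * R * borel E) (D : set Z).
Hypothesis mD : measurable D.
Hypothesis DT : forall z, D z -> (0 < (pr z).1.2 <= T)%R.
Hypothesis mrect : forall A (B : set (borel E)) (s t : R), (0 <= s)%R -> (s < t)%R ->
  (t <= T)%R -> filtration P N T s A -> measurable B ->
  measurable (D `&` pr @^-1` (A `*` [set` `]s, t]] `*` B)).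

Lemma measurable_predictable_preimage C : predictable_algebra P N T C ->
  measurable (D `&` pr @^-1` C).
Proof.
apply: (smallest_sub (C := sigma_algebra _)
  (X := [set C | measurable (D `&` pr @^-1` C)])).
  split => /=.
  - by rewrite preimage_set0 setI0.
  - move=> A mA; rewrite (_ : _ `&` _ = D `\` (D `&` pr @^-1` A)); first exact: measurableD.
    apply/seteqP; split => z /=.
      by move=> [Dz [_ nA]]; split => // -[].
    move=> [Dz nA]; split => //; split; last by move=> Az; apply: nA.
    split => //; split => //=; rewrite in_itv/=.
    by have /andP[/ltW -> ->] := DT Dz.
  - by move=> A mA; rewrite preimage_bigcup setI_bigcupr; exact: bigcupT_measurable.
move=> A [[A0 [B [_ _ ->]]]|[A0 [B [s [t [s0 st tT [hA mB ->]]]]]]] /=.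
  rewrite (_ : _ `&` _ = set0)//; apply/seteqP; split => // z /= [/DT + [[_ z0] _]].
  by rewrite z0 ltxx.
exact: mrect.
Qed.

Lemma measurable_predictable_extension :
  measurable_fun setT (fun z => if z \in D then V (pr z).1.1 (pr z).1.2 (pr z).2 else 0).
Proof.
move=> _ C mC; rewrite setTI.
rewrite (_ : _ @^-1` C = (D `&` pr @^-1` [set p | (0 <= p.1.2 <= T)%R /\ C (V p.1.1 p.1.2 p.2)])
    `|` (~` D `&` [set z | C 0])).
  apply: measurableU; first by apply: measurable_predictable_preimage; exact: hV.
  apply: measurableI; first exact: measurableC.
  have [C0|C0] := pselect (C 0).
    by rewrite (_ : [set z | _] = setT)//; apply/seteqP; split.
  by rewrite (_ : [set z | _] = set0)//; apply/seteqP; split.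
apply/seteqP; split => z /=.
  case: ifPn => [|]; rewrite ?inE ?notin_setE => Dz CV; last by right.
  by left; split => //; split => //; have /andP[/ltW -> ->] := DT Dz.
move=> [[Dz [_ CV]]|[Dz C0]]; first by rewrite mem_set.
by rewrite memNset.
Qed.

End preimage.

Let measurable_fst_itv (a b : R) d1 (O : measurableType d1) (A : set O) d2 (W : measurableType d2)
  (B : set W) : measurable A -> measurable B ->
  measurable (A `*` ([set` `]a, b]] `*` B)).
Proof. by move=> mA mB; apply: measurableX => //; exact: measurableX. Qed.

Lemma progressively_measurable (q : R) d' (O : measurableType d') (i : O -> Omega) :
  (0 < q <= T)%R -> (forall A, F q A -> measurable (i @^-1` A)) ->
  measurable_fun setT (fun p : O * (R * borel E) =>
    if (0 < p.2.1 <= q)%R then V (i p.1) p.2.1 p.2.2 else 0).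
Proof.
move=> /andP[q0 qT] hi.
pose D : set (O * (R * borel E)) := setT `*` ([set` `]0%R, q]] `*` setT).
have DE p : (p \in D) = (0 < p.2.1 <= q)%R.
  apply/idP/idP; rewrite inE; first by move=> [_ [/= + _]]; rewrite in_itv.
  by move=> h; split => //; split => //=; rewrite in_itv.
rewrite (_ : (fun p => _) = (fun p => if p \in D then V (i p.1) p.2.1 p.2.2 else 0)); last first.
  by apply/funext => p; rewrite DE.
apply: (measurable_predictable_extension (pr := fun p => (i p.1, p.2.1, p.2.2)) (D := D)).
- exact: measurable_fst_itv.
- by move=> p /mem_set; rewrite DE/= => /andP[-> /le_trans ->].
- move=> A B s t s0 st tT FA mB.
  have [sq|qs] := ltP s q; last first.
    rewrite (_ : _ `&` _ = set0)//; apply/seteqP; split => // p.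
    move=> [/mem_set + [[_ /=]]]; rewrite DE in_itv/= => /andP[_ pq] /andP[sp _] _.
    by have := lt_le_trans sp (le_trans pq qs); rewrite ltxx.
  rewrite (_ : _ `&` _ = (i @^-1` A) `*` (([set` `]0%R, q]] `&` [set` `]s, t]]) `*` B)).
    apply: measurableX; first by apply: hi; exact: filtration_raw FA.
    by apply: measurableX => //; exact: measurableI.
  apply/seteqP; split => p /=.
    by move=> [[_ [/= pq _]] [[/= Ap ps] Bp]].
  by move=> [/= Ap [[/= pq ps] Bp]].
Qed.

Local Notation rectangles := (@time_rectangles R d _ Omega marks T F).
Local Notation history := (g_sigma_algebraType rectangles).

Let D0 : set (Omega * atoms) := setT `*` ([set` `]0%R, T]] `*` setT).

Let D0E p : (p \in D0) = (0 < p.2.1 <= T)%R.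
Proof.
apply/idP/idP; rewrite inE; first by move=> [_ [/= + _]]; rewrite in_itv.
by move=> h; split => //; split => //=; rewrite in_itv.
Qed.

Let rectangle_history (A : set Omega) (a b : R) (B : set marks) : (0 <= a)%R -> (b <= T)%R ->
  F a A -> measurable B -> <<s rectangles >> (A `*` ([set` `]a, b]] `*` B)).
Proof.
move=> a0 bT FA mB; have [ab|ba] := ltP a b; last first.
  have [h0 _ _] := @smallest_sigma_algebra _ setT rectangles.
  rewrite (_ : _ `*` _ = set0)//.
  apply/seteqP; split => // p [_ [/=]]; rewrite in_itv/= => /andP[ap pb].
  by have := lt_le_trans ap (le_trans pb ba); rewrite ltxx.
by apply: sub_sigma_algebra; exists A, a, b, B.
Qed.

Lemma measurable_history_value : measurable_fun setT
  ((fun p : Omega * atoms => if p \in D0 then V p.1 p.2.1 p.2.2.1 else 0) : history -> \bar R).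
Proof.
apply: (@measurable_predictable_extension _ history
  (fun p : Omega * atoms => (p.1, p.2.1, p.2.2.1)) D0).
- apply: rectangle_history => //.
  exact: (sigma_algebra_setT (raw_filtration_sigma 0)).
- by move=> p /mem_set; rewrite D0E.
- move=> A B s t s0 st tT FA mB.
  rewrite (_ : _ `&` _ = \bigcup_n ((if (s + n.+1%:R^-1 < t)%R then A else set0) `*`
      ([set` `](s + n.+1%:R^-1)%R, t]] `*` (B `*` setT)))).
    apply: bigcupT_measurable => n; case: ifPn => ns; last first.
      by rewrite set0X; exact: measurable0.
    apply: rectangle_history => //.
    - by rewrite addr_ge0.
    - by apply: filtration_raw FA; rewrite ?ltrDl ?invr_gt0// (le_trans (ltW ns)).
    - exact: measurableX.
  apply/seteqP; split => p /=.
    move=> [_ [[/= Ap]]]; rewrite in_itv/= => /andP[sp pt] Bp.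
    have sp' : (0 < p.2.1 - s)%R by rewrite subr_gt0.
    pose n := Num.truncn (p.2.1 - s)^-1.
    have ns : (s + n.+1%:R^-1 < p.2.1)%R.
      by rewrite -ltrBrDl invf_plt ?posrE// truncnS_gt.
    exists n => //; rewrite (lt_le_trans ns pt); split => //; split => //=.
    by rewrite in_itv/= ns.
  move=> [n _]; case: ifPn => ns -[//= Ap]; rewrite in_itv/= => -[/andP[sp pt] [Bp _]].
  have sp' : (s < p.2.1)%R by apply: lt_trans sp; rewrite ltrDl invr_gt0.
  split; last by split => //; split => //=; rewrite in_itv/= sp'.
  apply/set_mem; rewrite D0E (le_trans pt tT) andbT.
  exact: le_lt_trans sp'.
Qed.

Context (m : {finite_measure set (borel E) -> \bar R}).
Context (l : {sigma_finite_measure set R -> \bar R}) (lambda0 lambda1 : R).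
Context (psi : R * borel E -> R).
Hypothesis hV0 : forall w (t : R) x, (0 <= t <= T)%R -> 0 <= V w t x.
Hypothesis hF : forall A, F T A -> measurable A.
Hypothesis lambda0_ge0 : (0 <= lambda0)%R.
Hypothesis lambda1_ge0 : (0 <= lambda1)%R.
Hypothesis mpsi : measurable_fun setT psi.
Hypothesis psi0 : forall p, (0 <= psi p)%R.
Hypothesis psiT : forall p : R * borel E, ~ (0 < p.1 <= T)%R -> psi p = 0%R.

Definition stopped_field (q : R) (p : Omega * (R * borel E)) : \bar R :=
  if (0 < p.2.1 <= q)%R then V p.1 p.2.1 p.2.2 else 0.

Lemma stopped_field_ge0 q p : (q <= T)%R -> 0 <= stopped_field q p.
Proof.
move=> qT; rewrite /stopped_field; case: ifP => // /andP[/ltW s0 sq].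
by apply: hV0; rewrite s0 (le_trans sq).
Qed.

Lemma measurable_stopped_field : measurable_fun setT (stopped_field T).
Proof.
apply: (progressively_measurable (i := id)); first by rewrite T0 lexx.
exact: hF.
Qed.

Local Notation rate := (cumulated_rate m l lambda0 lambda1 psi (stopped_field T)).

Let rate_integrand_ge0 w p :
  0 <= jump_rate lambda0 lambda1 (stopped_field T) (w, p) * mean_effect l psi p.
Proof.
by rewrite mule_ge0 ?mean_effect_ge0// adde_ge0 ?mule_ge0 ?stopped_field_ge0 ?lee_fin.
Qed.

Let measurable_rate_integrand w : measurable_fun setT
  (fun p => jump_rate lambda0 lambda1 (stopped_field T) (w, p) * mean_effect l psi p).
Proof.
apply: emeasurable_funM; last exact: measurable_mean_effect.
apply: emeasurable_funD => //; apply: measurable_funeM.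
exact: (measurableT_comp measurable_stopped_field (measurable_pair1 w)).
Qed.

Lemma cumulated_rate_adapted (q : R) (c : \bar R) : (0 < q <= T)%R ->
  F q [set w | c < rate w q].
Proof.
move=> qq; have /andP[q0 qT] := qq.
pose O := g_sigma_algebraType (F q).
have sF : <<s F q >> = F q by apply: sigma_algebra_id; exact: raw_filtration_sigma.
pose h (p : O * (R * borel E)) : \bar R := (p.2.1 <= q)%R%:R%:E *
  ((lambda0%:E + lambda1%:E * stopped_field q p) * mean_effect l psi p.2).
have mVq : measurable_fun setT (stopped_field q : O * (R * borel E) -> \bar R).
  apply: (@progressively_measurable q _ O id) => // A FA.
  by rewrite preimage_id /measurable/= /g_sigma_algebraType; rewrite /= sF.
have mh : measurable_fun setT h.
  apply: emeasurable_funM.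
    apply/measurable_EFinP; apply: measurable_bool_natr.
    by apply: measurable_fun_ler => //; exact: measurableT_comp.
  apply: emeasurable_funM.
    by apply: emeasurable_funD => //; exact: measurable_funeM.
  by apply: measurableT_comp => //; exact: measurable_mean_effect.
have h0 p : 0 <= h p.
  rewrite mule_ge0 ?mule_ge0 ?mean_effect_ge0 ?lee_fin//.
  by rewrite adde_ge0 ?mule_ge0 ?stopped_field_ge0 ?lee_fin.
have rateE w : rate w q = \int[mu \x m]_p h (w, p).
  apply: eq_integral => p _; rewrite /h /jump_rate /=.
  have [pq|pq] := leP p.1 q; last by rewrite !mul0e.
  have [p0|p0] := ltP 0%R p.1.
    by rewrite /stopped_field /= p0 pq (le_trans pq qT).
  by rewrite (mean_effectT l psiT) ?mule0// ltNge p0.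
have mr : measurable_fun setT ((fun w => rate w q) : O -> \bar R).
  rewrite (_ : (fun w => _) = fun w => \int[mu \x m]_p h (w, p)); last exact/funext.
  by have := @measurable_integral_product R _ _ _ O _ (borel E) mu m h mh h0.
have H := emeasurable_fun_o_infty measurableT mr c; rewrite setTI in H.
by rewrite -sF; exact: H.
Qed.

(* Left continuity, by monotone convergence: the level set of a time has measure 0. *)
Lemma cumulated_rate_gt (c : R) w (s : R) : (0 <= c)%R -> c%:E < rate w s ->
  exists q : rat, [/\ (0 < ratr q :> R)%R, (ratr q < s)%R & c%:E < rate w (ratr q)].
Proof.
move=> c0 cs.
pose f p := jump_rate lambda0 lambda1 (stopped_field T) (w, p) * mean_effect l psi p.
pose t n : R := (s - n.+1%:R^-1)%R.
pose ind (n : nat) (p : R * borel E) : \bar R := (p.1 <= t n)%R%:R%:E * f p.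
have mle (u : R) : measurable_fun setT (fun p : R * borel E => (p.1 <= u)%R%:R : R).
  by apply: measurable_bool_natr; exact: measurable_fun_ler.
have mlt (u : R) : measurable_fun setT (fun p : R * borel E => (p.1 < u)%R%:R : R).
  by apply: measurable_bool_natr; exact: measurable_fun_ltr.
have mind n : measurable_fun setT (ind n).
  by apply: emeasurable_funM; [exact/measurable_EFinP|exact: measurable_rate_integrand].
have ind0 n p : 0 <= ind n p by rewrite mule_ge0 ?rate_integrand_ge0// lee_fin.
have lim p : ind ^~ p @ \oo --> (p.1 < s)%R%:R%:E * f p.
  apply: cvg_near_cst; have [ps|sp] := ltP p.1 s; last first.
    apply: nearW => n; rewrite /ind /t leNgt (lt_le_trans _ sp) ?mul0e//.
    by rewrite ltrBlDr ltrDl invr_gt0.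
  have ps' : (0 < s - p.1)%R by rewrite subr_gt0.
  exists (Num.truncn (s - p.1)^-1) => // n /= hn.
  rewrite /ind /t (_ : (p.1 <= _)%R)// lerBrDr -lerBrDl.
  rewrite invf_ple ?posrE//; apply: le_trans (ltW (truncnS_gt _)) _.
  by rewrite ler_nat.
have rateE : rate w s = \int[mu \x m]_p limn (ind ^~ p).
  transitivity (\int[mu \x m]_p ((p.1 < s)%R%:R%:E * f p)); last first.
    by apply: eq_integral => p _; apply/esym/cvg_lim => //; exact: lim.
  apply: ae_eq_ge0_integral.
  - by apply: emeasurable_funM; [apply/measurable_EFinP; exact: mle|exact: measurable_rate_integrand].
  - by apply: emeasurable_funM; [apply/measurable_EFinP; exact: mlt|exact: measurable_rate_integrand].
  - by move=> p; rewrite mule_ge0 ?rate_integrand_ge0// lee_fin.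
  - by move=> p; rewrite mule_ge0 ?rate_integrand_ge0// lee_fin.
  exists ([set s] `*` setT); split.
  - exact: measurableX.
  - apply: etrans (@product_measure1E _ _ _ _ R mu m [set s] setT (measurable_set1 s) measurableT) _.
    apply: etrans (congr1 (fun a => a * m setT) (lebesgue_measure_set1 s)) _.
    exact: mul0e.
  - move=> p /= ne; split => //; apply: contrapT => ps; apply: ne.
    by rewrite le_eqVlt (_ : (p.1 == s) = false)//; apply/eqP.
have cvgI : (fun n => rate w (t n)) @ \oo --> rate w s.
  rewrite rateE; apply: cvg_monotone_convergence => //.
  - by move=> n p _; exact: ind0.
  - move=> p _ i j ij; rewrite lee_wpmul2r ?rate_integrand_ge0// lee_fin ler_nat.
    have tij : (t i <= t j)%R.
      by rewrite lerD2l lerN2 lef_pV2 ?posrE// ler_nat.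
    by have [h|//] := leP p.1 (t i); rewrite (le_trans h tij).
have [n cn] : exists n, c%:E < rate w (t n).
  apply: contrapT => /forallNP hn.
  suff : rate w s <= c%:E by rewrite leNgt cs.
  rewrite -(cvg_lim _ cvgI)//; apply: lime_le; first by apply/cvg_ex; exists (rate w s).
  by apply: nearW => n; rewrite leNgt; apply/negP/hn.
have [q] : exists q : rat, ratr q \in `]t n, s[.
  by apply: rat_in_itvoo; rewrite ltrBlDr ltrDl invr_gt0.
rewrite in_itv/= => /andP[tq qs]; exists q; split => //; last first.
  apply: lt_le_trans cn _; apply: cumulated_rate_le => //.
  - exact: measurable_stopped_field.
  - by move=> p; exact: stopped_field_ge0.
  - exact: ltW.
rewrite ltNge; apply/negP => q0; move: cn; rewrite /cumulated_rate integral0_eq ?lte_fin ?ltNge ?c0//.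
move=> p _; have [p0|p0] := ltP 0%R p.1; last by rewrite (mean_effectT l psiT) ?mule0// ltNge p0.
by rewrite leNgt (lt_trans tq) ?mul0e// (le_lt_trans q0).
Qed.

Lemma accepted_history k :
  <<s rectangles >> (accepted T m l lambda0 lambda1 psi (stopped_field T) k).
Proof.
have rle := cumulated_rate_le m l lambda0_ge0 lambda1_ge0 mpsi psi0 measurable_stopped_field
  (fun p => stopped_field_ge0 p (lexx T)).
have mD0 : measurable (D0 : set history).
  by apply: rectangle_history => //; exact: (sigma_algebra_setT (raw_filtration_sigma 0)).
pose v : history -> \bar R := fun p : Omega * atoms => if p \in D0 then V p.1 p.2.1 p.2.2.1 else 0.
have mv : measurable_fun setT v by exact: measurable_history_value.
pose u : history -> \bar R := fun p : Omega * atoms => if p \in D0 then p.2.2.2.2%:E else 0.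
have mu' : measurable_fun setT u.
  move=> _ C mC; rewrite setTI.
  pose B : set marks := setT `*` (setT `*` [set z : R | C z%:E]).
  have mB : measurable B.
    apply: measurableX => //; apply: measurableX => //.
    have me : measurable_fun setT (EFin : R -> \bar R) by exact/measurable_EFinP.
    by have := me measurableT C mC; rewrite setTI.
  rewrite (_ : u @^-1` C = (setT `*` ([set` `]0%R, T]] `*` B)) `|` (~` D0 `&` [set _ | C 0])).
    apply: measurableU.
      by apply: rectangle_history => //; exact: (sigma_algebra_setT (raw_filtration_sigma 0)).
    apply: measurableI; first exact: measurableC.
    have [C0|C0] := pselect (C 0).
      by rewrite (_ : [set z | _] = setT)//; apply/seteqP; split.
    by rewrite (_ : [set z | _] = set0)//; apply/seteqP; split.
  apply/seteqP; split => z /=; rewrite /u.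
    case: ifPn => [|]; rewrite ?inE ?notin_setE => Dz Cz; last by right.
    by left; case: Dz => _ [/= Dz _].
  move=> [[_ [/= zT [_ [_ Cz]]]]|[Dz C0]]; last by rewrite memNset.
  by rewrite mem_set.
have m1 : measurable [set p : history | u p <= lambda0%:E + lambda1%:E * v p].
  have mr : measurable_fun setT (fun p : history => lambda0%:E + lambda1%:E * v p).
    by apply: emeasurable_funD => //; exact: measurable_funeM.
  have := measurable_fun_lee mu' mr.
  by move=> /(_ measurableT [set true] I); rewrite setTI.
pose L (q : rat) : set history := (if (0 < ratr q :> R)%R && (ratr q < T)%R then
  [set w | k%:R%:E < rate w (ratr q)] else set0) `*` ([set` `](ratr q : R), T]] `*` setT).
have mL : measurable (\bigcup_q L q).
  apply: bigcupT_measurable_rat => q; rewrite /L; case: ifPn => [/andP[q0 qT]|_]; last first.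
    by rewrite set0X; exact: measurable0.
  apply: rectangle_history => //; first exact: ltW.
  by apply: cumulated_rate_adapted; rewrite q0 ltW.
have -> : accepted T m l lambda0 lambda1 psi (stopped_field T) k =
    (D0 `&` [set p : history | u p <= lambda0%:E + lambda1%:E * v p]) `&` ~` (\bigcup_q L q).
  apply/seteqP; split => p.
    move=> [pT pu pk]; have Dp : p \in D0 by rewrite D0E.
    have up : u p <= lambda0%:E + lambda1%:E * v p.
      by rewrite /u /v Dp; move: pu; rewrite /jump_rate /stopped_field /= pT.
    split; first by split; [exact: (set_mem Dp)|exact: up].
    move=> [q _ [/=]]; case: ifPn => // /andP[q0 qT] /= kq []; rewrite in_itv/= => /andP[qp _] _.
    have := lt_le_trans kq (rle p.1 _ _ (ltW qp)).
    by rewrite ltNge pk.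
  move=> [[/mem_set Dp /= pu] nL]; have pT := Dp; rewrite D0E in pT.
  split => //.
    by move: pu; rewrite /u /v Dp /jump_rate /stopped_field /= pT.
  rewrite leNgt; apply/negP => kp; apply: nL.
  have [q [q0 qp kq]] := cumulated_rate_gt (ler0n _ _) kp.
  have /andP[p0 pT'] := pT.
  exists q => //; split => /=; first by rewrite q0 (lt_le_trans qp pT').
  by split => //=; rewrite in_itv/= qp.
exact: (measurableI _ _ (measurableI _ _ mD0 m1) (measurableC mL)).
Qed.

End predictability.

Section time_restriction.
Context (R : realType) (E : ptopologicalType) (T : R).
Local Notation mu := (@lebesgue_measure R).

Lemma integral_time_product (m : {finite_measure set (borel E) -> \bar R}) (a b : R)
    (h : R -> borel E -> \bar R) (H : R * borel E -> \bar R) :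
  measurable_fun setT H -> (forall p, 0 <= H p) ->
  (forall p : R * borel E, ~ (a < p.1 <= b)%R -> H p = 0) ->
  (forall s y, (a < s <= b)%R -> h s y = H (s, y)) ->
  \int[mu]_(s in `[a, b]) \int[m]_y h s y = \int[mu \x m]_p H p.
Proof.
move=> mH H0 Hout hH.
have mF : measurable_fun setT (fun s => \int[m]_y H (s, y)).
  exact: (@measurable_fun_fubini_tonelli_F _ _ _ _ R m H).
have hF s : s \in [set` `]a, b]] -> \int[m]_y H (s, y) = \int[m]_y h s y.
  by rewrite inE/= in_itv/= => sab; apply: eq_integral => y _; rewrite hH.
have -> := @integral_product_iterated R _ _ _ (borel E) mu m H mH H0.
rewrite -integral_itv_obnd_cbnd; last first.
  by apply: eq_measurable_fun hF _; exact: measurable_funTS.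
transitivity (\int[mu]_(s in [set` `]a, b]]) \int[m]_y H (s, y)).
  by apply: eq_integral => s /hF.
rewrite integral_mkcond; apply: eq_integral => s _.
rewrite patchE; case: ifPn => //; rewrite notin_setE/= in_itv/= => sab.
by rewrite integral0_eq// => y _; rewrite Hout.
Qed.

Lemma integral_product_combination (m : {finite_measure set (borel E) -> \bar R})
    (c : R) (f h : R * borel E -> \bar R) : (0 <= c)%R ->
  measurable_fun setT f -> measurable_fun setT h -> (forall p, 0 <= f p) -> (forall p, 0 <= h p) ->
  \int[mu \x m]_p f p + c%:E * \int[mu \x m]_p h p = \int[mu \x m]_p (f p + c%:E * h p).
Proof.
move=> c0 mf mh f0 h0; rewrite ge0_integralD//.
- by rewrite ge0_integralZl_EFin.
- by move=> p _; rewrite mule_ge0 ?lee_fin.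
- exact: measurable_funeM.
Qed.

Definition restrict_time (f : R -> borel E -> R) (p : R * borel E) : R :=
  if (0 < p.1 <= T)%R then f p.1 p.2 else 0%R.

Lemma restrict_timeE f p : (0 < p.1 <= T)%R -> restrict_time f p = f p.1 p.2.
Proof. by rewrite /restrict_time => ->. Qed.

Lemma restrict_timeT f p : ~ (0 < p.1 <= T)%R -> restrict_time f p = 0%R.
Proof. by rewrite /restrict_time => /negP/negbTE ->. Qed.

Lemma restrict_time_facts f : bounded_nonneg_borel T f ->
  [/\ measurable_fun setT (restrict_time f), forall p, (0 <= restrict_time f p)%R &
      exists M : R, forall p, (restrict_time f p <= M)%R].
Proof.
move=> [mf f0 [M fM]].
have itv (s : R) : (0 < s <= T)%R -> (0 <= s <= T)%R by move=> /andP[/ltW -> ->].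
split.
- have mD : measurable ([set` `]0%R, T]] `*` [set: borel E]) by exact: measurableX.
  rewrite (_ : restrict_time f = (fun p => f p.1 p.2) \_ (`]0%R, T] `*` setT)).
    apply/(measurable_restrictT _ mD); apply: measurable_funS mf.
      exact: measurableX.
    by move=> p [/=]; rewrite !in_itv/= => /itv.
  apply/funext => p; rewrite patchE /restrict_time; case: ifPn => h.
    by rewrite mem_set//; split => //=; rewrite in_itv.
  by rewrite memNset// => -[/=]; rewrite in_itv/= => h' _; move: h; rewrite h'.
- by move=> p; rewrite /restrict_time; case: ifP => // /itv /f0.
- exists `|M|%R => p; rewrite /restrict_time; case: ifP => // /itv pT.
  by apply: le_trans (fM _ _ pT) (ler_norm _).
Qed.

End time_restriction.

Lemma jump_part_version (R : realType) d (Omega : measurableType d) (E : ptopologicalType)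
    (T lambda0 lambda1 : R)
    (N : R.-ker Omega ~> (R * (borel E * (R * R)))%type)
    (N' : R.-sfker Omega ~> (R * (borel E * (R * R)))%type)
    (K Kt : R -> borel E -> borel E -> R) (V : Omega -> R -> borel E -> \bar R)
    w (t : R) (x : borel E) :
  (forall B, measurable B -> N' w B = N w (B `&` @positive_atoms R E T)) ->
  (0 <= lambda0)%R -> (0 <= lambda1)%R ->
  (forall w (t : R) x, (0 <= t <= T)%R -> 0 <= V w t x) ->
  measurable_fun setT (stopped_field V T) ->
  measurable_fun setT (fun p : R * (borel E * borel E) => Kt p.1 p.2.1 p.2.2) ->
  (forall r x y, (0 <= Kt r x y)%R) ->
  (forall (r : R) x y, (r <= 0)%R -> Kt r x y = 0%R) ->
  (forall (r : R) x y, (0 < r <= T)%R -> Kt r x y = K r x y) ->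
  (0 < t <= T)%R ->
  jump_part N' T lambda0 lambda1 (stopped_field V T) Kt (w, (t, x)) =
  \int[N w]_(p in `]0%R, t[ `*` @mark_space R E)
    (let: (s, (y, (z, u))) := p in
     (K (t - s) x y * z * (u%:E <= lambda0%:E + lambda1%:E * V w s y)%E%:R)%:E).
Proof.
move=> hw l0 l1 V0 mV mKt Kt0 KtN KtE /andP[t0 tT].
pose h (p : R * (borel E * (R * R))) :=
  (Kt (t - p.1) x p.2.1 * thinned_mark T lambda0 lambda1 (stopped_field V T) w p)%:E.
have mh : measurable_fun setT h.
  apply/measurable_EFinP; apply: measurable_funM.
    pose k (p : R * (borel E * (R * R))) := ((t - p.1)%R, (x, p.2.1)).
    apply: (@measurableT_comp _ _ _ _ _ _ _ _ k mKt).
    apply: measurable_fun_pair; first exact: measurable_funB.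
    apply: measurable_fun_pair => //; exact: measurableT_comp.
  have mth := @measurable_thinned_mark R _ _ Omega (borel E) T lambda0 lambda1 _ mV.
  exact: (measurableT_comp mth (measurable_pair1 w)).
have h0 p : 0 <= h p by rewrite lee_fin mulr_ge0// thinned_mark_ge0.
transitivity (\int[mrestr (N w) (@measurable_positive_atoms R E T)]_p h p).
  by apply: eq_measure_integral => B mB _; exact: hw.
rewrite integral_mrestr// integral_mkcond [RHS]integral_mkcond.
apply: eq_integral => -[s [y [z u]]] _; rewrite !patchE.
have [pos|npos] := pselect (@positive_atoms R E T (s, (y, (z, u)))); last first.
  rewrite memNset// memNset// => -[/= st hm]; apply: npos; split => //=.
  by move: st; rewrite !in_itv/= => /andP[-> /ltW st]; exact: le_trans st tT.
rewrite mem_set//; have [/= sT [_ [/= z0 u0]]] := pos.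
rewrite !in_itv/= ?andbT in sT z0 u0; have /andP[s0 _] := sT.
have [ts|st] := leP t s.
  rewrite /h KtN ?subr_le0// mul0r memNset// => -[/=]; rewrite in_itv/= => /andP[_ st] _.
  by have := lt_le_trans st ts; rewrite ltxx.
rewrite mem_set; last first.
  by split => /=; [rewrite in_itv/= s0|do !split => //=; rewrite in_itv/= ?andbT].
rewrite /h /thinned_mark /jump_rate /stopped_field /= KtE; last first.
  by rewrite subr_gt0 st (le_trans _ tT)// lerBlDr lerDl ltW.
by rewrite sT z0 u0 !mulr1 mulrA.
Qed.

Unset Implicit Arguments.
Set Strict Implicit.
Set Printing Implicit Defensive.

Theorem theorem5p1 (R : realType)
    (d : measure_display) (Omega : measurableType d) (P : probability Omega R)
    (hP : measure_is_complete P)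
    (T : R) (hT : (0 < T)%R)
    (E : ptopologicalType) (hE : polish R E)
    (m : {finite_measure set (borel E) -> \bar R})
    (l : {measure set R -> \bar R})
    (hl : l [set z | (z <= 0)%R] = 0)
    (hz : \int[l]_(z in `]0%R, +oo[) z%:E < +oo)
    (N : R.-ker Omega ~> (R * (borel E * (R * R)))%type)
    (hN : poisson_random_measure P (@atom_space R E T) (intensity m l) N)
    (K : R -> borel E -> borel E -> R)
    (hK : admissible_kernel T m K)
    (hK' : lebesgue_measure.-integrable `]0%R, T] (dual_majorant m K))
    (lambda0 lambda1 : R) (hlambda0 : (0 <= lambda0)%R)
    (hlambda1 : (0 <= lambda1)%R)
    (phi : R -> borel E -> R) (hphi : bounded_nonneg_borel T phi)
    (V : Omega -> R -> borel E -> \bar R)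
    (hV0 : forall w (t : R) x, (0 <= t <= T)%R -> 0 <= V w t x)
    (hVpred : predictable P N T V)
    (hVfin : forall (t : R) x, (0 <= t <= T)%R -> {ae P, forall w, V w t x < +oo})
    (hVsup : ereal_sup
       [set \int[P]_w V w t x | t in `[0%R, T] & x in [set: borel E]] < +oo)
    (hV : volterra_equation P N T K lambda0 lambda1 phi V)
    (g : R -> borel E -> R) (hg : bounded_nonneg_borel T g)
    (psi : R -> borel E -> R) (hpsi : bounded_nonneg_borel T psi)
    (hpsieq : dual_equation T m l K lambda1 g psi) :
  let I_phi := \int[lebesgue_measure]_(s in `[0%R, T])
    pairing m (EFin \o g s) (EFin \o phi s) in
  let I_psi := \int[lebesgue_measure]_(s in `[0%R, T])
    \int[m]_y ((lambda0 + lambda1 * phi s y)%:E *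
               laplace_exponent l (psi s y)) in
  [/\ I_phi \is a fin_num, I_psi \is a fin_num &
    \int[P]_w expeR (- \int[lebesgue_measure]_(s in `[0%R, T])
                        pairing m (EFin \o g s) (V w s)) =
    expeR (- I_phi - I_psi)].
Proof.
set mu := (@lebesgue_measure R).
have [K0 mK _ KZ] := hK.
have [mphi phi0 phiM] := restrict_time_facts hphi.
have [mg g0 gM] := restrict_time_facts hg.
have [mpsi psi0 psiM] := restrict_time_facts hpsi.
have phiT := @restrict_timeT R E T phi; have gT := @restrict_timeT R E T g.
have psiT := @restrict_timeT R E T psi.
move: mphi phi0 phiM mg g0 gM mpsi psi0 psiM phiT gT psiT.
set phi' := restrict_time T phi; set g' := restrict_time T g; set psi' := restrict_time T psi.
move=> mphi phi0 phiM mg g0 gM mpsi psi0 psiM phiT gT psiT.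
have [l' [N' [nu' [lE NE [hL hZ] nuE hnu]]]] := sigma_finite_model hl hz hN.
have indep (s : R) : (0 <= s <= T)%R -> raw_filtration P N s `<=`
    indep_future P N' [set x | (x.1 <= s)%R] [set x | (s < x.1)%R].
  exact: (raw_filtration_indep hP NE hL hZ).
have TT : (0 <= T <= T)%R by rewrite lexx ltW.
have hF A : raw_filtration P N T A -> measurable A.
  by move=> hA; have [] := indep T TT A hA.
pose V' := stopped_field V T.
have mV : measurable_fun setT V' by exact: (measurable_stopped_field hT hVpred hF).
have V0 p : 0 <= V' p by exact: (stopped_field_ge0 hV0 p (lexx T)).
have hacc k : <<s time_rectangles T (raw_filtration P N) >>
    (accepted T m l' lambda0 lambda1 psi' V' k).
  exact: accepted_history.
have expo (f : R * (borel E * (R * R)) -> R) k mf f0 fT fnu :=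
  @exponential_formula R d _ Omega _ P N' nu' T (raw_filtration P N) f hL hnu
  (@raw_filtration_sigma R E d Omega P N) (@raw_filtration_le R E d Omega P N) indep
  mf f0 fT fnu hT _ (hacc k).
have macc k : measurable (accepted T m l' lambda0 lambda1 psi' V' k).
  have [] // := expo (cst 0%R) k (measurable_cst _) (fun _ => lexx _) (fun _ _ => erefl).
  by rewrite integral0_eq.
have hexp k f mf f0 fT fnu := (expo f k mf f0 fT fnu).2.
pose Kt (r : R) (x y : borel E) : R := if (0 < r <= T)%R then K r x y else 0%R.
have mKt : measurable_fun setT (fun p : R * (borel E * borel E) => Kt p.1 p.2.1 p.2.2).
  have mD : measurable ([set` `]0%R, T]] `*` [set: borel E * borel E]) by exact: measurableX.
  rewrite (_ : (fun p => _) = (fun p => K p.1 p.2.1 p.2.2) \_ (`]0%R, T] `*` setT)).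
    exact/(measurable_restrictT _ mD).
  apply/funext => p; rewrite patchE /Kt; case: ifPn => h.
    by rewrite mem_set//; split => //=; rewrite in_itv.
  by rewrite memNset// => -[/=]; rewrite in_itv/= => h' _; move: h; rewrite h'.
have Kt0 r x y : (0 <= Kt r x y)%R by rewrite /Kt; case: ifP => // /K0.
have KtN (r : R) x y : (r <= 0)%R -> Kt r x y = 0%R.
  by rewrite /Kt leNgt => /negbTE ->.
have KtE (r : R) x y : (0 < r <= T)%R -> Kt r x y = K r x y by rewrite /Kt => ->.
have hz' : \int[l']_(z in `]0%R, +oo[) z%:E < +oo.
  by apply: le_lt_trans hz; rewrite lE.
have V'E w (q : R * borel E) : (0 < q.1 <= T)%R -> V' (w, q) = V w q.1 q.2.
  by rewrite /V' /stopped_field /= => ->.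
have volterra (q : R * borel E) : (0 < q.1 <= T)%R -> {ae P, forall w, V' (w, q) =
    (phi' q)%:E + jump_part N' T lambda0 lambda1 V' Kt (w, q)}.
  case: q => t x /= tT.
  have tT' : (0 <= t <= T)%R by case/andP: tT => /ltW -> ->.
  apply: filterS2 NE (hV t x tT') => w hw VE.
  rewrite V'E// /phi' restrict_timeE//= VE; congr (_ + _); apply/esym.
  exact: (jump_part_version x hw hlambda0 hlambda1 hV0 mV mKt Kt0 KtN KtE tT).
have mM := measurable_mean_effect l' mpsi psi0.
have mM0 := mean_effect_ge0 l' psi0.
have dual (s : R) (y : borel E) : (0 < s <= T)%R -> (psi' (s, y))%:E =
    \int[mu \x m]_q (((g' q)%:E + lambda1%:E * mean_effect l' psi' q) *
      (Kt (q.1 - s) q.2 y)%:E).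
  move=> sT; have /andP[s0 sT'] := sT.
  have mk : measurable_fun setT (fun q : R * borel E => (Kt (q.1 - s) q.2 y)%:E).
    apply/measurable_EFinP.
    apply: (@measurableT_comp _ _ _ _ _ _ _ _ (fun q : R * borel E => ((q.1 - s)%R, (q.2, y))) mKt).
    apply: measurable_fun_pair; first exact: measurable_funB.
    exact: measurable_fun_pair.
  have out (q : R * borel E) : ~ (s < q.1 <= T)%R -> ~ (0 < q.1 <= T)%R \/ Kt (q.1 - s)%R q.2 y = 0%R.
    have [qs _|sq h] := leP q.1 s; first by right; rewrite KtN ?subr_le0.
    left; move=> /andP[_ qT]; apply: h; exact/andP.
  have inn (r : R) : (s < r <= T)%R -> (0 < r <= T)%R /\ (0 < r - s <= T)%R.
    move=> /andP[sr rT]; rewrite (lt_trans s0 sr) rT subr_gt0 sr; split => //=.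
    by apply: le_trans rT; rewrite lerBlDr lerDl ltW.
  have E1 : dual_source T m K g s y = \int[mu \x m]_q ((g' q)%:E * (Kt (q.1 - s) q.2 y)%:E).
    apply: integral_time_product.
    - by apply: emeasurable_funM => //; exact/measurable_EFinP.
    - by move=> q; rewrite mule_ge0 ?lee_fin.
    - by move=> q /out [/gT ->|->]; rewrite ?mul0e ?mule0.
    - by move=> r x /inn [rT rs]; rewrite -EFinM /g' restrict_timeE// KtE.
  have E2 : \int[mu]_(r in `[s, T]) \int[m]_y'
      ((K (r - s) y' y)%:E * laplace_exponent l (psi r y')) =
      \int[mu \x m]_q (mean_effect l' psi' q * (Kt (q.1 - s) q.2 y)%:E).
    apply: integral_time_product.
    - exact: emeasurable_funM.
    - by move=> q; rewrite mule_ge0 ?lee_fin.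
    - by move=> q /out [/(mean_effectT l' psiT) ->|->]; rewrite ?mul0e ?mule0.
    - move=> r x /inn [rT rs]; rewrite muleC /mean_effect /psi' restrict_timeE// KtE//=.
      by rewrite lE.
  have -> : psi' (s, y) = psi s y by rewrite /psi' restrict_timeE.
  rewrite hpsieq; last by rewrite sT' ltW.
  rewrite E1 E2.
  rewrite integral_product_combination//.
  - apply: eq_integral => q _; rewrite [RHS](@ge0_muleDl _ (Kt (q.1 - s)%R q.2 y)%:E (g' q)%:E)
      ?mule_ge0 ?lee_fin//.
    by rewrite muleA.
  - by apply: emeasurable_funM => //; exact/measurable_EFinP.
  - exact: emeasurable_funM.
  - by move=> q; rewrite mule_ge0 ?lee_fin.
  - by move=> q; rewrite mule_ge0 ?lee_fin.
have hEV : exists M : R, forall q : R * borel E, (0 < q.1 <= T)%R -> \int[P]_w V' (w, q) <= M%:E.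
  set S := ereal_sup _ in hVsup; exists (fine S) => q qT.
  apply: (@le_trans _ _ S); last by case: S hVsup => //=; rewrite leNye.
  apply: ereal_sup_ubound; exists q.1; first by rewrite /= in_itv/=; case/andP: qT => /ltW -> ->.
  by exists q.2 => //; apply: eq_integral => w _; rewrite V'E.
have main := volterra_laplace hT hz' hlambda0 hlambda1 mpsi psi0 psiT psiM mV V0 nuE macc hnu hexp
  mKt Kt0 KtN mg g0 gT gM mphi phi0 phiM volterra dual hEV.
have Iphi_fin := initial_pairing_lty m hT mg g0 gT gM mphi phi0 phiM.
have base_fin := base_rate_lty m hT hz' hlambda0 hlambda1 mpsi psi0 psiT psiM mphi phi0 phiM.
have IphiE : \int[mu]_(s in `[0%R, T]) pairing m (EFin \o g s) (EFin \o phi s) =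
    \int[mu \x m]_q (g' q * phi' q)%:E.
  apply: integral_time_product.
  - by apply/measurable_EFinP; exact: measurable_funM.
  - by move=> q; rewrite lee_fin mulr_ge0.
  - by move=> q /gT ->; rewrite mul0r.
  - by move=> s y sT /=; rewrite /g' /phi' !restrict_timeE.
have IpsiE : \int[mu]_(s in `[0%R, T]) \int[m]_y ((lambda0 + lambda1 * phi s y)%:E *
    laplace_exponent l (psi s y)) = base_rate m l' lambda0 lambda1 psi' phi'.
  apply: integral_time_product.
  - apply: emeasurable_funM => //; apply/measurable_EFinP; apply: measurable_funD => //.
    exact: measurable_funM.
  - by move=> q; rewrite mule_ge0 ?lee_fin ?addr_ge0 ?mulr_ge0.
  - by move=> q /(mean_effectT l' psiT) ->; rewrite mule0.
  - by move=> s y sT; rewrite /mean_effect /psi' /phi' !restrict_timeE//= lE.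
have IVE w : \int[mu]_(s in `[0%R, T]) pairing m (EFin \o g s) (V w s) =
    \int[mu \x m]_q ((g' q)%:E * V' (w, q)).
  apply: integral_time_product.
  - apply: emeasurable_funM; first exact/measurable_EFinP.
    exact: (measurableT_comp mV (measurable_pair1 w)).
  - by move=> q; rewrite mule_ge0 ?lee_fin.
  - by move=> q /gT ->; rewrite mul0e.
  - by move=> s y sT; rewrite V'E// /g' restrict_timeE.
have Iphi0 : 0 <= \int[mu \x m]_q (g' q * phi' q)%:E.
  by apply: integral_ge0 => q _; rewrite lee_fin mulr_ge0.
have base0 : 0 <= base_rate m l' lambda0 lambda1 psi' phi'.
  exact: (base_rate_ge0 m l' hlambda0 hlambda1 psi0 phi0).
move=> I_phi I_psi; rewrite /I_phi /I_psi IphiE IpsiE.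
have f1 : \int[mu \x m]_q (g' q * phi' q)%:E \is a fin_num by rewrite ge0_fin_numE.
have f2 : base_rate m l' lambda0 lambda1 psi' phi' \is a fin_num by rewrite ge0_fin_numE.
split => //.
transitivity (\int[P]_w expN (\int[mu \x m]_q ((g' q)%:E * V' (w, q)))).
  by apply: eq_integral => w _; rewrite /expN IVE.
by rewrite main /expN oppeD ?ge0_adde_def ?inE.
Qed.
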